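(* Let $\varrho_1,\varrho_2$ be proximate orders with orders $\rho_1,\rho_2>0$ such that $r^{\varrho_1(r)}=O(r^{\varrho_2(r)})$ as $r\to\infty$. Let $\hat\varrho_1$ be a normalized proximate order with $\hat\varrho_1(r)=\varrho_1(r)$ for all sufficiently large $r$. Then: (a) If $\{u_\ell\}_{\ell\in\mathbb{N}_0}\subseteq\mathcal{SM}_L(\mathbb{R}^{n+1})$ satisfies $$\forall\sigma>0\ \exists\varepsilon,C>0\ \forall\ell\in\mathbb{N}_0:\quad \|u_\ell\|_{\varrho_2,\sigma}\le C\frac{G_{\hat\varrho_1,\ell}}{\ell!}\varepsilon^\ell,$$ then for every $f\in A_{\varrho_1,+0}$ the series $Tf:=\sum_{\ell=0}^\infty u_\ell\star_L\partial_{x_0}^\ell f$ converges in $A_{\varrho_2,+0}$, and $T:A_{\varrho_1,+0}\to A_{\varrho_2,+0}$ is continuous. (b) Conversely, every continuous right $\mathbb{R}_n$-linear operator $T:A_{\varrho_1,+0}\to A_{\varrho_2,+0}$ is of the form $Tf=\sum_{\ell=0}^\infty u_\ell\star_L\partial_{x_0}^\ell f$ for some sequence $\{u_\ell\}$ satisfying the condition in (a).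
   Context: $\mathbb{R}_n$ is the real Clifford algebra generated by $e_1,\dots,e_n$ with $e_ie_j=-e_je_i$ ($i\neq j$), $e_i^2=-1$, with Euclidean norm $|a|^2=\sum_Aa_A^2$ for $a=\sum_Aa_Ae_A$. Paravectors $x=x_0+\sum_{\ell=1}^nx_\ell e_\ell$ are identified with $\mathbb{R}^{n+1}$, and $\mathbb{S}=\{\sum x_\ell e_\ell:\sum x_\ell^2=1\}$. $f:\mathbb{R}^{n+1}\to\mathbb{R}_n$ is (entire) left slice monogenic, $f\in\mathcal{SM}_L(\mathbb{R}^{n+1})$, if $f(u+jv)=f_0(u,v)+jf_1(u,v)$ for all $u,v\in\mathbb{R}$, $j\in\mathbb{S}$, with $f_0,f_1$ continuously differentiable, $f_0(u,-v)=f_0(u,v)$, $f_1(u,-v)=-f_1(u,v)$, $\partial_uf_0=\partial_vf_1$, $\partial_vf_0=-\partial_uf_1$. Star product: $f\star_Lg=f_0g_0-f_1g_1+j(f_1g_0+f_0g_1)$. $\partial_{x_0}$ is the partial derivative in $x_0$. A proximate order is a differentiable $\varrho:[0,\infty)\to[0,\infty)$ with $\lim_{r\to\infty}\varrho(r)=\rho>0$ and $\lim_{r\to\infty}\varrho'(r)r\ln r=0$; it is normalized if $r\mapsto r^{\varrho(r)}$ is strictly increasing on $(0,\infty)$ and tends to $0$ as $r\to0^+$; then $\varphi$ is the inverse of $r\mapsto r^{\varrho(r)}$ and $G_{\varrho,0}=1$, $G_{\varrho,\ell}=\varphi(\ell)^\ell/(e\rho)^{\ell/\rho}$. For $\sigma>0$,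 $A_{\varrho,\sigma}=\{f\in\mathcal{SM}_L(\mathbb{R}^{n+1}):\|f\|_{\varrho,\sigma}:=\sup_x|f(x)|e^{-\sigma|x|^{\varrho(|x|)}}<\infty\}$. $A_{\varrho,+0}=\bigcap_{\epsilon>0}A_{\varrho,\epsilon}$ with the projective limit topology given by all norms $\|\cdot\|_{\varrho,\epsilon}$, $\epsilon>0$. *)

(* Defs.v *)
From HB Require Import structures.
From mathcomp Require Import all_boot all_order all_algebra.
From mathcomp Require Import all_classical all_reals all_analysis.
From Stdlib Require Import ClassicalEpsilon.
Set Implicit Arguments. Unset Strict Implicit. Unset Printing Implicit Defensive.
Import Order.TTheory GRing.Theory Num.Theory.
Import numFieldNormedType.Exports.

Local Open Scope ring_scope.

Section Defs.
Variable R : realType.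
Variable n : nat.

(** ** The real Clifford algebra R_n.
    Generators e_1..e_n are indexed by 'I_n; a basis element e_A by a subset
    A of 'I_n (e_A = e_{i1}...e_{ik}, i1<...<ik, e_emptyset = 1). *)
Definition Cl := {ffun {set 'I_n} -> R}.

(* e_A e_B = (-1)^(#{(i,j) : i in A, j in B, j < i} + #(A :&: B)) e_(A Delta B),
   which encodes e_i e_j = - e_j e_i (i<>j) and e_i^2 = -1. *)
Definition clsign (A B : {set 'I_n}) : R :=
  (-1) ^+ (#|[set p : 'I_n * 'I_n | (p.1 \in A) && (p.2 \in B) && (p.2 < p.1)%N]|
           + #|A :&: B|).

Definition symdiff (A B : {set 'I_n}) : {set 'I_n} := (A :\: B) :|: (B :\: A).

Definition cladd (a b : Cl) : Cl := [ffun C => a C + b C].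
Definition clopp (a : Cl) : Cl := [ffun C => - a C].
Definition clzero : Cl := [ffun _ => 0].
Definition clmul (a b : Cl) : Cl :=
  [ffun C => \sum_(A : {set 'I_n}) \sum_(B : {set 'I_n} | symdiff A B == C)
               clsign A B * a A * b B].
Definition clscale (r : R) (a : Cl) : Cl := [ffun C => r * a C].
Definition clsum (N : nat) (a : nat -> Cl) : Cl := [ffun C => \sum_(l < N) a l C].

Definition clnorm (a : Cl) : R := Num.sqrt (\sum_(A : {set 'I_n}) a A ^+ 2).

(** ** Paravectors x = x_0 + sum_l x_l e_l, identified with R^{n+1}. *)
Definition para := (R * ('I_n -> R))%type.

Definition pnorm (x : para) : R := Num.sqrt (x.1 ^+ 2 + \sum_(l < n) x.2 l ^+ 2).

Definition para2cl (x : para) : Cl :=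
  [ffun A : {set 'I_n} => if #|A| == 0%N then x.1
             else if [pick l | A == finset.set1 l] is Some l then x.2 l else 0].

Definition inS (j : 'I_n -> R) : Prop := \sum_(l < n) j l ^+ 2 = 1.

Definition slicept (u v : R) (j : 'I_n -> R) : para := (u, fun l => v * j l).

Definition jcl (j : 'I_n -> R) : Cl := para2cl (0, j).

Definition derive_u (g : R -> R -> R) (u v : R) : R := derive1 (fun t => g t v) u.
Definition derive_v (g : R -> R -> R) (u v : R) : R := derive1 (fun t => g u t) v.

Definition C1_2 (g : R -> R -> R) : Prop :=
  (forall u v, derivable (fun t => g t v) u 1 /\ derivable (fun t => g u t) v 1) /\
  continuous (fun p : R * R => derive_u g p.1 p.2) /\
  continuous (fun p : R * R => derive_v g p.1 p.2).

Definition slice_decomp (f : para -> Cl) (f0 f1 : R -> R -> Cl) : Prop :=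
  forall u v j, inS j -> f (slicept u v j) = cladd (f0 u v) (clmul (jcl j) (f1 u v)).

Definition slice_components (f : para -> Cl) (f0 f1 : R -> R -> Cl) : Prop :=
  slice_decomp f f0 f1 /\
  (forall A, C1_2 (fun u v => f0 u v A)) /\
  (forall A, C1_2 (fun u v => f1 u v A)) /\
  (forall u v, f0 u (- v) = f0 u v) /\
  (forall u v, f1 u (- v) = clopp (f1 u v)) /\
  (forall A u v, derive_u (fun u v => f0 u v A) u v = derive_v (fun u v => f1 u v A) u v) /\
  (forall A u v, derive_v (fun u v => f0 u v A) u v = - derive_u (fun u v => f1 u v A) u v).

Definition SM_L (f : para -> Cl) : Prop := exists f0 f1, slice_components f f0 f1.

Definition comps (f : para -> Cl) : (R -> R -> Cl) * (R -> R -> Cl) :=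
  epsilon (inhabits ((fun _ _ => clzero), (fun _ _ => clzero)))
          (fun p => slice_components f p.1 p.2).

(* a representation x = u + j v with j in S (when x is not real, u = x_0,
   v = |x'|, j = x'/|x'|; when x is real, v = 0 and j is irrelevant) *)
Definition xv (x : para) : R := Num.sqrt (\sum_(l < n) x.2 l ^+ 2).
Definition xj (x : para) : 'I_n -> R := fun l => x.2 l / xv x.

Definition starL (f g : para -> Cl) (x : para) : Cl :=
  let f0 := (comps f).1 in let f1 := (comps f).2 in
  let g0 := (comps g).1 in let g1 := (comps g).2 in
  let u := x.1 in let v := xv x in
  cladd (cladd (clmul (f0 u v) (g0 u v)) (clopp (clmul (f1 u v) (g1 u v))))
        (clmul (jcl (xj x)) (cladd (clmul (f1 u v) (g0 u v)) (clmul (f0 u v) (g1 u v)))).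

Definition dx0 (f : para -> Cl) : para -> Cl :=
  fun x => [ffun A => derive1 (fun t => f (t, x.2) A) x.1].

Definition dx0n (l : nat) (f : para -> Cl) : para -> Cl := iter l dx0 f.

Local Open Scope classical_set_scope.
Local Open Scope ring_scope.
Definition prox_order (rho : R -> R) (rhoinf : R) : Prop :=
  (forall r, 0 <= r -> 0 <= rho r) /\
  (forall r, 0 < r -> derivable rho r 1) /\
  cvg ((fun h => h^-1 * (rho h - rho 0)) @ 0^'+) /\
  0 < rhoinf /\
  rho r @[r --> +oo] --> rhoinf /\
  (derive1 rho r * r * ln r) @[r --> +oo] --> (0 : R).

Definition normalized_prox_order (rho : R -> R) (rhoinf : R) : Prop :=
  prox_order rho rhoinf /\
  (forall r s, 0 < r -> r < s -> powR r (rho r) < powR s (rho s)) /\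
  powR r (rho r) @[r --> 0^'+] --> (0 : R).

Definition phi (rho : R -> R) (s : R) : R :=
  epsilon (inhabits 0) (fun r => 0 < r /\ powR r (rho r) = s).

Definition Gcoef (rho : R -> R) (rhoinf : R) (l : nat) : R :=
  if l == 0%N then 1
  else phi rho l%:R ^+ l / powR (expR 1 * rhoinf) (l%:R / rhoinf).

Definition weight (rho : R -> R) (sigma : R) (x : para) : R :=
  expR (- sigma * powR (pnorm x) (rho (pnorm x))).

Definition wnorm (rho : R -> R) (sigma : R) (f : para -> Cl) : \bar R :=
  ereal_sup (range (fun x => (clnorm (f x) * weight rho sigma x)%:E)).

Definition inA (rho : R -> R) (sigma : R) (f : para -> Cl) : Prop :=
  SM_L f /\ (wnorm rho sigma f < +oo)%E.

Definition inA0 (rho : R -> R) (f : para -> Cl) : Prop :=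
  forall eps, 0 < eps -> inA rho eps f.

Definition fsub (f g : para -> Cl) : para -> Cl := fun x => cladd (f x) (clopp (g x)).

Definition cvgA0 (rho : R -> R) (S : nat -> para -> Cl) (g : para -> Cl) : Prop :=
  forall eps, 0 < eps -> (wnorm rho eps (fsub (S N) g) @[N --> \oo] --> 0%E).

(* continuity of T : A_{rho1,+0} -> A_{rho2,+0}; since the seminorms
   ||.||_{rho,eps} decrease as eps increases, the balls for a single seminorm
   form a neighbourhood basis of the projective limit topology *)
Definition contA0 (rho1 rho2 : R -> R) (T : (para -> Cl) -> (para -> Cl)) : Prop :=
  forall f, inA0 rho1 f ->
  forall eps2 delta, 0 < eps2 -> 0 < delta ->
  exists eps1 eta, 0 < eps1 /\ 0 < eta /\
    forall g, inA0 rho1 g -> (wnorm rho1 eps1 (fsub g f) < eta%:E)%E ->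
      (wnorm rho2 eps2 (fsub (T g) (T f)) < delta%:E)%E.

Definition rlinA0 (rho1 : R -> R) (T : (para -> Cl) -> (para -> Cl)) : Prop :=
  (forall f g, inA0 rho1 f -> inA0 rho1 g ->
     forall x, T (fun y => cladd (f y) (g y)) x = cladd (T f x) (T g x)) /\
  (forall f a, inA0 rho1 f ->
     forall x, T (fun y => clmul (f y) a) x = clmul (T f x) a).

Definition ucond (rho2 rhohat : R -> R) (rhohatinf : R) (u : nat -> para -> Cl) : Prop :=
  (forall l, SM_L (u l)) /\
  forall sigma, 0 < sigma -> exists eps C, 0 < eps /\ 0 < C /\
    forall l, (wnorm rho2 sigma (u l) <=
               (C * Gcoef rhohat rhohatinf l / (l`!)%:R * eps ^+ l)%:E)%E.

Definition psum (u : nat -> para -> Cl) (f : para -> Cl) (N : nat) : para -> Cl :=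
  fun x => clsum N (fun l => starL (u l) (dx0n l f) x).

End Defs.

(* Main.v *)
(* A slice monogenic f is given by 2^n entire functions of one complex variable commuting with
   conjugation, one for each basis blade; its components therefore have real Taylor coefficients,
   the star product is a twisted convolution of the families and d/dx_0 is complex differentiation.
   Weighted sup bounds on f and Cauchy bounds on its coefficients are equivalent up to a constant
   and an arbitrarily small loss in the type. Write V_i(r) = r^(rho_i(r)) and hatV for the
   normalized V_1, so that phi inverts hatV.

   (a) Cauchy's estimate for the l-th derivative of f is taken on the disc of radius M phi(l)
   around x: the factor phi(l)^l cancels the one in G_l, while hatV(2 M phi(l)) = O(l), so that a
   large M and then a small type make the l-th term of the series O(2^-l) in the weight of V_2.

   (b) Put p_k = T(x^k) and u_l = (1/l!) sum_k C(l,k) p_k * (-x)^(l-k). By binomial inversion the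
   series reproduces T on Taylor polynomials, which converge to f in the projective topology, so
   continuity of both operators concludes. The bound on u_l comes from |x^k| <= C D^k phi(k)^k in
   every weight, the continuity of T, and phi(k)^k phi(m)^m <= phi(k+m)^(k+m). *)
Require Import Defs.
From HB Require Import structures.
From mathcomp Require Import all_boot all_order all_algebra.
From mathcomp Require Import complex.
From mathcomp Require Import all_classical all_reals all_analysis.
From mathcomp Require Import ring lra.
Import Order.TTheory GRing.Theory Num.Theory.
Import numFieldNormedType.Exports.
Import ComplexField.Normc.
Set Implicit Arguments.
Unset Strict Implicit.
Unset Printing Implicit Defensive.
Local Open Scope classical_set_scope.
Local Open Scope ring_scope.

(** All growth estimates pass through bounds on Taylor coefficients valid at every radius at once,
    [|a_k| * r ^ k <= B * expR (e * V r)]. Such bounds are linear in [B], survive coefficientwise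
    limits, and always sum to an entire function, so limits of slice monogenic functions need no
    separate regularity argument. Passing from coefficients back to functions costs a factor 2 in
    the radius, absorbed by [V (2 * r) <= K * (V r + 1)] and a smaller type. The additive 1 is
    unavoidable: on bounded radii the functions [V] are merely bounded, and different orders compare
    only up to constants; it ends up in the constant in front. Almost all limits are taken at the
    single rate [2 ^ -N]: an inequality with error [E * 2 ^ -N] for all N holds without the error,
    and this replaces most topological arguments. The star product is defined from chosen components
    f0, f1, so computing it requires their uniqueness: they are recovered from the values of f at u
    + jv and u - jv for one fixed imaginary unit j, which exists because n > 0. *)

Lemma mvt_total (R : realType) (f : R -> R) (x y : R) :
  (forall t, derivable f t 1) ->
  exists2 c, `|c - x| <= `|y - x| & f y - f x = derive1 f c * (y - x).
Proof.
move=> df.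
have dfc (z : R) : is_derive z (1:R) f (derive1 f z) by rewrite derive1E; apply: derivableP; exact: df.
have cf : continuous f by move=> z; apply: differentiable_continuous; apply/derivable1_diffP; exact: df.
have cfw (A : set R) : {within A, continuous f} by exact: continuous_subspaceT.
have [xy|yx|->] := ltgtP x y.
- have [c] := MVT xy (fun z _ => dfc z) (cfw _).
  rewrite in_itv/= => /andP[xc cy] e; exists c => //.
  by rewrite !ger0_norm; lra.
- have [c] := MVT yx (fun z _ => dfc z) (cfw _).
  rewrite in_itv/= => /andP[xc cy] e; exists c.
    by rewrite !ler0_norm; lra.
  by rewrite -opprB e -mulrN opprB.
- by exists y; rewrite ?subrr ?mulr0// subrr.
Qed.

(** * Cauchy's formula and Taylor expansion *)

Section C1.
Variable R : realType.
Implicit Types (g : R -> R -> R) (a b : R -> R).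

(** One coordinate is moved at a time and the mean value theorem is applied to each move. The
    intermediate points are chosen as functions of the endpoints, so that they can be passed to the
    limit along a filter. *)
Lemma C1_increment g : C1_2 g ->
  exists xi eta : R -> R -> R -> R -> R,
    forall x y x' y',
      [/\ `|xi x y x' y' - x| <= `|x' - x|, `|eta x y x' y' - y| <= `|y' - y| &
       g x' y' - g x y = derive_u g (xi x y x' y') y' * (x' - x)
                        + derive_v g x (eta x y x' y') * (y' - y)].
Proof.
case=> dg _.
have H1 (p : R * R * R * R) : exists c, `|c - p.1.1.1| <= `|p.1.2 - p.1.1.1| /\
   g p.1.2 p.2 - g p.1.1.1 p.2 = derive_u g c p.2 * (p.1.2 - p.1.1.1).
  have [c c1 c2] := @mvt_total R (fun t => g t p.2) p.1.1.1 p.1.2 (fun t => (dg t p.2).1).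
  by exists c.
have H2 (p : R * R * R * R) : exists c, `|c - p.1.1.2| <= `|p.2 - p.1.1.2| /\
   g p.1.1.1 p.2 - g p.1.1.1 p.1.1.2 = derive_v g p.1.1.1 c * (p.2 - p.1.1.2).
  have [c c1 c2] := @mvt_total R (fun t => g p.1.1.1 t) p.1.1.2 p.2 (fun t => (dg p.1.1.1 t).2).
  by exists c.
have [xi Hxi] := choice H1; have [eta Heta] := choice H2.
exists (fun x y x' y' => xi (x, y, x', y')), (fun x y x' y' => eta (x, y, x', y')).
move=> x y x' y'.
have [/= h1 h2] := Hxi (x, y, x', y'); have [/= h3 h4] := Heta (x, y, x', y').
by split => //; rewrite -h2 -h4; ring.
Qed.

(** The factor [c] is left abstract to serve twice: [c = 1] gives joint continuity, [c = h^-1] gives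
    the chain rule. The intermediate points are squeezed to [x] and [y], where the partial
    derivatives are continuous. *)
Lemma C1_chain_cvg g (T : Type) (F : set_system T) (FF : Filter F)
    (x y dx dy : R) (a b c : T -> R) : C1_2 g ->
  a t @[t --> F] --> x -> b t @[t --> F] --> y ->
  (a t - x) * c t @[t --> F] --> dx -> (b t - y) * c t @[t --> F] --> dy ->
  (g (a t) (b t) - g x y) * c t @[t --> F]
    --> derive_u g x y * dx + derive_v g x y * dy.
Proof.
move=> g1 ax bx cdx cdy.
have [xi [eta H]] := C1_increment g1.
have [_ [cu cv]] := g1.
have sq (h k : T -> R) (z : R) : (forall t, `|h t - z| <= `|k t - z|) ->
    k t @[t --> F] --> z -> h t @[t --> F] --> z.
  move=> hk /cvgrPdist_le kz; apply/cvgrPdist_le => e e0.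
  by apply: filterS (kz e e0) => t; rewrite ![`|z - _|]distrC => /(le_trans (hk t)).
have xix : xi x y (a t) (b t) @[t --> F] --> x.
  by apply: (sq _ _ _ _ ax) => t; have [] := H x y (a t) (b t).
have etay : eta x y (a t) (b t) @[t --> F] --> y.
  by apply: (sq _ _ _ _ bx) => t; have [] := H x y (a t) (b t).
rewrite (_ : (fun t => _) = fun t => derive_u g (xi x y (a t) (b t)) (b t) * ((a t - x) * c t)
   + derive_v g x (eta x y (a t) (b t)) * ((b t - y) * c t)); last first.
  by apply/funext => t; have [_ _ ->] := H x y (a t) (b t); ring.
apply: cvgD; apply: cvgM => //.
  have := cu (x, y); rewrite /continuous_at/= => cxy.
  apply: (cvg_comp (fun t => (xi x y (a t) (b t), b t)) (fun p => derive_u g p.1 p.2)) cxy.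
  by apply: (@cvg_pair _ _ _ F (nbhs x) (nbhs y)).
have := cv (x, y); rewrite /continuous_at/= => cxy.
apply: (cvg_comp (fun t => (x, eta x y (a t) (b t))) (fun p => derive_v g p.1 p.2)) cxy.
by apply: (@cvg_pair _ _ _ F (nbhs x) (nbhs y)) => //; exact: cvg_cst.
Qed.

Lemma C1_continuous g : C1_2 g -> continuous (fun p : R * R => g p.1 p.2).
Proof.
move=> g1 [x y]; rewrite /continuous_at/=.
have := @C1_chain_cvg g _ (nbhs (x, y)) _ x y 0 0 fst snd (cst 1) g1.
rewrite !mulr0 addr0 => /(_ _ cvg_fst cvg_snd) H.
have h (f : R * R -> R) z : f p @[p --> nbhs (x, y)] --> z ->
    (f t - z) * cst 1 t @[t --> nbhs (x, y)] --> 0.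
  by under [in X in _ -> X]eq_fun do rewrite mulr1; move=> /subr_cvg0.
have e : (fun t : R * R => (g t.1 t.2 - g x y) * cst 1 t) = (fun t => g t.1 t.2 - g x y).
  by apply/funext => t; rewrite mulr1.
have {}H : g t.1 t.2 - g x y @[t --> nbhs (x, y)] --> 0.
  by rewrite -e; apply: H; apply: h; [exact: cvg_fst|exact: cvg_snd].
have K : g t.1 t.2 - g x y + g x y @[t --> nbhs (x, y)] --> 0 + g x y.
  by apply: cvgD; [exact: H|exact: cvg_cst].
rewrite add0r in K; rewrite (_ : (fun p : R * R => _) = fun t => g t.1 t.2 - g x y + g x y)//.
by apply/funext => t /=; rewrite subrK.
Qed.

Lemma C1_chain g a b (s da db : R) : C1_2 g ->
  is_derive s 1 a da -> is_derive s 1 b db ->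
  is_derive s 1 (fun s => g (a s) (b s))
    (derive_u g (a s) (b s) * da + derive_v g (a s) (b s) * db).
Proof.
move=> g1 Da Db.
have E (f : R -> R) df : is_derive s 1 f df ->
    (f (h + s) - f s) * h^-1 @[h --> 0^'] --> df.
  move=> [fd fE]; rewrite -fE.
  move: fd; rewrite /derivable /derive => /cvg_ex [l Hl].
  have := cvg_lim (@norm_hausdorff _ _) Hl => ->; apply: cvg_trans Hl.
  apply: cvg_trans (_ : (fun h => h^-1 *: ((f \o shift s) (h *: 1) - f s)) @ 0^' `=>` _); last by [].
  by apply: near_eq_cvg; near=> h; rewrite /= /GRing.scale/= mulr1 mulrC.
have C (f : R -> R) df : is_derive s 1 f df -> f (h + s) @[h --> 0^'] --> f s.
  move=> [fd _]; have : {for s, continuous f}.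
    by apply: differentiable_continuous; apply/derivable1_diffP.
  move=> fs. apply: (cvg_comp (fun h => h + s) f _ fs).
  suff : h + s @[h --> 0^'] --> 0 + s by rewrite add0r.
  by apply: cvgD; [exact: cvg_within|exact: cvg_cst].
have H : (g (a (h + s)) (b (h + s)) - g (a s) (b s)) * h^-1 @[h --> 0^'] -->
    derive_u g (a s) (b s) * da + derive_v g (a s) (b s) * db.
  by apply: C1_chain_cvg => //; [exact: C Da|exact: C Db|exact: E|exact: E].
have H' : h^-1 *: (((fun s => g (a s) (b s)) \o shift s) (h *: 1) - g (a s) (b s)) @[h --> 0^']
   --> derive_u g (a s) (b s) * da + derive_v g (a s) (b s) * db.
  apply: cvg_trans H; apply: near_eq_cvg; near=> h.
  by rewrite /= /GRing.scale/= mulr1 mulrC.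
apply: DeriveDef; first by apply/cvg_ex; eexists; exact: H'.
by apply: cvg_lim => //.
Unshelve. all: by end_near. Qed.
End C1.

(** * Integrals over [0, 2 pi] and their dependence on a parameter *)

Section CircleIntegral.
Variable R : realType.
Implicit Types (f g : R -> R).

Definition cint f : R := \int[lebesgue_measure]_(x in `[0, 2 * pi]) f x.

Lemma twopi_gt0 : 0 < 2 * pi :> R.
Proof. by rewrite mulr_gt0 ?pi_gt0. Qed.

Lemma cint_integrable f : continuous f ->
  lebesgue_measure.-integrable (`[0, 2 * pi] : set R) (EFin \o f).
Proof.
move=> cf; apply: continuous_compact_integrable; first exact: segment_compact.
exact: continuous_subspaceT.
Qed.

Lemma measurable_circle : measurable (`[0, 2 * pi]%classic : set R).
Proof. exact: measurable_itv. Qed.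

Lemma cintD f g : continuous f -> continuous g ->
  cint (fun x => f x + g x) = cint f + cint g.
Proof.
move=> cf cg; rewrite /cint RintegralD//; exact: cint_integrable.
Qed.

Lemma cintZ (c : R) f : continuous f -> cint (fun x => c * f x) = c * cint f.
Proof.
move=> cf; rewrite /cint RintegralZl//; exact: cint_integrable.
Qed.

Lemma cint_cst (c : R) : cint (fun=> c) = c * (2 * pi).
Proof.
rewrite /cint Rintegral_cst; last exact: measurable_circle.
have /= := lebesgue_measure_itv `[0, 2 * pi : R].
by rewrite lte_fin twopi_gt0 => ->; rewrite -EFinB subr0.
Qed.

Lemma cint_le f (B : R) : continuous f -> (forall x, x \in `[0, 2 * pi] -> `|f x| <= B) ->
  `|cint f| <= B * (2 * pi).
Proof.
move=> cf fB; have H := @le_normr_Rintegral _ _ _ lebesgue_measure _ _ measurable_circle (cint_integrable cf).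
apply: le_trans H _; rewrite -cint_cst; apply: le_Rintegral => //.
- apply: cint_integrable => x; apply: (@continuous_comp _ _ _ f Num.norm); [exact: cf|exact: norm_continuous].
- by apply: cint_integrable; exact: cst_continuous.
Qed.

Lemma is_derive_continuous f g : (forall x : R, is_derive x (1 : R) f (g x)) -> continuous f.
Proof.
move=> D x; have [d _] := D x.
by apply: differentiable_continuous; apply/derivable1_diffP.
Qed.

Lemma cint_FTC f F : continuous f -> (forall x : R, is_derive x (1 : R) F (f x)) ->
  cint f = F (2 * pi) - F 0.
Proof.
move=> cf D; have cF := is_derive_continuous D.
rewrite /cint /Rintegral (@continuous_FTC2 _ f F)//.
- exact: twopi_gt0.
- exact: continuous_subspaceT.
- split; [by move=> x _; have [] := D x|exact/cvg_at_right_filter/cF|exact/cvg_at_left_filter/cF].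
- by move=> x _; have [_ <-] := D x; rewrite derive1E.
Qed.

Lemma continuous_pair_r (D : R -> R -> R) t : continuous (fun p : R * R => D p.1 p.2) ->
  continuous (D t).
Proof.
move=> cD x; apply: (cvg_comp (fun x => (t, x)) (fun p => D p.1 p.2) _ (cD (t, x))).
by apply: (@cvg_pair _ _ _ (nbhs x) (nbhs t) (nbhs x)) => //; exact: cvg_cst.
Qed.

(** The homotopy argument behind Cauchy's theorem. [D] is the derivative of [G] in the parameter,
    and [t * D t] is the derivative in x of the periodic [H t]; hence [t] times the derivative of
    the integral of [G t] vanishes. The factor [t] reflects that the loops shrink to a point at
    [t = 0]. *)
Lemma cint_param_const (G D H : R -> R -> R) :
  (forall t, continuous (G t)) ->
  continuous (fun p : R * R => D p.1 p.2) ->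
  (forall t x : R, is_derive t (1 : R) (G ^~ x) (D t x)) ->
  (forall t x : R, is_derive x (1 : R) (H t) (t * D t x)) ->
  (forall t, H t (2 * pi) = H t 0) ->
  cint (G 1) = cint (G 0).
Proof.
move=> cG cD dG dH perH.
(* The open interval from -1 to 2 contains [0, 1], so the integral is differentiable, hence
   continuous, at both endpoints. Its closure is compact, which yields the dominating constant. *)
have [B HB] : exists B : R, forall t x : R, t \in `]-1, 2[ -> x \in `[0, 2 * pi] -> `|D t x| <= B.
  have cpt : compact (`[-1, 2]%classic `*` `[0, 2 * pi]%classic : set (R * R)).
    by apply: compact_setX; exact: segment_compact.
  have := @continuous_compact _ _ _ _ (continuous_subspaceT cD) cpt.
  move=> /compact_bounded [M [Mr HM]]; exists (M + 1) => t x ti xi.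
  apply: (HM (M + 1)); first by rewrite ltrDl.
  exists (t, x) => //; split => //=.
  by move: ti; rewrite !in_itv/= => /andP[/ltW -> /ltW ->].
have der (t : R) : t \in `]-1, 2[ -> is_derive t (1 : R) (fun t => cint (G t)) (cint (D t)).
  move=> ti.
  have Hc : h^-1 *: (cint (G (h + t)) - cint (G t)) @[h --> 0^'] --> cint (D t).
    have pE x y : partial1of2 G x y = D x y.
      by rewrite partial1of2E; have [_ ->] := dG x y.
    rewrite (_ : cint (D t) = \int[lebesgue_measure]_(y in `[0, 2 * pi]) partial1of2 G t y); last first.
      by apply: eq_Rintegral => y _; rewrite pE.
    apply: (@cvg_differentiation_under_integral R _ _ lebesgue_measure G _ measurable_circle
      t (-1) 2 _ _ _ (fun=> `|B|)) => //.
    - by move=> x _; exact: cint_integrable.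
    - by apply: cint_integrable; exact: cst_continuous.
    - by move=> x y xi yi; rewrite pE (le_trans (HB _ _ xi yi))// ler_norm.
  have Hc' : h^-1 *: (((fun t => cint (G t)) \o shift t) (h *: 1) - cint (G t)) @[h --> 0^'] --> cint (D t).
    apply: cvg_trans Hc; apply: near_eq_cvg; near=> h.
    by rewrite /= /GRing.scale/= mulr1.
  apply: DeriveDef; first by apply/cvg_ex; eexists; exact: Hc'.
  by apply: cvg_lim => //.
have cDt t : continuous (D t) by apply: continuous_pair_r.
have z t : t \in `]0, 1[ -> cint (D t) = 0.
  rewrite in_itv/= => /andP[t0 _].
  have := @cint_FTC (fun x => t * D t x) (H t).
  rewrite perH subrr cintZ// => /(_ _ (dH t)).
  have cc : continuous (fun x => t * D t x).
    by move=> x; apply: cvgM; [exact: cvg_cst|exact: cDt].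
  by move=> /(_ cc) /eqP; rewrite mulf_eq0 gt_eqF//= => /eqP.
have d01 (x : R) : x \in `]0, 1[ -> is_derive x (1 : R) (fun t => cint (G t)) (cint (D x)).
  rewrite in_itv/= => /andP[x0 x1]; apply: der.
  by rewrite in_itv/=; apply/andP; split; lra.
have c01 : {within `[0, 1], continuous (fun t => cint (G t))}.
  apply: derivable_within_continuous => x; rewrite in_itv/= => /andP[x0 x1].
  have xi : x \in `]-1, 2[ by rewrite in_itv/=; apply/andP; split; lra.
  by have [] := der _ xi.
have [c ci] := MVT ltr01 d01 c01.
by rewrite z// mul0r => /eqP; rewrite subr_eq0 => /eqP.
Unshelve. all: by end_near. Qed.
End CircleIntegral.

(** * Complex-valued functions of a real variable and their integrals *)

Section ComplexBasics.
Variable R : realType.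
Implicit Types (z w : R[i]).

Lemma complex_eta z : z = Complex (complex.Re z) (complex.Im z).
Proof. by case: z. Qed.

Lemma cReD z w : complex.Re (z + w) = complex.Re z + complex.Re w.
Proof. by case: z; case: w. Qed.
Lemma cImD z w : complex.Im (z + w) = complex.Im z + complex.Im w.
Proof. by case: z; case: w. Qed.
Lemma cReN z : complex.Re (- z) = - complex.Re z.
Proof. by case: z. Qed.
Lemma cImN z : complex.Im (- z) = - complex.Im z.
Proof. by case: z. Qed.
Lemma cReM z w : complex.Re (z * w) =
  complex.Re z * complex.Re w - complex.Im z * complex.Im w.
Proof. by case: z; case: w. Qed.
Lemma cImM z w : complex.Im (z * w) =
  complex.Re z * complex.Im w + complex.Im z * complex.Re w.
Proof. by case: z; case: w. Qed.

Lemma Re_sum (I : Type) (r : seq I) (P : pred I) (F : I -> R[i]) :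
  complex.Re (\sum_(i <- r | P i) F i) = \sum_(i <- r | P i) complex.Re (F i).
Proof. by elim/big_rec2: _ => // i x y _ <-; rewrite cReD. Qed.
Lemma Im_sum (I : Type) (r : seq I) (P : pred I) (F : I -> R[i]) :
  complex.Im (\sum_(i <- r | P i) F i) = \sum_(i <- r | P i) complex.Im (F i).
Proof. by elim/big_rec2: _ => // i x y _ <-; rewrite cImD. Qed.

Lemma normcE' z : normc z = Num.sqrt (complex.Re z ^+ 2 + complex.Im z ^+ 2).
Proof. by case: z. Qed.

Lemma normc_sqr z : normc z ^+ 2 = complex.Re z ^+ 2 + complex.Im z ^+ 2.
Proof. by rewrite normcE' sqr_sqrtr// addr_ge0// sqr_ge0. Qed.

Lemma normc_ge0 z : 0 <= normc z.
Proof. by rewrite normcE' sqrtr_ge0. Qed.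

Lemma Re_le_normc z : `|complex.Re z| <= normc z.
Proof.
by rewrite normcE' -sqrtr_sqr ler_wsqrtr// lerDl sqr_ge0.
Qed.

Lemma Im_le_normc z : `|complex.Im z| <= normc z.
Proof.
by rewrite normcE' -sqrtr_sqr ler_wsqrtr// lerDr sqr_ge0.
Qed.

Lemma normc_le_ReIm z : normc z <= `|complex.Re z| + `|complex.Im z|.
Proof.
rewrite -(@ler_pXn2r _ 2)// ?nnegrE ?normc_ge0 ?addr_ge0// normc_sqr sqrrD.
rewrite !real_normK ?num_real// -addrA lerD2l lerDr mulrn_wge0// mulr_ge0//.
Qed.

Lemma normcX z k : normc (z ^+ k) = normc z ^+ k.
Proof. by elim: k => [|k IH]; rewrite ?expr0 ?normc1// !exprS normcM IH. Qed.

Lemma normc_real (x : R) : normc (x%:C)%C = `|x|.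
Proof. by rewrite normcE'/= expr0n addr0 sqrtr_sqr. Qed.

Lemma normcB z w : normc (z - w) = normc (w - z).
Proof. by rewrite -normcN opprB. Qed.

Lemma normc_sum (I : Type) (r : seq I) (P : pred I) (F : I -> R[i]) :
  normc (\sum_(i <- r | P i) F i) <= \sum_(i <- r | P i) normc (F i).
Proof.
elim/big_rec2: _ => [|i x y _ H]; first by rewrite normc0.
by apply: le_trans (le_normcD _ _) _; rewrite lerD2l.
Qed.

Lemma normc_eq0 z : (normc z == 0) = (z == 0).
Proof. by apply/eqP/eqP => [/eq0_normc|->]//; rewrite normc0. Qed.

Definition ccont (f : R -> R[i]) :=
  continuous (fun x => complex.Re (f x)) /\ continuous (fun x => complex.Im (f x)).

Lemma ccont_cst z : ccont (fun=> z).
Proof. by split; apply: cst_continuous. Qed.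

Lemma ccontD f g : ccont f -> ccont g -> ccont (fun x => f x + g x).
Proof.
move=> [f1 f2] [g1 g2]; split => x.
- by under eq_fun do rewrite cReD; apply: cvgD; [exact: f1|exact: g1].
- by under eq_fun do rewrite cImD; apply: cvgD; [exact: f2|exact: g2].
Qed.

Lemma ccontM f g : ccont f -> ccont g -> ccont (fun x => f x * g x).
Proof.
move=> [f1 f2] [g1 g2]; split => x.
- under eq_fun do rewrite cReM; apply: cvgB; apply: cvgM;
  [exact: f1|exact: g1|exact: f2|exact: g2].
- under eq_fun do rewrite cImM; apply: cvgD; apply: cvgM;
  [exact: f1|exact: g2|exact: f2|exact: g1].
Qed.

Lemma ccontX f k : ccont f -> ccont (fun x => f x ^+ k).
Proof.
move=> cf; elim: k => [|k IH].
  by under eq_fun do rewrite expr0; exact: ccont_cst.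
by under eq_fun do rewrite exprS; exact: ccontM.
Qed.

Lemma Re_inv z : complex.Re z^-1 = complex.Re z / normc z ^+ 2.
Proof. by rewrite normc_sqr; case: z. Qed.
Lemma Im_inv z : complex.Im z^-1 = - (complex.Im z / normc z ^+ 2).
Proof. by rewrite normc_sqr; case: z => a b. Qed.

Lemma ccontV f : ccont f -> (forall x, f x != 0) -> ccont (fun x => (f x)^-1).
Proof.
move=> [f1 f2] f0.
have c (x : R) : (normc (f t) ^+ 2)^-1 @[t --> x] --> (normc (f x) ^+ 2)^-1.
  apply: cvgV; first by rewrite expf_eq0/= normc_eq0.
  rewrite normc_sqr; under eq_fun do rewrite normc_sqr.
  by apply: cvgD; [apply: (cvg_comp _ (fun x => x ^+ 2) (f1 x))|apply: (cvg_comp _ (fun x => x ^+ 2) (f2 x))];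
    exact: exprn_continuous.
split => x.
- rewrite /continuous_at Re_inv; under eq_fun do rewrite Re_inv.
  by apply: cvgM; [exact: f1|exact: c].
- rewrite /continuous_at Im_inv; under eq_fun do rewrite Im_inv.
  by apply: cvgN; apply: cvgM; [exact: f2|exact: c].
Qed.

Lemma ccont_sum N (f : nat -> R -> R[i]) : (forall k, ccont (f k)) ->
  ccont (fun x => \sum_(k < N) f k x).
Proof.
move=> cf; elim: N => [|N IH].
  by under eq_fun do rewrite big_ord0; exact: ccont_cst.
by under eq_fun do rewrite big_ord_recr/=; exact: ccontD.
Qed.

Definition ccint (f : R -> R[i]) : R[i] :=
  Complex (cint (fun x => complex.Re (f x))) (cint (fun x => complex.Im (f x))).

Lemma ccintD f g : ccont f -> ccont g ->
  ccint (fun x => f x + g x) = ccint f + ccint g.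
Proof.
move=> [f1 f2] [g1 g2]; rewrite /ccint.
rewrite (_ : (fun x => complex.Re (f x + g x)) = fun x => complex.Re (f x) + complex.Re (g x)); last first.
  by apply/funext => x; rewrite cReD.
rewrite (_ : (fun x => complex.Im (f x + g x)) = fun x => complex.Im (f x) + complex.Im (g x)); last first.
  by apply/funext => x; rewrite cImD.
by rewrite !cintD.
Qed.

Lemma ccintZ z f : ccont f -> ccint (fun x => z * f x) = z * ccint f.
Proof.
move=> [f1 f2]; rewrite [z]complex_eta /ccint; case: z => a b /=.
have cs (c : R) (h : R -> R) : continuous h -> continuous (fun x => c * h x).
  by move=> ch x; apply: cvgM; [exact: cvg_cst|exact: ch].
rewrite (_ : (fun x => complex.Re _) =
    fun x => a * complex.Re (f x) + (- b) * complex.Im (f x)); last first.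
  by apply/funext => x; rewrite cReM/= mulNr.
rewrite (_ : (fun x => complex.Im _) =
    fun x => a * complex.Im (f x) + b * complex.Re (f x)); last first.
  by apply/funext => x; rewrite cImM/=.
rewrite !cintD ?cintZ//; try exact: cs.
by rewrite mulNr; simpc.
Qed.

Lemma ccint_cst z : ccint (fun=> z) = (2 * pi)%:C%C * z.
Proof. by case: z => a b; rewrite /ccint/= !cint_cst; simpc; rewrite ![_ * (2 * pi)]mulrC. Qed.

Lemma ccint_sum N (f : nat -> R -> R[i]) : (forall k, ccont (f k)) ->
  ccint (fun x => \sum_(k < N) f k x) = \sum_(k < N) ccint (f k).
Proof.
move=> cf; elim: N => [|N IH].
  have -> : (fun x : R => \sum_(k < 0) f k x) = fun=> 0.
    by apply/funext => x; rewrite big_ord0.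
  by rewrite ccint_cst mulr0 big_ord0.
rewrite big_ord_recr/= -IH -ccintD//; last exact: ccont_sum.
by congr ccint; apply/funext => x; rewrite big_ord_recr.
Qed.

(** Real and imaginary parts are estimated separately; the factor 2 lost this way reappears in
    Cauchy's bounds and is harmless, since no constant is optimized. *)
Lemma ccint_le f (B : R) : ccont f ->
  (forall x, x \in `[0, 2 * pi] -> normc (f x) <= B) ->
  normc (ccint f) <= 2 * B * (2 * pi).
Proof.
move=> [f1 f2] fB; apply: le_trans (normc_le_ReIm _) _ => /=.
rewrite mulrDl mul1r mulrDl; apply: lerD; apply: cint_le => // x xi.
- exact: le_trans (Re_le_normc _) (fB _ xi).
- exact: le_trans (Im_le_normc _) (fB _ xi).
Qed.

Lemma ccont_bounded f : ccont f ->
  exists B : R, forall x, x \in `[0, 2 * pi] -> normc (f x) <= B.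
Proof.
move=> [f1 f2].
have bd (g : R -> R) : continuous g -> exists B : R, forall x, x \in `[0, 2 * pi] -> `|g x| <= B.
  move=> cg; have cpt := @segment_compact R 0 (2 * pi).
  have := @continuous_compact _ _ _ _ (continuous_subspaceT cg) cpt.
  move=> /compact_bounded [M [Mr HM]]; exists (M + 1) => x xi.
  by apply: (HM (M + 1)); [rewrite ltrDl|exists x].
have [B1 H1] := bd _ f1; have [B2 H2] := bd _ f2.
exists (B1 + B2) => x xi; apply: le_trans (normc_le_ReIm _) _.
by apply: lerD; [exact: H1|exact: H2].
Qed.

End ComplexBasics.

(** * Complex differentiability expressed by partial derivatives *)

Section Holomorphic.
Variable R : realType.
Implicit Types (F G : R[i] -> R[i]) (z w : R[i]).

Definition ccont2 F :=
  continuous (fun p : R * R => complex.Re (F (Complex p.1 p.2))) /\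
  continuous (fun p : R * R => complex.Im (F (Complex p.1 p.2))).

(* Phrased through the partial derivatives, so that it matches [C1_2] and the Cauchy-Riemann
   system of [slice_components]. *)
Definition cderiv F F' :=
  [/\ forall u v : R, is_derive u (1 : R) (fun t => complex.Re (F (Complex t v)))
        (complex.Re (F' (Complex u v))),
      forall u v : R, is_derive u (1 : R) (fun t => complex.Im (F (Complex t v)))
        (complex.Im (F' (Complex u v))),
      forall u v : R, is_derive v (1 : R) (fun t => complex.Re (F (Complex u t)))
        (- complex.Im (F' (Complex u v))),
      forall u v : R, is_derive v (1 : R) (fun t => complex.Im (F (Complex u t)))
        (complex.Re (F' (Complex u v)))
    & ccont2 F'].

Lemma is_derive_derive1 (f : R -> R) (x d : R) : is_derive x (1 : R) f d -> derive1 f x = d.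
Proof. by move=> [_ <-]; rewrite derive1E. Qed.

Lemma cderiv_u_Re F F' u v : cderiv F F' ->
  derive_u (fun u v => complex.Re (F (Complex u v))) u v = complex.Re (F' (Complex u v)).
Proof. by move=> [d _ _ _ _]; exact: is_derive_derive1. Qed.
Lemma cderiv_u_Im F F' u v : cderiv F F' ->
  derive_u (fun u v => complex.Im (F (Complex u v))) u v = complex.Im (F' (Complex u v)).
Proof. by move=> [_ d _ _ _]; exact: is_derive_derive1. Qed.
Lemma cderiv_v_Re F F' u v : cderiv F F' ->
  derive_v (fun u v => complex.Re (F (Complex u v))) u v = - complex.Im (F' (Complex u v)).
Proof. by move=> [_ _ d _ _]; exact: is_derive_derive1. Qed.
Lemma cderiv_v_Im F F' u v : cderiv F F' ->
  derive_v (fun u v => complex.Im (F (Complex u v))) u v = complex.Re (F' (Complex u v)).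
Proof. by move=> [_ _ _ d _]; exact: is_derive_derive1. Qed.

Lemma cderiv_C1_Re F F' : cderiv F F' -> C1_2 (fun u v => complex.Re (F (Complex u v))).
Proof.
move=> d; have [d1 d2 d3 d4 [c1 c2]] := d; split; last split.
- by move=> u v; split; [have [] := d1 u v|have [] := d3 u v].
- by under eq_fun do rewrite (cderiv_u_Re _ _ d).
- under eq_fun do rewrite (cderiv_v_Re _ _ d).
  by move=> x; apply: cvgN; exact: c2.
Qed.

Lemma cderiv_C1_Im F F' : cderiv F F' -> C1_2 (fun u v => complex.Im (F (Complex u v))).
Proof.
move=> d; have [d1 d2 d3 d4 [c1 c2]] := d; split; last split.
- by move=> u v; split; [have [] := d2 u v|have [] := d4 u v].
- by under eq_fun do rewrite (cderiv_u_Im _ _ d).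
- by under eq_fun do rewrite (cderiv_v_Im _ _ d).
Qed.

Lemma C1_cderiv (g0 g1 : R -> R -> R) : C1_2 g0 -> C1_2 g1 ->
  (forall u v, derive_u g0 u v = derive_v g1 u v) ->
  (forall u v, derive_v g0 u v = - derive_u g1 u v) ->
  cderiv (fun z => Complex (g0 (complex.Re z) (complex.Im z)) (g1 (complex.Re z) (complex.Im z)))
    (fun z => Complex (derive_u g0 (complex.Re z) (complex.Im z))
                      (derive_u g1 (complex.Re z) (complex.Im z))).
Proof.
move=> [d0 [cu0 cv0]] [d1 [cu1 cv1]] cr1 cr2.
have D (f : R -> R) (x : R) : derivable f x (1 : R) -> is_derive x (1 : R) f (derive1 f x).
  by move=> df; rewrite derive1E; exact: derivableP.
split => /=.
- by move=> u v; apply: D; exact: (d0 u v).1.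
- by move=> u v; apply: D; exact: (d1 u v).1.
- by move=> u v; rewrite -cr2; apply: D; exact: (d0 u v).2.
- by move=> u v; rewrite cr1; apply: D; exact: (d1 u v).2.
- by rewrite /ccont2 /=; split; [exact: cu0|exact: cu1].
Qed.

Lemma cderiv_ccont2 F F' : cderiv F F' -> ccont2 F.
Proof.
move=> d; split.
- exact: C1_continuous (cderiv_C1_Re d).
- exact: C1_continuous (cderiv_C1_Im d).
Qed.

Lemma ccont2_comp F (a b : R -> R) : ccont2 F -> continuous a -> continuous b ->
  ccont (fun x => F (Complex (a x) (b x))).
Proof.
move=> [c1 c2] ca cb.
have cp (x : R) : (a t, b t) @[t --> x] --> (a x, b x).
  by apply: (@cvg_pair _ _ _ (nbhs x) (nbhs (a x)) (nbhs (b x))); [exact: ca|exact: cb].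
split => x; [exact: (cvg_comp _ (fun p : R * R => complex.Re (F (Complex p.1 p.2))) (cp x) (c1 _))|
  exact: (cvg_comp _ (fun p : R * R => complex.Im (F (Complex p.1 p.2))) (cp x) (c2 _))].
Qed.

Lemma cderiv_cst z : cderiv (fun=> z) (fun=> 0).
Proof.
split=> /=; try by move=> u v; rewrite ?oppr0; exact: is_derive_cst.
by split => /=; exact: cst_continuous.
Qed.

Lemma ccont2D F G : ccont2 F -> ccont2 G -> ccont2 (fun z => F z + G z).
Proof.
move=> [f1 f2] [g1 g2]; split => x.
- by under eq_fun do rewrite cReD; apply: cvgD; [exact: f1|exact: g1].
- by under eq_fun do rewrite cImD; apply: cvgD; [exact: f2|exact: g2].
Qed.

Lemma ccont2M F G : ccont2 F -> ccont2 G -> ccont2 (fun z => F z * G z).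
Proof.
move=> [f1 f2] [g1 g2]; split => x.
- under eq_fun do rewrite cReM; apply: cvgB; apply: cvgM;
  [exact: f1|exact: g1|exact: f2|exact: g2].
- under eq_fun do rewrite cImM; apply: cvgD; apply: cvgM;
  [exact: f1|exact: g2|exact: f2|exact: g1].
Qed.

Lemma is_deriveDR (f g : R -> R) (x df dg d : R) : is_derive x (1 : R) f df ->
  is_derive x (1 : R) g dg -> d = df + dg -> is_derive x (1 : R) (fun t => f t + g t) d.
Proof. by move=> Df Dg ->; exact: (is_deriveD Df Dg). Qed.

Lemma is_deriveBR (f g : R -> R) (x df dg d : R) : is_derive x (1 : R) f df ->
  is_derive x (1 : R) g dg -> d = df - dg -> is_derive x (1 : R) (fun t => f t - g t) d.
Proof. by move=> Df Dg ->; exact: (is_deriveB Df Dg). Qed.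

Lemma is_deriveMR (f g : R -> R) (x df dg d : R) : is_derive x (1 : R) f df ->
  is_derive x (1 : R) g dg -> d = df * g x + f x * dg ->
  is_derive x (1 : R) (fun t => f t * g t) d.
Proof.
move=> Df Dg ->; have := is_deriveM Df Dg.
by rewrite /GRing.scale/= addrC (mulrC (g x)).
Qed.

Lemma cderivD F F' G G' : cderiv F F' -> cderiv G G' ->
  cderiv (fun z => F z + G z) (fun z => F' z + G' z).
Proof.
move=> [f1 f2 f3 f4 f5] [g1 g2 g3 g4 g5]; split.
- move=> u v; under eq_fun do rewrite cReD; rewrite cReD.
  by apply: (is_deriveDR (f1 u v) (g1 u v)); rewrite ?opprD.
- move=> u v; under eq_fun do rewrite cImD; rewrite cImD.
  by apply: (is_deriveDR (f2 u v) (g2 u v)); rewrite ?opprD.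
- move=> u v; under eq_fun do rewrite cReD; rewrite cImD opprD.
  by apply: (is_deriveDR (f3 u v) (g3 u v)); rewrite ?opprD.
- move=> u v; under eq_fun do rewrite cImD; rewrite cReD.
  by apply: (is_deriveDR (f4 u v) (g4 u v)); rewrite ?opprD.
- exact: ccont2D.
Qed.

Lemma cderivM F F' G G' : cderiv F F' -> cderiv G G' ->
  cderiv (fun z => F z * G z) (fun z => F' z * G z + F z * G' z).
Proof.
move=> dF dG; have cF := cderiv_ccont2 dF; have cG := cderiv_ccont2 dG.
move: dF dG => [f1 f2 f3 f4 f5] [g1 g2 g3 g4 g5]; split.
- move=> u v; under eq_fun do rewrite cReM; rewrite cReD !cReM.
  apply: (is_deriveBR (is_deriveMR (f1 u v) (g1 u v) erefl) (is_deriveMR (f2 u v) (g2 u v) erefl)).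
  by ring.
- move=> u v; under eq_fun do rewrite cImM; rewrite cImD !cImM.
  apply: (is_deriveDR (is_deriveMR (f1 u v) (g2 u v) erefl) (is_deriveMR (f2 u v) (g1 u v) erefl)).
  by ring.
- move=> u v; under eq_fun do rewrite cReM; rewrite cImD !cImM.
  apply: (is_deriveBR (is_deriveMR (f3 u v) (g3 u v) erefl) (is_deriveMR (f4 u v) (g4 u v) erefl)).
  by ring.
- move=> u v; under eq_fun do rewrite cImM; rewrite cReD !cReM.
  apply: (is_deriveDR (is_deriveMR (f3 u v) (g4 u v) erefl) (is_deriveMR (f4 u v) (g3 u v) erefl)).
  by ring.
- by apply: ccont2D; apply: ccont2M.
Qed.

End Holomorphic.

(** * Cauchy's integral formula on circles around the origin *)

Section Cauchy.
Variable R : realType.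
Implicit Types (F : R[i] -> R[i]) (z w : R[i]).

Definition circ (r x : R) : R[i] := Complex (r * cos x) (r * sin x).

Lemma normc_circ r x : 0 <= r -> normc (circ r x) = r.
Proof.
move=> r0; rewrite normcE'/= !exprMn -mulrDr cos2Dsin2 mulr1 sqrtr_sqr ger0_norm//.
Qed.

Lemma continuous_rcos (r : R) : continuous (fun x => r * cos x).
Proof. by move=> x; apply: cvgM; [exact: cvg_cst|exact: continuous_cos]. Qed.
Lemma continuous_rsin (r : R) : continuous (fun x => r * sin x).
Proof. by move=> x; apply: cvgM; [exact: cvg_cst|exact: continuous_sin]. Qed.

Lemma ccont_circ r : ccont (circ r).
Proof. by split; [exact: continuous_rcos|exact: continuous_rsin]. Qed.

(** With w = [circ r x] the hypothesis says K = w / (w - z), so F(w) K dx is the Cauchy integrand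
    F(w) / (w - z) dw up to a factor i. The circle is shrunk to z along w_t = z + t (w - z). The
    t-derivative of F(w_t) K is F'(w_t) w, and t times its real part is the x-derivative of Im
    F(w_t). *)
Lemma cauchy_kernel_Re F F' z r (K : R -> R[i]) : cderiv F F' -> ccont K ->
  (forall x, (circ r x - z) * K x = circ r x) ->
  cint (fun x => complex.Re (F (circ r x) * K x)) = cint (fun x => complex.Re (F z * K x)).
Proof.
move=> dF cK KE; case: z KE => u v KE.
pose p t x := u + t * (r * cos x - u); pose q t x := v + t * (r * sin x - v).
pose w t x := Complex (p t x) (q t x).
have w1 x : w 1 x = circ r x by rewrite /w /p /q !mul1r !subrKC.
have w0 x : w 0 x = Complex u v by rewrite /w /p /q !mul0r !addr0.
pose G t x := complex.Re (F (w t x) * K x).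
have -> : (fun x => complex.Re (F (circ r x) * K x)) = G 1.
  by apply/funext => x; rewrite /G w1.
have -> : (fun x => complex.Re (F (Complex u v) * K x)) = G 0.
  by apply/funext => x; rewrite /G w0.
have cp t : continuous (p t).
  move=> x; apply: cvgD; first exact: cvg_cst.
  by apply: cvgM; [exact: cvg_cst|apply: cvgB; [exact: continuous_rcos|exact: cvg_cst]].
have cq t : continuous (q t).
  move=> x; apply: cvgD; first exact: cvg_cst.
  by apply: cvgM; [exact: cvg_cst|apply: cvgB; [exact: continuous_rsin|exact: cvg_cst]].
have [_ _ _ _ cF'] := dF.
apply: (@cint_param_const _ G (fun t x => complex.Re (F' (w t x) * circ r x))
  (fun t x => complex.Im (F (w t x)))).
- move=> t; have [] := ccontM (ccont2_comp (cderiv_ccont2 dF) (cp t) (cq t)) cK.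
  by [].
- have cc (f : R -> R) : continuous f -> continuous (fun y : R * R => f y.2).
    by move=> cf y; apply: (cvg_comp _ f _ (cf _)); exact: cvg_snd.
  have cw (a : R) (f : R -> R) : continuous f ->
      continuous (fun y : R * R => a + y.1 * (f y.2 - a)).
    move=> cf y; apply: cvgD; first exact: cvg_cst.
    apply: cvgM; first exact: cvg_fst.
    by apply: cvgB; [exact: cc|exact: cvg_cst].
  have cpq : continuous (fun y : R * R => (p y.1 y.2, q y.1 y.2)).
    move=> y; apply: (@cvg_pair _ _ _ (nbhs y) (nbhs (p y.1 y.2)) (nbhs (q y.1 y.2)));
      [exact: (cw _ _ (@continuous_rcos r))|exact: (cw _ _ (@continuous_rsin r))].
  move=> y; under eq_fun do rewrite cReM/=.
  apply: cvgB; apply: cvgM.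
  + exact: (cvg_comp _ (fun p : R * R => complex.Re (F' (Complex p.1 p.2))) (cpq y) (cF'.1 _)).
  + exact: (cc _ (@continuous_rcos r)).
  + exact: (cvg_comp _ (fun p : R * R => complex.Im (F' (Complex p.1 p.2))) (cpq y) (cF'.2 _)).
  + exact: (cc _ (@continuous_rsin r)).
- move=> t x; rewrite /G.
  have dp : is_derive t (1 : R) (p ^~ x) (r * cos x - u).
    by rewrite /p; apply: is_derive_eq; rewrite /GRing.scale/=; ring.
  have dq : is_derive t (1 : R) (q ^~ x) (r * sin x - v).
    by rewrite /q; apply: is_derive_eq; rewrite /GRing.scale/=; ring.
  have H1 := C1_chain (cderiv_C1_Re dF) dp dq.
  have H2 := C1_chain (cderiv_C1_Im dF) dp dq.
  under eq_fun do rewrite cReM.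
  apply: (is_deriveBR (is_deriveMR H1 (is_derive_cst _ _ _) erefl)
    (is_deriveMR H2 (is_derive_cst _ _ _) erefl)).
  rewrite !(cderiv_u_Re _ _ dF) !(cderiv_v_Re _ _ dF) !(cderiv_u_Im _ _ dF) !(cderiv_v_Im _ _ dF).
  rewrite -(KE x) -/(w t x) !cReM !cImM !cReD !cImD !cReN !cImN /=; ring.
- move=> t x.
  have dp : is_derive x (1 : R) (p t) (- (t * r * sin x)).
    by rewrite /p; apply: is_derive_eq; rewrite /GRing.scale/=; ring.
  have dq : is_derive x (1 : R) (q t) (t * r * cos x).
    by rewrite /q; apply: is_derive_eq; rewrite /GRing.scale/=; ring.
  apply: is_derive_eq; first exact: C1_chain (cderiv_C1_Im dF) dp dq.
  by rewrite (cderiv_u_Im _ _ dF) (cderiv_v_Im _ _ dF) -/(w t x) cReM /=; ring.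
- by move=> t; rewrite /w /p /q mulr_natl cos2pi sin2pi cos0 sin0.
Qed.
End Cauchy.

(** * Taylor coefficients as circle integrals *)

Section CauchyTaylor.
Variable R : realType.
Implicit Types (F : R[i] -> R[i]) (z w : R[i]).

(** The imaginary part is the real part for the function -i F. *)
Lemma cauchy_kernel F F' z r (K : R -> R[i]) : cderiv F F' -> ccont K ->
  (forall x, (circ r x - z) * K x = circ r x) ->
  ccint (fun x => F (circ r x) * K x) = ccint (fun x => F z * K x).
Proof.
move=> dF cK KE; rewrite /ccint (cauchy_kernel_Re dF cK KE); congr Complex.
have dG := cderivM (cderiv_cst (Complex 0 (-1))) dF.
have := cauchy_kernel_Re dG cK KE.
have e (a b : R[i]) : complex.Re (Complex 0 (-1) * a * b) = complex.Im (a * b).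
  by rewrite -mulrA cReM/= mul0r sub0r mulN1r opprK.
by under eq_fun do rewrite e; under [in X in _ = X -> _]eq_fun do rewrite e.
Qed.

Lemma circ_neq0 (r x : R) : 0 < r -> circ r x != 0.
Proof. by move=> r0; rewrite -normc_eq0 normc_circ ?ltW// gt_eqF. Qed.

Lemma circVX (r x : R) k : 0 < r ->
  (circ r x)^-1 ^+ k = (r ^- k)%:C%C * Complex (cos (k%:R * x)) (- sin (k%:R * x)).
Proof.
move=> r0; elim: k => [|k IH].
  by rewrite !expr0 invr1 mul0r cos0 sin0 oppr0 mul1r.
have ce : (circ r x)^-1 = (r^-1)%:C%C * Complex (cos x) (- sin x).
  apply: (mulfI (circ_neq0 x r0)); rewrite divff ?circ_neq0// /circ; simpc.
  apply/eqP; rewrite eq_complex/=; apply/andP; split; apply/eqP; last first.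
    by field; rewrite gt_eqF.
  rewrite -[LHS](cos2Dsin2 x); field; rewrite gt_eqF//.
rewrite exprS IH ce mulrACA -rmorphM/= -invfM -exprS; congr (_ * _).
simpc; rewrite -natr1 mulrDl mul1r cosD sinD.
by apply/eqP; rewrite eq_complex/=; apply/andP; split; apply/eqP; ring.
Qed.

Lemma ccont_circV (r : R) : 0 < r -> ccont (fun x => (circ r x)^-1).
Proof. by move=> r0; apply: ccontV; [exact: ccont_circ|move=> x; exact: circ_neq0]. Qed.

Lemma ccint_circVX (r : R) k : 0 < r ->
  ccint (fun x => (circ r x)^-1 ^+ k) = if k == 0%N then (2 * pi)%:C%C else 0.
Proof.
move=> r0; case: k => [|k] /=.
  by under eq_fun do rewrite expr0; rewrite ccint_cst mulr1.
set m : R := k.+1%:R.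
have m0 : m != 0 by rewrite pnatr_eq0.
(* Both values are read off De Moivre's formula [circVX] on the unit circle at the angle 2 pi. *)
have per : cos (m * (2 * pi)) = 1 /\ sin (m * (2 * pi)) = 0.
  have := circVX (2 * pi) k.+1 (@ltr01 R); rewrite -/m.
  rewrite /circ mul1r mulr_natl cos2pi mul1r sin2pi.
  have -> : (Complex 1 0 : R[i]) = 1 by [].
  by rewrite invr1 !expr1n invr1 mul1r => -[<- /eqP]; rewrite eq_sym oppr_eq0 => /eqP <-.
have dm (x : R) : is_derive x (1 : R) (fun x => m * x) m.
  by apply: (is_deriveMR (is_derive_cst _ _ _) (is_derive_id _ _)); rewrite mul0r add0r mulr1.
have cm (h : R -> R) : continuous h -> continuous (fun x => h (m * x)).
  move=> ch x; apply: (cvg_comp (fun x => m * x) h _ (ch _)).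
  by apply: cvgM; [exact: cvg_cst|exact: cvg_id].
have [c c1] : exists c : R, c * m = 1 by exists m^-1; rewrite mulVf.
have Ic : cint (fun x => cos (m * x)) = 0.
  transitivity ((fun x => c * sin (m * x)) (2 * pi) - (fun x => c * sin (m * x)) 0);
    last by rewrite /= per.2 !mulr0 sin0 mulr0 subrr.
  apply: (@cint_FTC _ _ (fun x => c * sin (m * x))).
  - by apply: cm; exact: continuous_cos.
  - move=> x.
    apply: (is_deriveMR (is_derive_cst c _ _) (is_derive1_comp (is_derive_sin _) (dm x))).
    by rewrite mul0r add0r [_ * m]mulrC mulrA c1 mul1r.
have Is : cint (fun x => sin (m * x)) = 0.
  transitivity ((fun x => - c * cos (m * x)) (2 * pi) - (fun x => - c * cos (m * x)) 0);
    last by rewrite /= per.1 !mulr0 cos0 subrr.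
  apply: (@cint_FTC _ _ (fun x => - c * cos (m * x))).
  - by apply: cm; exact: continuous_sin.
  - move=> x.
    apply: (is_deriveMR (is_derive_cst (- c) _ _) (is_derive1_comp (is_derive_cos _) (dm x))).
    by rewrite mul0r add0r -[cst _ _]/(- c) mulNr mulNr mulrN opprK [_ * m]mulrC mulrA c1 mul1r.
under eq_fun do rewrite circVX//; rewrite ccintZ; last first.
  split; first exact: (cm _ (@continuous_cos R)).
  by move=> x; apply: cvgN; exact: (cm _ (@continuous_sin R)).
rewrite /ccint /= Ic (_ : (fun x => - sin _) = fun x => (-1) * sin (m * x)); last first.
  by apply/funext => x; rewrite mulN1r.
rewrite cintZ ?Is; last exact: (cm _ (@continuous_sin R)).
by rewrite mulr0 -[Complex 0 0]/(0 : R[i]) mulr0.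
Qed.

(** Cauchy's integral for the k-th Taylor coefficient: in the angle x, dw / (i w) becomes dx. It
    depends on [r] until its real part is shown not to, within the proof of [taylor_real]. *)
Definition tcoef F (r : R) (k : nat) : R[i] :=
  ((2 * pi)^-1)%:C%C * ccint (fun x => F (circ r x) * (circ r x)^-1 ^+ k).

Lemma ccont_Fcirc F F' r : cderiv F F' -> ccont (fun x => F (circ r x)).
Proof.
move=> dF; apply: (ccont2_comp (cderiv_ccont2 dF)).
  exact: continuous_rcos.
exact: continuous_rsin.
Qed.

Lemma tcoef_le F F' r k (B : R) : cderiv F F' -> 0 < r ->
  (forall x, x \in `[0, 2 * pi] -> normc (F (circ r x)) <= B) -> normc (tcoef F r k) * r ^+ k <= 2 * B.
Proof.
move=> dF r0 FB; rewrite normcM normc_real gtr0_norm ?invr_gt0 ?twopi_gt0//.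
rewrite -mulrA ler_pdivrMl ?twopi_gt0// -ler_pdivlMr ?exprn_gt0//.
apply: le_trans (ccint_le (B := B * r ^- k) _ _) _.
- apply: ccontM; first exact: ccont_Fcirc dF.
  by apply: ccontX; exact: ccont_circV.
- move=> x xi; rewrite normcM normcX normcV normc_circ ?(ltW r0)// -exprVn.
  by rewrite ler_wpM2r ?exprn_ge0 ?invr_ge0 ?(ltW r0)// FB.
- by rewrite le_eqVlt; apply/orP; left; apply/eqP; ring.
Qed.

(** The kernel K = w / (w - z) is the geometric sum of (z / w)^k plus (z / w)^N K. Integrated
    against F(w) - F(z), whose integral with K vanishes by Cauchy's formula, the sum produces the
    Taylor polynomial minus F(z) and the last term is the remainder. Taking [N.+1] terms ensures
    that k = 0 occurs, the only index where F(z) contributes. *)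
Lemma tcoef_expansion F F' z r : cderiv F F' -> normc z < r ->
  exists C : R, forall N,
    normc (\sum_(k < N.+1) tcoef F r k * z ^+ k - F z) <= C * (normc z / r) ^+ N.+1.
Proof.
move=> dF zr; have r0 : 0 < r := le_lt_trans (normc_ge0 _) zr.
have cz0 x : circ r x != 0 by exact: circ_neq0.
have czz x : circ r x - z != 0.
  by apply: contraTneq zr => /subr0_eq <-; rewrite normc_circ ?ltxx// ltW.
pose K x := circ r x * (circ r x - z)^-1.
have cK : ccont K.
  apply: ccontM; first exact: ccont_circ.
  apply: ccontV => //; apply: ccontD; [exact: ccont_circ|exact: ccont_cst].
pose Q x := F (circ r x) - F z.
have cQ : ccont Q by apply: ccontD; [exact: ccont_Fcirc dF|exact: ccont_cst].
have cV k : ccont (fun x => (circ r x)^-1 ^+ k) by apply: ccontX; exact: ccont_circV.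
have cFV k : ccont (fun x => F (circ r x) * (circ r x)^-1 ^+ k).
  by apply: ccontM; [exact: ccont_Fcirc dF|exact: cV].
have QK0 : ccint (fun x => Q x * K x) = 0.
  rewrite (_ : (fun x => _) = fun x => F (circ r x) * K x + (-1) * (F z * K x)); last first.
    by apply/funext => x; rewrite /Q mulrBl mulN1r.
  rewrite ccintD; last 2 first.
  - by apply: ccontM => //; exact: ccont_Fcirc dF.
  - by apply: ccontM; [exact: ccont_cst|apply: ccontM => //; exact: ccont_cst].
  rewrite ccintZ; last by apply: ccontM => //; exact: ccont_cst.
  rewrite (@cauchy_kernel F F' z r K)// ?mulN1r ?subrr// => x.
  by rewrite /K mulrC -mulrA mulVf ?mulr1.
have KE N x : K x = \sum_(k < N) z ^+ k * (circ r x)^-1 ^+ k +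
    z ^+ N * (circ r x)^-1 ^+ N * K x.
  have e : (1 - z * (circ r x)^-1) * K x = 1.
    by rewrite /K mulrA mulrBl mul1r -mulrA mulVf// mulr1 divff.
  have -> : \sum_(k < N) z ^+ k * (circ r x)^-1 ^+ k =
      (1 - (z * (circ r x)^-1) ^+ N) * K x.
    under eq_bigr do rewrite -exprMn.
    set w := z * _ in e *.
    have -> : 1 - w ^+ N = (1 - w) * \sum_(i < N) w ^+ i by rewrite -opprB subrX1 -mulNr opprB.
    by rewrite mulrAC e mul1r.
  by rewrite -exprMn -mulrDl subrK mul1r.
have [BQ HQ] := ccont_bounded cQ; have [BK HK] := ccont_bounded cK.
have BQ0 : 0 <= BQ.
  apply: le_trans (normc_ge0 _) (HQ 0 _).
  by rewrite in_itv/= lexx ltW ?twopi_gt0.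
exists (2 * (BQ * BK)) => N.
have cS M : ccont (fun x => \sum_(k < M) z ^+ k * (Q x * (circ r x)^-1 ^+ k)).
  apply: (@ccont_sum R M (fun k x => z ^+ k * (Q x * (circ r x)^-1 ^+ k))) => k.
  by apply: ccontM; [exact: ccont_cst|exact: ccontM].
have cE M : ccont (fun x => z ^+ M * (Q x * (circ r x)^-1 ^+ M * K x)).
  by apply: ccontM; [exact: ccont_cst|apply: ccontM => //; exact: ccontM].
have split0 : ccint (fun x => \sum_(k < N.+1) z ^+ k * (Q x * (circ r x)^-1 ^+ k))
    = - ccint (fun x => z ^+ N.+1 * (Q x * (circ r x)^-1 ^+ N.+1 * K x)).
  apply/eqP; rewrite -addr_eq0 -ccintD//; apply/eqP; rewrite -[RHS]QK0; congr ccint.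
  apply/funext => x; rewrite [in RHS](KE N.+1 x) mulrDr mulr_sumr; congr (_ + _).
    by apply: eq_bigr => k _; rewrite mulrCA.
  by ring.
have sumE : ccint (fun x => \sum_(k < N.+1) z ^+ k * (Q x * (circ r x)^-1 ^+ k)) =
    (2 * pi)%:C%C * (\sum_(k < N.+1) tcoef F r k * z ^+ k - F z).
  rewrite (@ccint_sum R N.+1 (fun k x => z ^+ k * (Q x * (circ r x)^-1 ^+ k))); last first.
    by move=> k; apply: ccontM; [exact: ccont_cst|exact: ccontM].
  have tp0 : (2 * pi : R)%:C%C != 0 by rewrite -normc_eq0 normc_real normr_eq0 gt_eqF ?twopi_gt0.
  have term k : ccint (fun x => z ^+ k * (Q x * (circ r x)^-1 ^+ k)) =
      (2 * pi)%:C%C * (tcoef F r k * z ^+ k) - z ^+ k * F z * (if k == 0%N then (2 * pi)%:C%C else 0).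
    rewrite ccintZ; last exact: ccontM.
    rewrite (_ : (fun x => _) = fun x => F (circ r x) * (circ r x)^-1 ^+ k +
        (- F z) * (circ r x)^-1 ^+ k); last first.
      by apply/funext => x; rewrite /Q mulrDl.
    rewrite ccintD//; last by apply: ccontM; [exact: ccont_cst|exact: cV].
    rewrite ccintZ// ccint_circVX// /tcoef fmorphV/=.
    set d := if _ then _ else _; move: d (ccint _) ((2 * pi)%:C%C) tp0 => d I P P0.
    by field.
  under eq_bigr do rewrite term.
  rewrite sumrB -mulr_sumr mulrBr; congr (_ - _).
  rewrite big_ord_recl/= expr0 mul1r big1 ?addr0 1?mulrC// => i _.
  by rewrite /bump/= mulr0.
have := congr1 (@normc R) sumE; rewrite split0 normcN normcM normc_real.
rewrite gtr0_norm ?twopi_gt0// => e.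
rewrite -(@ler_pM2l _ (2 * pi)) ?twopi_gt0// -e.
apply: le_trans (ccint_le (B := BQ * BK * (normc z / r) ^+ N.+1) (cE _) _) _.
  move=> x xi; rewrite (normcM (z ^+ _)) (normcM _ (K x)) (normcM (Q x)) !normcX normcV normc_circ ?(ltW r0)// exprMn.
  rewrite (_ : _ * _ = normc (Q x) * normc (K x) * (normc z ^+ N.+1 * r^-1 ^+ N.+1)); last by ring.
  rewrite ler_wpM2r ?mulr_ge0 ?exprn_ge0 ?normc_ge0 ?invr_ge0 ?(ltW r0)//.
  by apply: ler_pM; rewrite ?normc_ge0//; [exact: HQ|exact: HK].
by rewrite le_eqVlt; apply/orP; left; apply/eqP; ring.
Qed.

End CauchyTaylor.

(** * Power series with real coefficients *)

Section PowerSeries.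
Variable R : realType.
Implicit Types (a d : nat -> R) (z : R[i]).

Lemma geo_half_le (y : R) N : 0 <= y -> y <= 2^-1 -> \sum_(k < N) y ^+ k <= 2.
Proof.
move=> y0 y2; have y1 : 0 < 1 - y by lra.
have e : (1 - y) * (\sum_(k < N) y ^+ k) = 1 - y ^+ N.
  by rewrite -[1 - y ^+ N]opprB subrX1 -mulNr opprB.
rewrite -(ler_pM2l y1) e; have := exprn_ge0 N y0; lra.
Qed.

(** Once [q * x <= 1 / 2], the terms of positive degree sum to at most [2 * C * q * x]; so [d 0] is
    smaller than any multiple of a small x. *)
Lemma ps_unique0 d (C q x0 : R) : 0 < x0 -> (forall k, `|d k| <= C * q ^+ k) -> 0 <= C -> 0 < q ->
  (forall x, 0 < x -> x < x0 -> \sum_(k < N) d k * x ^+ k @[N --> \oo] --> (0 : R)) ->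
  d 0%N = 0.
Proof.
move=> x0_gt0 dC C0 q0 H.
have key x : 0 < x -> x < x0 -> q * x <= 2^-1 -> `|d 0%N| <= 2 * C * q * x.
  move=> xp xx0 qx; apply/ler_addgt0Pr => e e0.
  have /cvgrPdist_lt /(_ e e0) [M _ HM] := H x xp xx0.
  have {HM} := HM M.+1 (leqnSn M); rewrite /= sub0r normrN big_ord_recl/= expr0 mulr1 => h.
  set T := \sum_(i < M) _ in h.
  have hT : `|T| <= 2 * C * q * x.
    rewrite /T; apply: le_trans (ler_norm_sum _ _ _) _.
    apply: (@le_trans _ _ (\sum_(i < M) C * q * x * (q * x) ^+ i)).
      apply: ler_sum => i _; rewrite normrM /bump/= add1n.
      rewrite (ger0_norm (exprn_ge0 _ (ltW xp))) exprMn !exprS.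
      rewrite (_ : _ * _ * _ * _ = C * (q * q ^+ i) * (x * x ^+ i)); last by ring.
      rewrite ler_wpM2r ?mulr_ge0 ?exprn_ge0 ?(ltW xp)//.
      by have := dC i.+1; rewrite exprS.
    rewrite -mulr_sumr (_ : 2 * C * q * x = C * q * x * 2); last by ring.
    rewrite ler_wpM2l ?mulr_ge0 ?(ltW q0) ?(ltW xp)// geo_half_le ?mulr_ge0 ?(ltW q0) ?(ltW xp)//.
  have -> : d 0%N = (d 0%N + T) - T by rewrite addrK.
  by apply: le_trans (ler_normB _ _) _; rewrite addrC lerD// ltW.
apply/eqP; rewrite -normr_le0; apply/ler_addgt0Pr => e e0; rewrite add0r.
pose A := 2 * C * q + 1; have A0 : 0 < A by rewrite ltr_wpDl// mulr_ge0 ?mulr_ge0 ?(ltW q0).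
(* The three entries keep x inside the domain, make the geometric ratio at most one half, and make
   the final bound at most e. *)
pose x := Num.min (x0 / 2) (Num.min ((2 * q)^-1) (e / A)).
have xp : 0 < x by rewrite !lt_min !divr_gt0 ?invr_gt0 ?mulr_gt0.
have x1 : x <= x0 / 2 by rewrite ge_min lexx.
have x2 : x <= (2 * q)^-1 by rewrite !ge_min lexx !orbT.
have x3 : x <= e / A by rewrite !ge_min lexx !orbT.
apply: le_trans (key x xp _ _) _.
- by apply: le_lt_trans x1 _; lra.
- rewrite -ler_pdivlMl// (le_trans x2)// invfM mulrC//.
- apply: (@le_trans _ _ (A * x)); first by rewrite ler_wpM2r ?(ltW xp)// /A lerDl.
  by rewrite mulrC -ler_pdivlMr.
Qed.

Lemma ps_unique d (C q x0 : R) : 0 < x0 -> (forall k, `|d k| <= C * q ^+ k) -> 0 <= C -> 0 < q ->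
  (forall x, 0 < x -> x < x0 -> \sum_(k < N) d k * x ^+ k @[N --> \oo] --> (0 : R)) ->
  forall m, d m = 0.
Proof.
move=> x0_gt0 + + q0 + m; elim: m d C => [|m IH] d C dC C0 H.
  exact: (ps_unique0 x0_gt0 dC).
have d0 := ps_unique0 x0_gt0 dC C0 q0 H.
apply: (IH (fun k => d k.+1) (C * q)).
- by move=> k; have := dC k.+1; rewrite exprS mulrA.
- by rewrite mulr_ge0// ltW.
- move=> x xp xx0.
  have := H x xp xx0; rewrite -(cvg_shiftS (fun N => \sum_(k < N) d k * x ^+ k)) => H1.
  have -> : (fun N => \sum_(k < N) d k.+1 * x ^+ k) =
      fun N => x^-1 * (\sum_(k < N.+1) d k * x ^+ k).
    apply/funext => N; rewrite big_ord_recl/= d0 mul0r add0r mulr_sumr.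
    apply: eq_bigr => i _; rewrite /bump/= add1n exprS.
    by field; rewrite gt_eqF.
  suff : x^-1 * (\sum_(k < N.+1) d k * x ^+ k) @[N --> \oo] --> x^-1 * 0 by rewrite mulr0.
  by apply: cvgM; [exact: cvg_cst|exact: H1].
Qed.

Definition entire_seq a := forall r : R, 0 < r -> exists B : R, forall k, `|a k| * r ^+ k <= B.

(** Coefficients are real because only functions commuting with conjugation occur. Real and
    imaginary parts are separate real limits, meaningful when the series converges, as it does under
    [entire_seq]. *)
Definition ps a z : R[i] :=
  Complex (limn (fun N => \sum_(k < N) a k * complex.Re (z ^+ k)))
          (limn (fun N => \sum_(k < N) a k * complex.Im (z ^+ k))).

Definition psN a N z : R[i] := \sum_(k < N) (a k)%:C%C * z ^+ k.

Lemma Re_psN a N z : complex.Re (psN a N z) = \sum_(k < N) a k * complex.Re (z ^+ k).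
Proof. by rewrite Re_sum; apply: eq_bigr => k _; rewrite cReM/= mul0r subr0. Qed.
Lemma Im_psN a N z : complex.Im (psN a N z) = \sum_(k < N) a k * complex.Im (z ^+ k).
Proof. by rewrite Im_sum; apply: eq_bigr => k _; rewrite cImM/= mul0r addr0. Qed.

Lemma sum_half_tail (x : nat -> R) (B : R) : (forall k, `|x k| <= B * 2^-1 ^+ k) ->
  cvgn (fun N => \sum_(k < N) x k) /\
  forall N, `|limn (fun N => \sum_(k < N) x k) - \sum_(k < N) x k| <= 2 * B * 2^-1 ^+ N.
Proof.
move=> xB.
have B0 : 0 <= B by have := xB 0%N; rewrite expr0 mulr1; exact: le_trans.
have tail N M : `|\sum_(k < N + M) x k - \sum_(k < N) x k| <= 2 * B * 2^-1 ^+ N.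
  rewrite big_split_ord/= addrAC subrr add0r.
  apply: le_trans (ler_norm_sum _ _ _) _.
  apply: (@le_trans _ _ (\sum_(i < M) B * 2^-1 ^+ N * 2^-1 ^+ i)).
    by apply: ler_sum => i _; rewrite -mulrA -exprD; exact: xB.
  rewrite -mulr_sumr (_ : 2 * B * _ = B * 2^-1 ^+ N * 2); last by ring.
  by rewrite ler_wpM2l ?mulr_ge0 ?exprn_ge0 ?invr_ge0// geo_half_le ?invr_ge0.
have half0 : 2 * B * 2^-1 ^+ N @[N --> \oo] --> (0 : R).
  rewrite -[X in _ --> X](mulr0 (2 * B)); apply: cvgM; first exact: cvg_cst.
  by apply: cvg_expr; rewrite ger0_norm ?invr_ge0// invf_lt1// ltr1n.
have cv : cvgn (fun N => \sum_(k < N) x k).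
  apply/cauchy_cvgP; apply: cauchy_exP => e e0.
  have /cvgrPdist_lt /(_ _ e0) [M _ HM] := half0.
  have {HM} := HM M (leqnn M); rewrite /= sub0r normrN => HM.
  exists (\sum_(k < M) x k); exists M => // N /= MN.
  rewrite -(subnKC MN) -ball_normE /ball_/= distrC.
  by apply: le_lt_trans (tail _ _) _; apply: le_lt_trans HM; exact: ler_norm.
split => // N.
have lt : `|\sum_(k < N + M) x k - \sum_(k < N) x k| @[M --> \oo] -->
    `|limn (fun N => \sum_(k < N) x k) - \sum_(k < N) x k|.
  apply: cvg_norm; apply: cvgB; last exact: cvg_cst.
  have := cv; rewrite -(cvg_shiftn N) => h.
  by under eq_fun do rewrite addnC; exact: h.
rewrite -(cvg_lim (@norm_hausdorff _ _) lt).
apply: limr_le; first by apply/cvg_ex; eexists; exact: lt.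
by near=> M; exact: tail.
Unshelve. all: by end_near. Qed.

Lemma half_expr_cvg0 (E : R) : E * 2^-1 ^+ N @[N --> \oo] --> (0 : R).
Proof.
rewrite -[X in _ --> X](mulr0 E); apply: cvgM; first exact: cvg_cst.
by apply: cvg_expr; rewrite ger0_norm ?invr_ge0// invf_lt1// ltr1n.
Qed.

(** The standard way here to pass to the limit: equalities and bounds are proved up to an error of
    rate [2 ^ -N], which is then dropped. *)
Lemma le_half_limit (x y E : R) : (forall N, x <= y + E * 2^-1 ^+ N) -> x <= y.
Proof.
move=> H; apply/ler_addgt0Pr => e e0.
have /cvgrPdist_lt /(_ _ e0) [M _ HM] := half_expr_cvg0 E.
have {HM} := HM M (leqnn M); rewrite /= sub0r normrN => HM.
apply: le_trans (H M) _; rewrite lerD2l ltW//; apply: le_lt_trans HM; exact: ler_norm.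
Qed.

(** Bounding the coefficients at the doubled radius [2 * normc z] makes the k-th term at [z] at most
    [B * 2 ^ -k]. This is where the doubling of radii originates. *)
Lemma ps_approx a z (B : R) : (forall k, `|a k| * (2 * normc z) ^+ k <= B) ->
  forall N, normc (ps a z - psN a N z) <= 4 * B * 2^-1 ^+ N.
Proof.
move=> aB N.
have ab (p : R[i] -> R) : (forall z, `|p z| <= normc z) ->
    forall k, `|a k * p (z ^+ k)| <= B * 2^-1 ^+ k.
  move=> pz k; rewrite normrM exprVn ler_pdivlMr ?exprn_gt0//.
  apply: le_trans (aB k); rewrite -mulrA ler_wpM2l// exprMn mulrC.
  by rewrite ler_wpM2l ?exprn_ge0//; apply: le_trans (pz _) _; rewrite normcX.
have [c1 t1] := sum_half_tail (ab _ (@Re_le_normc R)).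
have [c2 t2] := sum_half_tail (ab _ (@Im_le_normc R)).
apply: le_trans (normc_le_ReIm _) _.
rewrite cReD cImD cReN cImN Re_psN Im_psN.
rewrite (_ : 4 * B * _ = 2 * B * 2^-1 ^+ N + 2 * B * 2^-1 ^+ N); last by ring.
exact: lerD (t1 N) (t2 N).
Qed.

Lemma ps_le a z (B : R) : (forall k, `|a k| * (2 * normc z) ^+ k <= B) ->
  normc (ps a z) <= 4 * B.
Proof.
by move=> /ps_approx/(_ 0%N); rewrite /psN big_ord0 subr0 expr0 mulr1.
Qed.

Lemma ps_unique_limit a z w (B E : R) : (forall k, `|a k| * (2 * normc z) ^+ k <= B) ->
  (forall N, normc (psN a N z - w) <= E * 2^-1 ^+ N) -> ps a z = w.
Proof.
move=> aB H; apply/eqP; rewrite -subr_eq0 -normc_eq0 eq_le normc_ge0 andbT.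
apply: (@le_half_limit _ _ (4 * B + E)) => N; rewrite add0r mulrDl.
rewrite (_ : ps a z - w = (ps a z - psN a N z) + (psN a N z - w)); last by rewrite addrA subrK.
by apply: le_trans (le_normcD _ _) _; apply: lerD; [exact: ps_approx|exact: H].
Qed.

Lemma entire_seqP a : entire_seq a -> forall r : R, exists2 B : R, 0 <= B & forall k (s : R), 0 <= s -> s <= r -> `|a k| * s ^+ k <= B.
Proof.
move=> ea r; have [|B HB] := ea (`|r| + 1); first by rewrite ltr_wpDl.
exists B; first by apply: le_trans (HB 0%N); rewrite mulr_ge0.
move=> k s s0 sr; apply: le_trans (HB k); rewrite ler_wpM2l// lerXn2r ?nnegrE ?addr_ge0//.
by apply: le_trans sr _; apply: le_trans (ler_norm _) _; rewrite lerDl.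
Qed.

Lemma psN_conj a N z : psN a N (z^*)%C = ((psN a N z)^*)%C.
Proof.
rewrite /psN rmorph_sum; apply: eq_bigr => k _.
by rewrite rmorphM rmorphXn/= oppr0.
Qed.

Lemma normcJ' z : normc (z^*)%C = normc z.
Proof. by rewrite !normcE'; case: z => x y /=; rewrite sqrrN. Qed.

Lemma ps_conj a z : entire_seq a -> ps a (z^*)%C = ((ps a z)^*)%C.
Proof.
move=> /entire_seqP/(_ (2 * normc z)) [B B0 HB].
have H k : `|a k| * (2 * normc z) ^+ k <= B by apply: HB; rewrite ?mulr_ge0 ?normc_ge0.
apply: (@ps_unique_limit _ _ _ B (4 * B)) => [k|N]; first by rewrite normcJ'.
by rewrite psN_conj -rmorphB/= normcJ' normcB; exact: ps_approx.
Qed.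

Definition dseq a : nat -> R := fun k => k.+1%:R * a k.+1.

(** The factor [k.+1] is at most [2 ^ k.+1] and is paid by doubling the radius; the shift of the
    index costs the division by [r]. *)
Lemma entire_dseq a : entire_seq a -> entire_seq (dseq a).
Proof.
move=> ea r r0; have [|B HB] := ea (2 * r); first by rewrite mulr_gt0.
exists (B / r) => k; rewrite ler_pdivlMr// -mulrA -exprSr /dseq normrM.
apply: le_trans (HB k.+1); rewrite exprMn -mulrA [leRHS]mulrCA.
rewrite ler_wpM2r ?mulr_ge0 ?exprn_ge0 ?(ltW r0)//.
by rewrite ger0_norm// -natrX ler_nat ltnW// ltn_expl.
Qed.

(** Induction on k: the remainder for [k.+1] is [z + h] times the remainder for [k] plus [h ^ 2]
    times the derivative term. The base 3 covers the factor k and closes the induction through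
    [rho + 1 <= 3 * rho]. *)
Lemma pow_quad z h k : normc h <= 1 ->
  normc ((z + h) ^+ k - z ^+ k - k%:R * z ^+ k.-1 * h) <=
  normc h ^+ 2 * (3 * (normc z + 1)) ^+ k.
Proof.
move=> h1; set rho := normc z + 1.
have rho1 : 1 <= rho by rewrite lerDr normc_ge0.
have rho0 : 0 <= rho := le_trans ler01 rho1.
have kle m : normc (m%:R * z ^+ m.-1) <= 3 ^+ m * rho ^+ m.
  rewrite normcM normcX; apply: ler_pM; rewrite ?normc_ge0 ?exprn_ge0 ?normc_ge0//.
    have -> : (m%:R : R[i]) = (m%:R : R)%:C%C by rewrite rmorph_nat.
    by rewrite normc_real ger0_norm// -natrX ler_nat ltnW// ltn_expl.
  apply: (@le_trans _ _ (rho ^+ m.-1)).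
    by rewrite lerXn2r ?nnegrE ?normc_ge0// lerDl.
  by apply: ler_weXn2l => //; exact: leq_pred.
elim: k => [|k IH].
  by rewrite !expr0 subrr mul0r mul0r subrr normc0 mulr1 exprn_ge0 ?normc_ge0.
rewrite (_ : _ - _ = (z + h) * ((z + h) ^+ k - z ^+ k - k%:R * z ^+ k.-1 * h)
    + h ^+ 2 * (k%:R * z ^+ k.-1)); last first.
  case: k {IH} => [|k]; first by rewrite !expr0 !expr1; ring.
  by rewrite -pred_Sn -[in LHS]natr1 -pred_Sn !exprS; ring.
apply: le_trans (le_normcD _ _) _; rewrite !normcM !normcX.
apply: (@le_trans _ _ (rho * (normc h ^+ 2 * (3 * rho) ^+ k) +
    normc h ^+ 2 * (3 ^+ k * rho ^+ k))).
  apply: lerD.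
    apply: ler_pM; rewrite ?normc_ge0//.
    by apply: le_trans (le_normcD _ _) _; rewrite lerD2l.
  by rewrite -expr2 -(normcX z) -(normcM k%:R) ler_wpM2l ?exprn_ge0 ?normc_ge0// kle.
rewrite [(3 * rho) ^+ k.+1]exprS exprMn.
rewrite [leLHS](_ : _ = normc h ^+ 2 * (3 ^+ k * rho ^+ k) * (rho + 1)); last by ring.
rewrite [leRHS](_ : _ = normc h ^+ 2 * (3 ^+ k * rho ^+ k) * (3 * rho)); last by ring.
rewrite ler_wpM2l ?mulr_ge0 ?exprn_ge0 ?normc_ge0//; lra.
Qed.

Lemma ps_quad a z : entire_seq a -> exists2 C : R, 0 <= C & forall h, normc h <= 1 ->
  normc (ps a (z + h) - ps a z - ps (dseq a) z * h) <= C * normc h ^+ 2.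
Proof.
move=> ea; set rho := normc z + 1.
have rho0 : 0 <= rho by rewrite addr_ge0 ?normc_ge0.
(* The radius [3 * rho] comes from the remainder of each power and is doubled to make the sum over k
   geometric. *)
have [B B0 HB] := entire_seqP ea (6 * rho).
have [B' B'0 HB'] := entire_seqP (entire_dseq ea) (2 * rho).
exists (2 * B); first by rewrite mulr_ge0.
move=> h h1.
have zh : normc (z + h) <= rho by apply: le_trans (le_normcD _ _) _; rewrite lerD2l.
have zr : normc z <= rho by rewrite lerDl.
have b1 k : `|a k| * (2 * normc (z + h)) ^+ k <= B.
  by apply: HB; [rewrite mulr_ge0 ?normc_ge0|apply: ler_pM; rewrite ?normc_ge0// ler_nat].
have b2 k : `|a k| * (2 * normc z) ^+ k <= B.
  by apply: HB; [rewrite mulr_ge0 ?normc_ge0|apply: ler_pM; rewrite ?normc_ge0// ler_nat].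
have b3 k : `|dseq a k| * (2 * normc z) ^+ k <= B'.
  by apply: HB'; [rewrite mulr_ge0 ?normc_ge0|rewrite ler_pM2l].
apply: (@le_half_limit _ _ (4 * B + 4 * B + 4 * B')) => N.
have sumE : psN a N.+1 (z + h) - psN a N.+1 z - psN (dseq a) N z * h =
    \sum_(k < N.+1) (a k)%:C%C * ((z + h) ^+ k - z ^+ k - k%:R * z ^+ k.-1 * h).
  transitivity (\sum_(k < N.+1) ((a k)%:C%C * (z + h) ^+ k - (a k)%:C%C * z ^+ k) -
     \sum_(k < N.+1) (a k)%:C%C * (k%:R * z ^+ k.-1 * h)).
    rewrite sumrB; congr (_ - _).
    rewrite big_ord_recl/= mul0r mul0r mulr0 add0r /psN mulr_suml.
    apply: eq_bigr => k _; rewrite /bump/= add1n /dseq rmorphM rmorph_nat/=.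
    by ring.
  by rewrite -sumrB; apply: eq_bigr => k _; ring.
have le1 : normc (\sum_(k < N.+1) (a k)%:C%C * ((z + h) ^+ k - z ^+ k - k%:R * z ^+ k.-1 * h))
    <= 2 * B * normc h ^+ 2.
  apply: le_trans (normc_sum _ _ _) _.
  apply: (@le_trans _ _ (\sum_(k < N.+1) normc h ^+ 2 * B * 2^-1 ^+ k)).
    apply: ler_sum => k _; rewrite normcM normc_real.
    apply: (@le_trans _ _ (`|a k| * (normc h ^+ 2 * (3 * rho) ^+ k))).
      by rewrite ler_wpM2l// pow_quad.
    rewrite mulrCA -mulrA ler_wpM2l ?exprn_ge0 ?normc_ge0// exprVn ler_pdivlMr ?exprn_gt0//.
    rewrite -mulrA -exprMn; apply: HB; first by rewrite !mulr_ge0.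
    by rewrite le_eqVlt; apply/orP; left; apply/eqP; ring.
  rewrite -mulr_sumr [leRHS](_ : _ = normc h ^+ 2 * B * 2); last by ring.
  by rewrite ler_wpM2l ?mulr_ge0 ?exprn_ge0 ?normc_ge0// geo_half_le ?invr_ge0.
have dec (p q r s t w x : R[i]) :
    p - q - r * x = (s - t - w * x) + ((p - s) - (q - t) - (r - w) * x) by ring.
rewrite (dec _ _ _ (psN a N.+1 (z + h)) (psN a N.+1 z) (psN (dseq a) N z)).
apply: le_trans (le_normcD _ _) _; rewrite sumE; apply: lerD => //.
rewrite (mulrDl (4 * B + 4 * B)) (mulrDl (4 * B)).
have half1 : 2^-1 ^+ N.+1 <= 2^-1 ^+ N :> R.
  by rewrite exprS ler_piMl ?exprn_ge0 ?invr_ge0// invf_le1// ler1n.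
apply: le_trans (le_normcD _ _) _; rewrite normcN; apply: lerD.
  apply: le_trans (le_normcD _ _) _; rewrite normcN; apply: lerD.
    by apply: le_trans (ps_approx b1 _) _; rewrite ler_wpM2l ?mulr_ge0.
  by apply: le_trans (ps_approx b2 _) _; rewrite ler_wpM2l ?mulr_ge0.
rewrite normcM -[leRHS]mulr1; apply: ler_pM; rewrite ?normc_ge0//.
exact: ps_approx.
Qed.

Lemma is_derive_quad (f : R -> R) (x d C : R) :
  (forall h : R, `|h| <= 1 -> `|f (x + h) - f x - d * h| <= C * h ^+ 2) ->
  is_derive x (1 : R) f d.
Proof.
move=> H.
have C0 : 0 <= C by have := H 1; rewrite normr1 lexx expr1n !mulr1 => /(_ isT); apply: le_trans; exact: normr_ge0.
have Hc : h^-1 *: ((f \o shift x) (h *: (1 : R)) - f x) @[h --> 0^'] --> d.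
  apply/cvgrPdist_le => e e0; near=> h.
  have h0 : h != 0 by near: h; exact: nbhs_dnbhs_neq.
  have h1 : `|h| <= Num.min 1 (e / (C + 1)).
    near: h; apply: dnbhs0_le; rewrite lt_min ltr01 divr_gt0// ltr_wpDl//.
  have [ha hb] : `|h| <= 1 /\ `|h| <= e / (C + 1) by move: h1; rewrite le_min => /andP.
  rewrite /= /GRing.scale/= mulr1 distrC.
  have -> : h^-1 * (f (h + x) - f x) - d = (f (x + h) - f x - d * h) / h.
    by rewrite (addrC h); field.
  rewrite normrM normfV ler_pdivrMr ?normr_gt0//.
  apply: le_trans (H _ ha) _; rewrite -real_normK ?num_real// expr2 mulrA ler_wpM2r//.
  apply: (@le_trans _ _ ((C + 1) * `|h|)); first by rewrite ler_wpM2r// lerDl.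
  by rewrite mulrC -ler_pdivlMr// ltr_wpDl.
apply: DeriveDef; first by apply/cvg_ex; eexists; exact: Hc.
by apply: cvg_lim.
Unshelve. all: by end_near. Qed.

Lemma near_pair (u v d : R) : 0 < d -> \forall p \near (u, v), `|p.1 - u| + `|p.2 - v| <= d.
Proof.
move=> d0; have d2 : 0 < d / 2 by rewrite divr_gt0.
exists (ball u (d / 2), ball v (d / 2)); first by split; exact: nbhsx_ballx.
move=> [a b] [/= H1 H2]; rewrite (splitr d); apply: lerD; rewrite distrC ltW//.
Qed.

(** A quadratic Taylor remainder at each point. It is what a power series estimate delivers, and it
    yields continuity as well as, for real and for imaginary increments, all four partial
    derivatives. *)
Definition cquad (F F' : R[i] -> R[i]) := forall z, exists2 C : R, 0 <= C &
  forall h, normc h <= 1 -> normc (F (z + h) - F z - F' z * h) <= C * normc h ^+ 2.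

Lemma cquad_ccont2 F F' : cquad F F' -> ccont2 F.
Proof.
move=> qF.
have key (u v e : R) : 0 < e ->
    \forall p \near (u, v), normc (F (Complex u v) - F (Complex p.1 p.2)) <= e.
  move=> e0; have [C C0 HC] := qF (Complex u v).
  set L := normc (F' (Complex u v)) + C.
  have L0 : 0 <= L by rewrite addr_ge0 ?normc_ge0.
  have bnd (p : R * R) : `|p.1 - u| + `|p.2 - v| <= 1 ->
      normc (F (Complex u v) - F (Complex p.1 p.2)) <= L * (`|p.1 - u| + `|p.2 - v|).
    move=> p1; pose h := Complex (p.1 - u) (p.2 - v); rewrite normcB.
    have hle : normc h <= `|p.1 - u| + `|p.2 - v| := normc_le_ReIm h.
    have -> : Complex p.1 p.2 = Complex u v + h by rewrite /h; simpc; rewrite !subrKC.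
    have h1 := le_trans hle p1.
    apply: (@le_trans _ _ (L * normc h)); last by rewrite ler_wpM2l.
    have -> : F (Complex u v + h) - F (Complex u v) =
      (F (Complex u v + h) - F (Complex u v) - F' (Complex u v) * h) +
      F' (Complex u v) * h by rewrite subrK.
    apply: le_trans (le_normcD _ _) _; rewrite normcM addrC mulrDl lerD2l.
    by apply: le_trans (HC _ h1) _; rewrite expr2 mulrA ler_piMr// mulr_ge0// normc_ge0.
  have d0 : 0 < Num.min 1 (e / (L + 1)) by rewrite lt_min ltr01 divr_gt0// ltr_wpDl.
  apply: filterS (near_pair u v d0) => p; rewrite le_min => /andP[p1 p2].
  apply: le_trans (bnd _ p1) _.
  apply: (@le_trans _ _ ((L + 1) * (`|p.1 - u| + `|p.2 - v|))).
    by rewrite ler_wpM2r ?addr_ge0// lerDl.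
  by rewrite mulrC -ler_pdivlMr// ltr_wpDl.
split => -[u v]; apply/cvgrPdist_le => e e0; apply: filterS (key u v e e0) => p /=; apply: le_trans.
- by rewrite -cReN -cReD; exact: Re_le_normc.
- by rewrite -cImN -cImD; exact: Im_le_normc.
Qed.

Lemma cquad_cderiv F F' : cquad F F' -> ccont2 F' -> cderiv F F'.
Proof.
move=> qF cF'.
have nr (h : R) : normc (h%:C)%C = `|h| by exact: normc_real.
have ni (h : R) : normc (Complex 0 h) = `|h| by rewrite normcE'/= expr0n add0r sqrtr_sqr.
split => // u v; have [C _ HC] := qF (Complex u v); apply: (@is_derive_quad _ _ _ C) => h h1.
- have := HC (h%:C)%C; rewrite nr real_normK ?num_real// => /(_ h1); apply: le_trans.
  have -> : Complex (u + h) v = Complex u v + (h%:C)%C by simpc.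
  by apply: le_trans (Re_le_normc _); rewrite !cReD !cReN cReM/= mulr0 subr0.
- have := HC (h%:C)%C; rewrite nr real_normK ?num_real// => /(_ h1); apply: le_trans.
  have -> : Complex (u + h) v = Complex u v + (h%:C)%C by simpc.
  by apply: le_trans (Im_le_normc _); rewrite !cImD !cImN cImM/= mulr0 add0r.
- have := HC (Complex 0 h); rewrite ni real_normK ?num_real// => /(_ h1); apply: le_trans.
  have -> : Complex u (v + h) = Complex u v + Complex 0 h by simpc.
  by apply: le_trans (Re_le_normc _); rewrite !cReD !cReN cReM/= mulr0 sub0r mulNr.
- have := HC (Complex 0 h); rewrite ni real_normK ?num_real// => /(_ h1); apply: le_trans.
  have -> : Complex u (v + h) = Complex u v + Complex 0 h by simpc.
  by apply: le_trans (Im_le_normc _); rewrite !cImD !cImN cImM/= mulr0 addr0.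
Qed.

Lemma ps_cderiv a : entire_seq a -> cderiv (ps a) (ps (dseq a)).
Proof.
move=> ea; have q b (eb : entire_seq b) : cquad (ps b) (ps (dseq b)) by move=> z; exact: ps_quad.
apply: cquad_cderiv; first exact: q.
exact: cquad_ccont2 (q _ (entire_dseq ea)).
Qed.

End PowerSeries.

(** * Taylor series of entire functions commuting with conjugation *)

Section Taylor.
Variable R : realType.

Lemma Re_psN_sub (a d : nat -> R) N (x : R) :
  complex.Re (psN a N x%:C%C - psN d N x%:C%C) = \sum_(k < N) (a k - d k) * x ^+ k.
Proof.
rewrite cReD cReN !Re_psN -sumrB; apply: eq_bigr => j _.
by rewrite -rmorphXn/= mulrBl.
Qed.

(* A Taylor expansion at the origin of a function commuting with conjugation has real
   coefficients: averaging it with the conjugate expansion kills the imaginary parts. *)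
Lemma taylor_real (F F' : R[i] -> R[i]) : cderiv F F' -> (forall z, F (z^*)%C = ((F z)^*)%C) ->
  exists a : nat -> R, [/\ entire_seq a, (forall z, F z = ps a z) &
    forall r (B : R) k, 0 < r -> (forall z, normc z = r -> normc (F z) <= B) ->
      `|a k| * r ^+ k <= 2 * B].
Proof.
move=> dF FJ; pose al r k := complex.Re (tcoef F r k).
have expand r z : normc z < r ->
    exists C : R, forall N, normc (psN (al r) N.+1 z - F z) <= C * (normc z / r) ^+ N.+1.
  move=> zr; have [C1 H1] := tcoef_expansion dF zr.
  have zr' : normc (z^*)%C < r by rewrite normcJ'.
  have [C2 H2] := tcoef_expansion dF zr'.
  exists (C1 + C2) => N; rewrite mulrDl.
  have -> : psN (al r) N.+1 z - F z = 2^-1 * ((\sum_(k < N.+1) tcoef F r k * z ^+ k - F z) +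
      ((\sum_(k < N.+1) tcoef F r k * (z^*)%C ^+ k - F (z^*)%C)^*)%C).
    rewrite FJ rmorphB/= conjcK rmorph_sum/= addrACA -big_split/= -opprD mulrDr.
    rewrite mulr_sumr; congr (_ + _); last by field.
    apply: eq_bigr => k _; rewrite rmorphM/= rmorphXn/= conjcK -mulrDl mulrA; congr (_ * _).
    by rewrite addcJ mulrA mulVf ?mul1r ?pnatr_eq0.
  rewrite normcM.
  have -> : normc (2^-1 : R[i]) = 2^-1.
    have -> : (2^-1 : R[i]) = (2^-1 : R)%:C%C by rewrite fmorphV rmorph_nat.
    by rewrite normc_real ger0_norm// invr_ge0.
  set X := normc (_ + _).
  have X0 : 0 <= X by exact: normc_ge0.
  apply: (@le_trans _ _ X); first by rewrite ler_piMl// invf_le1// ler1n.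
  apply: le_trans (le_normcD _ _) _; apply: lerD; first exact: H1.
  by rewrite normcJ' -[in leRHS](normcJ' z).
have albd r : 0 < r -> exists B : R, forall k, `|al r k| * r ^+ k <= B.
  move=> r0; have [B HB] := ccont_bounded (ccont_Fcirc r dF).
  exists (2 * B) => k; apply: le_trans (tcoef_le k dF r0 HB).
  by rewrite ler_wpM2r ?exprn_ge0 ?(ltW r0)// Re_le_normc.
(* Both expansions converge to F on the real points below [Num.min r s], so their difference has
   zero coefficients. This is what lets one sequence satisfy Cauchy's bound at every radius. *)
have indep r s : 0 < r -> 0 < s -> forall k, al r k = al s k.
  move=> r0 s0 k; have [B1 HB1] := albd _ r0; have [B2 HB2] := albd _ s0.
  pose m := Num.min r s; have m0 : 0 < m by rewrite lt_min r0.
  have b1 j : `|al r j| * m ^+ j <= B1.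
    apply: le_trans (HB1 j); rewrite ler_wpM2l// lerXn2r ?nnegrE ?(ltW m0) ?(ltW r0)//.
    by rewrite ge_min lexx.
  have b2 j : `|al s j| * m ^+ j <= B2.
    apply: le_trans (HB2 j); rewrite ler_wpM2l// lerXn2r ?nnegrE ?(ltW m0) ?(ltW s0)//.
    by rewrite ge_min lexx orbT.
  have geo0 (C q : R) : 0 <= q -> q < 1 -> C * q ^+ N.+1 @[N --> \oo] --> (0 : R).
    move=> q0 q1; rewrite -[X in _ --> X](mulr0 C); apply: cvgM; first exact: cvg_cst.
    by rewrite (cvg_shiftS (fun N => q ^+ N)); apply: cvg_expr; rewrite ger0_norm.
  apply/eqP; rewrite -subr_eq0; apply/eqP.
  apply: (@ps_unique R (fun k => al r k - al s k) (B1 + B2) m^-1 m m0 _ _ _ _ k).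
  - move=> j; rewrite exprVn ler_pdivlMr ?exprn_gt0//.
    apply: (@le_trans _ _ ((`|al r j| + `|al s j|) * m ^+ j)).
      by rewrite ler_wpM2r ?exprn_ge0 ?(ltW m0)// ler_normB.
    by rewrite mulrDl lerD.
  - by rewrite addr_ge0//; [apply: le_trans (b1 0%N)|apply: le_trans (b2 0%N)];
      rewrite mulr_ge0// exprn_ge0 ?(ltW m0).
  - by rewrite invr_gt0.
  move=> x x0 xm; pose z : R[i] := (x%:C)%C.
  have nz : normc z = x by rewrite normc_real ger0_norm ?ltW.
  have xr : x < r by apply: lt_le_trans xm _; rewrite ge_min lexx.
  have xs : x < s by apply: lt_le_trans xm _; rewrite ge_min lexx orbT.
  have [|C1 H1] := expand r z; first by rewrite nz.
  have [|C2 H2] := expand s z; first by rewrite nz.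
  rewrite -(cvg_shiftS (fun N => \sum_(k < N) _)).
  have c0 : C1 * (x / r) ^+ N.+1 + C2 * (x / s) ^+ N.+1 @[N --> \oo] --> (0 : R).
    rewrite -[X in _ --> X](addr0 0); apply: cvgD; apply: geo0;
      rewrite ?divr_ge0 ?(ltW x0) ?(ltW r0) ?(ltW s0)// ltr_pdivrMr// mul1r//.
  apply/norm_cvg0P; apply: (squeeze_cvgr _ (cvg_cst 0) c0).
  apply: nearW => N; rewrite normr_ge0/=.
  have e : \sum_(k < N.+1) (al r k - al s k) * x ^+ k =
      complex.Re ((psN (al r) N.+1 z - F z) - (psN (al s) N.+1 z - F z)).
    by rewrite opprB addrA subrK Re_psN_sub.
  rewrite e; apply: le_trans (Re_le_normc _) _; apply: le_trans (le_normcD _ _) _.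
  by rewrite normcN; apply: lerD; [rewrite -nz; exact: H1|rewrite -nz; exact: H2].
have bdr r (B : R) k : 0 < r -> (forall z, normc z = r -> normc (F z) <= B) -> `|al 1 k| * r ^+ k <= 2 * B.
  move=> r0 HB; rewrite (indep 1 r ltr01 r0).
  apply: le_trans (tcoef_le (B := B) k dF r0 _).
    by rewrite ler_wpM2r ?exprn_ge0 ?(ltW r0)// Re_le_normc.
  by move=> x _; apply: HB; rewrite normc_circ ?ltW.
have ent : entire_seq (al 1).
  by move=> r r0; have [B HB] := albd r r0; exists B => k; rewrite (indep 1 r ltr01 r0).
exists (al 1); split => // z.
(* At this radius the ratio [normc z / r] is at most one half, so the expansion converges at the
   rate required by [ps_unique_limit]. *)
have r0 : 0 < 2 * (normc z + 1) by rewrite mulr_gt0// ltr_wpDl// normc_ge0.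
have zr : normc z < 2 * (normc z + 1) by have := normc_ge0 z; lra.
have [C HC] := expand _ _ zr.
have [B HB] := ent _ r0.
(* The second entry covers the empty partial sum, about which [expand] says nothing. *)
have C0 : 0 <= Num.max C (normc (F z)) by rewrite le_max normc_ge0 orbT.
symmetry; apply: (@ps_unique_limit R _ _ _ B (Num.max C (normc (F z)))) => [k|N].
  apply: le_trans (HB k); rewrite ler_wpM2l// lerXn2r ?nnegrE ?(ltW r0)//.
    by rewrite mulr_ge0 ?normc_ge0.
  by rewrite ler_pM2l// lerDl.
case: N => [|N].
  by rewrite /psN big_ord0 sub0r normcN expr0 mulr1 le_max lexx orbT.
have -> : psN (al 1) N.+1 z = psN (al (2 * (normc z + 1))) N.+1 z.
  by apply: eq_bigr => k _; rewrite (indep _ _ ltr01 r0).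
apply: le_trans (HC N) _; apply: (@le_trans _ _ (Num.max C (normc (F z)) * (normc z / (2 * (normc z + 1))) ^+ N.+1)).
  rewrite ler_wpM2r ?exprn_ge0 ?divr_ge0 ?normc_ge0 ?(ltW r0)//.
  by rewrite le_max lexx.
rewrite ler_wpM2l// lerXn2r ?nnegrE ?divr_ge0 ?normc_ge0 ?(ltW r0) ?invr_ge0//.
rewrite ler_pdivrMr// mulrA mulVf ?pnatr_eq0// mul1r lerDl//.
Qed.

End Taylor.

(** * Proximate orders *)

Section ProximateOrder.
Variable R : realType.
Implicit Types (rho : R -> R) (rinf r s t : R).

Definition pw rho r : R := powR r (rho r).

Lemma pw_ge0 rho r : 0 <= pw rho r.
Proof. exact: powR_ge0. Qed.

Lemma pwE rho r : 0 < r -> pw rho r = expR (rho r * ln r).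
Proof. by move=> r0; rewrite /pw /powR gt_eqF. Qed.

Section One.
Variables (rho : R -> R) (rinf : R).
Hypothesis hp : prox_order rho rinf.

Lemma prox_ge0 r : 0 <= r -> 0 <= rho r.
Proof. by have [+ _] := hp; apply. Qed.

Lemma prox_rinf_gt0 : 0 < rinf.
Proof. by have [_ [_ [_ [+ _]]]] := hp. Qed.

Lemma prox_derivable r : 0 < r -> derivable rho r (1 : R).
Proof. by have [_ [+ _]] := hp; apply. Qed.

Lemma prox_is_derive r : 0 < r -> is_derive r (1 : R) rho (derive1 rho r).
Proof. by move=> r0; rewrite derive1E; apply: derivableP; exact: prox_derivable. Qed.

Lemma pw_le1 r : 0 <= r -> r <= 1 -> pw rho r <= 1.
Proof.
rewrite le_eqVlt => /orP[/eqP <-|r0] r1.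
  by rewrite /pw /powR eqxx; case: eqP.
rewrite pwE// -expR0 ler_expR mulr_ge0_le0 ?prox_ge0 ?(ltW r0)// ln_le0//.
Qed.

Lemma pw_bounded r : exists2 B : R, 0 <= B & forall s, 0 <= s -> s <= r -> pw rho s <= B.
Proof.
pose r1 := Num.max 1 r; have r1_ge1 : 1 <= r1 by rewrite le_max lexx.
have cw : {within `[1, r1], continuous rho}.
  apply: derivable_within_continuous => x; rewrite in_itv/= => /andP[x1 _].
  by apply: prox_derivable; exact: lt_le_trans ltr01 x1.
have [c ci Hc] := EVT_max r1_ge1 cw.
have c0 : 0 <= rho c.
  by apply: prox_ge0; move: ci; rewrite in_itv/= => /andP[c1 _]; exact: le_trans c1.
exists (1 + powR r1 (rho c)); first by rewrite addr_ge0// powR_ge0.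
move=> s s0 sr; have [s1|s1] := leP s 1.
  by apply: le_trans (pw_le1 s0 s1) _; rewrite lerDl powR_ge0.
apply: (@le_trans _ _ (powR r1 (rho c))); last by rewrite lerDr.
have sr1 : s <= r1 by rewrite le_max sr orbT.
apply: (@le_trans _ _ (powR s (rho c))).
  by apply: ler_powR; [exact: ltW|apply: Hc; rewrite in_itv/= (ltW s1)].
by apply: ge0_ler_powR => //; rewrite nnegrE// (le_trans s0).
Qed.

Lemma prox_log_derive t : 0 < t ->
  is_derive t (1 : R) (fun t => rho t * ln t) (derive1 rho t * ln t + rho t * t^-1).
Proof.
move=> t0; exact: (is_deriveMR (prox_is_derive t0) (is_derive1_ln t0) erefl).
Qed.

(* [t * (rho t * ln t)' = rho' t * t * ln t + rho t] tends to [rinf], so [pw rho] grows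
   between the powers [A ^ (rinf / 2)] and [A ^ (rinf + 1)]. *)
Lemma prox_log_growth : exists2 r0 : R, 1 < r0 & forall r (A : R), r0 <= r -> 1 <= A ->
  rho r * ln r + rinf / 2 * ln A <= rho (A * r) * ln (A * r) /\
  rho (A * r) * ln (A * r) <= rho r * ln r + (rinf + 1) * ln A.
Proof.
have rinf0 := prox_rinf_gt0.
have [_ [_ [_ [_ [c1 c2]]]]] := hp.
have [M [_ HM]] : \forall t \near +oo, rinf / 2 <= derive1 rho t * t * ln t + rho t <= rinf + 1.
  have cc : derive1 rho t * t * ln t + rho t @[t --> +oo] --> 0 + rinf by exact: cvgD.
  rewrite add0r in cc.
  have n1 := cvgr_ge _ cc; have n2 := cvgr_le _ cc.
  near=> t; apply/andP; split; near: t; [apply: n1; lra|apply: n2; lra].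
pose r0 := Num.max 2 (M + 1).
have r02 : 2 <= r0 by rewrite le_max lexx.
have r0M : M + 1 <= r0 by rewrite le_max lexx orbT.
exists r0; first by lra.
move=> r A r0r A1.
have rp : 0 < r by lra.
have [A1'|A1'] := eqVneq A 1; first by rewrite A1' mul1r ln1 !mulr0 !addr0.
have A1s : 1 < A by rewrite lt_neqAle eq_sym A1'.
have Ap : 0 < A by lra.
have rAr : r < A * r by rewrite ltr_pMl.
have key (c : R) (x : R) : 0 < x -> is_derive x (1 : R) (fun t => rho t * ln t - c * ln t)
    ((derive1 rho x * x * ln x + rho x - c) / x).
  move=> x0; apply: (is_deriveBR (prox_log_derive x0) (is_deriveMR (is_derive_cst c _ _) (is_derive1_ln x0) erefl)).
  by rewrite mul0r add0r -[cst _ _]/c; field; rewrite gt_eqF.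
(* Subtracting [c * ln] turns both inequalities into the sign of a derivative: nonnegative for
   [c = rinf / 2], nonpositive for [c = rinf + 1]. *)
have mvt (c : R) : exists2 x : R, r <= x & (rho (A * r) * ln (A * r) - c * ln (A * r)) - (rho r * ln r - c * ln r)
    = (derive1 rho x * x * ln x + rho x - c) / x * (A * r - r).
  have dk (x : R) : x \in `]r, (A * r)[ -> is_derive x (1 : R) (fun t => rho t * ln t - c * ln t)
      ((derive1 rho x * x * ln x + rho x - c) / x).
    by rewrite in_itv/= => /andP[rx _]; apply: key; exact: lt_trans rx.
  have ck : {within `[r, (A * r)], continuous (fun t => rho t * ln t - c * ln t)}.
    apply: derivable_within_continuous => x; rewrite in_itv/= => /andP[rx _].
    have x0 := lt_le_trans rp rx.
    by have [] := key c x x0.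
  have [x] := MVT rAr dk ck; rewrite in_itv/= => /andP[rx _] e.
  by exists x => //; exact: ltW.
have lnA : ln (A * r) = ln A + ln r by rewrite lnM.
have pos x : r <= x -> 0 <= (A * r - r) / x.
  by move=> rx; rewrite divr_ge0 ?subr_ge0 ?(ltW rAr)// (le_trans (ltW rp)).
split.
- have [x rx e] := mvt (rinf / 2).
  have /andP[H _] : rinf / 2 <= derive1 rho x * x * ln x + rho x <= rinf + 1 by apply: HM; lra.
  have : 0 <= (derive1 rho x * x * ln x + rho x - rinf / 2) / x * (A * r - r).
    by rewrite mulrAC -mulrA mulr_ge0 ?pos// subr_ge0.
  by rewrite -e lnA; set X := rho (A * r); lra.
- have [x rx e] := mvt (rinf + 1).
  have /andP[_ H] : rinf / 2 <= derive1 rho x * x * ln x + rho x <= rinf + 1 by apply: HM; lra.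
  have : (derive1 rho x * x * ln x + rho x - (rinf + 1)) / x * (A * r - r) <= 0.
    by rewrite mulrAC -mulrA mulr_le0_ge0 ?pos// subr_le0.
  by rewrite -e lnA; set X := rho (A * r); lra.
Unshelve. all: by end_near. Qed.

Lemma pw_growth : exists2 r0 : R, 1 < r0 & forall r (A : R), r0 <= r -> 1 <= A ->
  powR A (rinf / 2) * pw rho r <= pw rho (A * r) /\
  pw rho (A * r) <= powR A (rinf + 1) * pw rho r.
Proof.
have [r0 r01 H] := prox_log_growth; exists r0 => // r A r0r A1.
have rp : 0 < r by lra.
have Ap : 0 < A by lra.
have [H1 H2] := H r A r0r A1.
have e c : powR A c * pw rho r = expR (rho r * ln r + c * ln A).
  by rewrite pwE// /powR gt_eqF// -expRD addrC.
by rewrite !e pwE ?mulr_gt0// !ler_expR.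
Qed.

(** Beyond [r0] this is the upper growth bound; below it [pw rho (M * r)] is merely bounded, which
    the [+ 1] accounts for. *)
Lemma pw_scale (M : R) : 1 <= M -> exists2 K : R, 0 <= K &
  forall r, 0 <= r -> pw rho (M * r) <= K * (pw rho r + 1).
Proof.
move=> M1; have [r0 r01 H] := pw_growth.
have [B B0 HB] := pw_bounded (M * r0).
have P0 : 0 <= powR M (rinf + 1) by exact: powR_ge0.
exists (B + powR M (rinf + 1)); first by rewrite addr_ge0.
move=> r rp; have V0 := pw_ge0 rho r.
have [r0r|rr0] := leP r0 r.
  have [_ /le_trans] := H r M r0r M1; apply.
  rewrite mulrDl mulrDr mulr1; have : 0 <= B * (pw rho r + 1) by rewrite mulr_ge0// addr_ge0.
  lra.
apply: (@le_trans _ _ B).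
  by apply: HB; [rewrite mulr_ge0//; lra|rewrite ler_wpM2l ?(ltW rr0)//; lra].
rewrite mulrDl [B * _]mulrDr mulr1.
have : 0 <= powR M (rinf + 1) * (pw rho r + 1) by rewrite mulr_ge0// addr_ge0.
have : 0 <= B * pw rho r by rewrite mulr_ge0.
lra.
Qed.

End One.

Lemma pw_eventually_eq rho1 rho2 r1 r2 : prox_order rho1 r1 -> prox_order rho2 r2 ->
  (\forall r \near +oo, rho1 r = rho2 r) ->
  exists2 c : R, 0 <= c & forall r, 0 <= r -> pw rho1 r <= pw rho2 r + c.
Proof.
move=> h1 h2 [M [_ HM]]; have [B B0 HB] := pw_bounded h1 M.
exists B => // r r0; have [rM|Mr] := leP r M.
  by apply: le_trans (HB r r0 rM) _; rewrite lerDr pw_ge0.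
by rewrite /pw HM// lerDl.
Qed.

Lemma pw_bigO rho1 rho2 r1 : prox_order rho1 r1 ->
  (exists C : R, \forall r \near +oo, powR r (rho1 r) <= C * powR r (rho2 r)) ->
  exists2 c : R, 0 <= c & forall r, 0 <= r -> pw rho1 r <= c * (pw rho2 r + 1).
Proof.
move=> h1 [C [M [_ HM]]]; have [B B0 HB] := pw_bounded h1 M.
exists (B + `|C|); first by rewrite addr_ge0.
move=> r r0; have V0 := pw_ge0 rho2 r; rewrite mulrDl.
have [rM|Mr] := leP r M.
  apply: le_trans (HB r r0 rM) _; rewrite mulrDr mulr1 addrAC lerDr addr_ge0// mulr_ge0// addr_ge0//.
apply: le_trans (HM r Mr) _; rewrite -/(pw rho2 r).
apply: (@le_trans _ _ (`|C| * (pw rho2 r + 1))); last by rewrite lerDr mulr_ge0// addr_ge0.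
rewrite mulrDr mulr1; apply: (@le_trans _ _ (`|C| * pw rho2 r)); last by rewrite lerDl.
by rewrite ler_wpM2r// ler_norm.
Qed.

(** * Normalized orders and the inverse function [phi] *)

Section Normalized.
Variables (rho : R -> R) (rinf : R).
Hypothesis hn : normalized_prox_order rho rinf.
Let hp : prox_order rho rinf. Proof. by case: hn. Qed.

Lemma pw_lt r s : 0 < r -> r < s -> pw rho r < pw rho s.
Proof. by case: hn => _ [H _]; exact: H. Qed.

Lemma pw_le r s : 0 < r -> r <= s -> pw rho r <= pw rho s.
Proof. by move=> r0; rewrite le_eqVlt => /orP[/eqP <-//|rs]; exact/ltW/pw_lt. Qed.

(** Monotonicity is known only on positive radii. At 0 the power is 0 or 1 according to whether the
    exponent vanishes there, whence the [+ 1]. *)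
Lemma pw_le_ge0 r s : 0 <= r -> r <= s -> pw rho r <= pw rho s + 1.
Proof.
rewrite le_eqVlt => /orP[/eqP <-|r0] rs.
  by apply: le_trans (pw_le1 hp (lexx 0) ler01) _; rewrite lerDr pw_ge0.
by apply: le_trans (pw_le r0 rs) _; rewrite lerDl.
Qed.

Lemma pw_surj s : 0 < s -> exists r, 0 < r /\ pw rho r = s.
Proof.
move=> s0; have [_ [_ c0]] := hn.
have [a a0 Ha] : exists2 a : R, 0 < a & pw rho a <= s.
  have n1 := cvgr_le _ c0 s s0.
  have [a [a0 Ha]] : exists a : R, 0 < a /\ powR a (rho a) <= s.
    near (0 : R)^'+ => a; exists a; split; near: a; [exact: nbhs_right_gt|exact: n1].
  by exists a.
have rinf0 := prox_rinf_gt0 hp.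
have [r0 r01 Hg] := pw_growth hp.
have [b ab Hb] : exists2 b : R, a <= b & s <= pw rho b.
  have V0 : 0 < pw rho r0 by rewrite pwE ?expR_gt0//; lra.
  (* [A] satisfies [powR A (rinf / 2) >= s / pw rho r0], so the lower growth bound lifts [pw rho]
     above [s] at [A * r0]; the maximum with [a] orders the two endpoints. *)
  pose y := Num.max 1 (s / pw rho r0); pose A := Num.max (powR y (2 / rinf)) a.
  have y1 : 1 <= y by rewrite le_max lexx.
  have pA : 1 <= powR y (2 / rinf).
    by have := @ler_powR _ y y1 0 (2 / rinf); rewrite powRr0; apply; rewrite divr_ge0// ltW.
  have A1 : 1 <= A by rewrite le_max pA.
  have aA : a <= A by rewrite le_max lexx orbT.
  have [H _] := Hg r0 A (lexx _) A1.
  exists (A * r0); first by apply: le_trans aA _; rewrite ler_pMr ?ltW//; lra.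
  apply: le_trans H; rewrite -ler_pdivrMr//.
  apply: (@le_trans _ _ y); first by rewrite le_max lexx orbT.
  apply: (@le_trans _ _ (powR (powR y (2 / rinf)) (rinf / 2))).
    rewrite -powRrM (_ : 2 / rinf * (rinf / 2) = 1) ?powRr1 ?(le_trans ler01)//.
    by field; rewrite gt_eqF.
  apply: ge0_ler_powR; rewrite ?nnegrE ?powR_ge0 ?divr_ge0 ?(ltW rinf0)// ?(le_trans ler01)//.
  by rewrite le_max lexx.
have cw : {within `[a, b], continuous (pw rho)}.
  have : {within `[a, b], continuous (fun r => expR (rho r * ln r))}.
    apply: derivable_within_continuous => x; rewrite in_itv/= => /andP[ax _].
    have x0 := lt_le_trans a0 ax.
    have := @is_derive1_comp R (@expR R) (fun t => rho t * ln t) x _ _ (is_derive_expR _) (prox_log_derive hp x0).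
    by case.
  apply: subspace_eq_continuous => x; rewrite inE/= in_itv/= => /andP[ax _].
  by symmetry; exact: (pwE rho (lt_le_trans a0 ax)).
have [] := @IVT _ _ a b s ab cw.
  by rewrite ge_min Ha le_max Hb orbT.
move=> c; rewrite in_itv/= => /andP[ac _] e; exists c; split => //.
exact: lt_le_trans ac.
Unshelve. all: by end_near. Qed.

Lemma phiP s : 0 < s -> 0 < phi rho s /\ pw rho (phi rho s) = s.
Proof.
move=> /pw_surj H; rewrite /phi.
exact: (ClassicalEpsilon.epsilon_spec (inhabits 0) (fun r => 0 < r /\ powR r (rho r) = s) H).
Qed.

Lemma phi_le s t : 0 < s -> s <= t -> phi rho s <= phi rho t.
Proof.
move=> s0 st; have t0 := lt_le_trans s0 st.
have [ps es] := phiP s0; have [pt et] := phiP t0.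
rewrite leNgt; apply/negP => /(pw_lt pt); rewrite es et; lra.
Qed.

Lemma phiX_ge0 l : 0 <= phi rho l%:R ^+ l.
Proof.
case: l => [|l]; first by rewrite expr0.
have [p _] := @phiP l.+1%:R (ltr0Sn _ _).
by rewrite exprn_ge0// ltW.
Qed.

Lemma phiX_gt0 l : 0 < phi rho l%:R ^+ l.
Proof.
case: l => [|l]; first by rewrite expr0.
have [p _] := @phiP l.+1%:R (ltr0Sn _ _).
by rewrite exprn_gt0.
Qed.

(** Both factors grow when [phi] is taken at [k + m]. Exponent 0 is treated apart because [phi] at 0
    is an unspecified value. *)
Lemma phiX_mul k m :
  phi rho k%:R ^+ k * phi rho m%:R ^+ m <= phi rho (k + m)%:R ^+ (k + m).
Proof.
have mono i j : phi rho i%:R ^+ i <= phi rho (i + j)%:R ^+ i.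
  case: i => [|i]; first by rewrite !expr0.
  have [p _] := @phiP i.+1%:R (ltr0Sn _ _).
  have le : phi rho i.+1%:R <= phi rho (i.+1 + j)%:R.
    by apply: phi_le; rewrite ?ltr0Sn// ler_nat leq_addr.
  by rewrite lerXn2r ?nnegrE ?(ltW p)// (le_trans (ltW p)).
rewrite exprD; apply: ler_pM; [exact: phiX_ge0|exact: phiX_ge0|exact: mono|].
by rewrite addnC; exact: mono.
Qed.

(** In this form G_l is [phi(l) ^ l] up to a geometric factor, which can be traded against the free
    [eps ^ l] of the growth condition; the case [l = 0] is included. *)
Lemma Gcoef_phi l : Gcoef rho rinf l =
  phi rho l%:R ^+ l / powR (expR 1 * rinf) rinf^-1 ^+ l.
Proof.
rewrite /Gcoef; case: eqP => [->|_]; first by rewrite !expr0 divr1.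
congr (_ / _); rewrite -powR_mulrn ?powR_ge0// -powRrM; congr (powR _ _).
by rewrite mulrC.
Qed.

(** This is [1 + ln y <= y] at [y = e * tau * powR A tau], solved for [ln A]. The maximum with 1
    makes the powers of [D] at least 1. *)
Lemma pw_lower_scaled (tau : R) (e : R) : 0 < tau -> 0 < e -> exists2 D : R, 1 <= D &
  forall A : R, 1 <= A -> A <= D * expR (e * powR A tau).
Proof.
move=> t0 e0; exists (Num.max 1 (expR (- (1 + ln (e * tau)) / tau))); first by rewrite le_max lexx.
move=> A A1; have A0 : 0 < A by lra.
apply: (@le_trans _ _ (expR (- (1 + ln (e * tau)) / tau) * expR (e * powR A tau))); last first.
  by rewrite ler_wpM2r ?expR_ge0// le_max lexx orbT.
rewrite -expRD -[leLHS]lnK ?posrE// ler_expR.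
have P0 : 0 < powR A tau by rewrite powR_gt0.
have y0 : 0 < e * tau * powR A tau by rewrite !mulr_gt0.
have := expR_ge1Dx (ln (e * tau * powR A tau)); rewrite lnK ?posrE// lnM ?posrE ?mulr_gt0// ln_powR => H.
rewrite -(@ler_pM2l _ tau)// mulrDr (_ : tau * (- (1 + ln (e * tau)) / tau) = - (1 + ln (e * tau))); last by field; rewrite gt_eqF.
by set P := powR A tau in H *; set L := ln (e * tau) in H *; nra.
Qed.

(** For [r <= phi(k)] the power alone suffices. For [r = A * phi(k)] with [A > 1] the exponent is at
    least [A ^ (rinf / 2) * k], and the excess [A ^ k] is absorbed into [D ^ k] by the preceding
    lemma. This requires [phi(k) >= r0]; the finitely many smaller k only affect the constant. *)
Lemma monomial_bound (e : R) : 0 < e -> exists C D : R, [/\ 0 < C, 0 < D &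
  forall k r, 0 <= r -> r ^+ k * expR (- e * pw rho r) <= C * D ^+ k * phi rho k%:R ^+ k].
Proof.
move=> e0; have rinf0 := prox_rinf_gt0 hp.
have [r0 r01 Hg] := pw_growth hp.
have [|D D1 HD] := @pw_lower_scaled (rinf / 2) e _ e0; first by rewrite divr_gt0.
have D0 : 0 < D by lra.
have ex1 r : expR (- e * pw rho r) <= 1.
  by rewrite -expR0 ler_expR mulNr oppr_le0 mulr_ge0 ?pw_ge0 ?ltW.
(* From [l0] on, [pw rho (phi l) = l] exceeds [pw rho r0], so [phi l] lies in the range of the
   growth bounds. *)
pose l0 := (Num.truncn (pw rho r0)).+1.
have Hl0 l : (l0 <= l)%N -> 0 < phi rho l%:R /\ pw rho (phi rho l%:R) = l%:R /\ r0 <= phi rho l%:R.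
  move=> ll; have l_gt0 : (0 : R) < l%:R by rewrite ltr0n (leq_trans _ ll).
  have [p e'] := phiP l_gt0; split => //; split => //.
  rewrite leNgt; apply/negP => lt.
  have := pw_lt p lt; rewrite e'.
  have : pw rho r0 < l0%:R by exact: truncnS_gt.
  have : (l0%:R : R) <= l%:R by rewrite ler_nat.
  lra.
have big l r : (l0 <= l)%N -> 0 <= r -> r ^+ l * expR (- e * pw rho r) <= D ^+ l * phi rho l%:R ^+ l.
  move=> ll rp; have [p [e' r0p]] := Hl0 l ll.
  have [rle|rgt] := leP r (phi rho l%:R).
    apply: (@le_trans _ _ (r ^+ l)); first by rewrite ler_piMr ?exprn_ge0.
    apply: (@le_trans _ _ (phi rho l%:R ^+ l)); first by rewrite lerXn2r ?nnegrE ?(ltW p).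
    by rewrite ler_peMl ?exprn_ge0 ?(ltW p)// exprn_ege1.
  pose A := r / phi rho l%:R.
  have A1 : 1 <= A by rewrite ler_pdivlMr// mul1r ltW.
  have rE : r = A * phi rho l%:R by rewrite /A divfK ?gt_eqF.
  have [H _] := Hg _ _ r0p A1; rewrite -rE e' in H.
  rewrite rE exprMn mulrAC -rE ler_wpM2r ?exprn_ge0 ?(ltW p)//.
  apply: (@le_trans _ _ (A ^+ l * expR (- e * (powR A (rinf / 2) * l%:R)))).
    rewrite ler_wpM2l ?exprn_ge0 ?(le_trans ler01)//.
    by rewrite ler_expR !mulNr lerN2 ler_wpM2l// ltW.
  have -> : - e * (powR A (rinf / 2) * l%:R) = l%:R * (- (e * powR A (rinf / 2))) by ring.
  have A0 : 0 <= A := le_trans ler01 A1.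
  rewrite expRM_natl -exprMn lerXn2r ?nnegrE ?(ltW D0)//; first exact: mulr_ge0 A0 (expR_ge0 _).
  by rewrite expRN ler_pdivrMr ?expR_gt0// HD.
(* A positive lower bound for the finitely many remaining [phi(k) ^ k]; small powers of r are
   bounded by 1 or by the power [l0], and dividing by [m] restores the required form. *)
have [m m0 Hm] : exists2 m : R, 0 < m & forall k, (k < l0)%N -> m <= phi rho k%:R ^+ k.
  elim: l0 {Hl0 big} => [|l [m m0 IH]]; first by exists 1.
  exists (Num.min m (phi rho l%:R ^+ l)); first by rewrite lt_min m0 phiX_gt0.
  move=> k; rewrite ltnS leq_eqVlt => /orP[/eqP ->|kl]; first by rewrite ge_min lexx orbT.
  by rewrite ge_min IH.
pose B := 1 + D ^+ l0 * phi rho l0%:R ^+ l0.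
have DP : 0 <= D ^+ l0 * phi rho l0%:R ^+ l0 := mulr_ge0 (exprn_ge0 l0 (ltW D0)) (phiX_ge0 l0).
have B0 : 0 < B by rewrite ltr_pwDl.
have Bm : 0 <= B / m by rewrite divr_ge0 ?(ltW B0) ?(ltW m0).
exists (1 + B / m), D; split => //; first by rewrite ltr_wpDr.
move=> k r rp; have Dk : 1 <= D ^+ k by rewrite exprn_ege1.
have P := phiX_gt0 k.
have [kl|lk] := ltnP k l0; last first.
  apply: le_trans (big k r lk rp) _; rewrite -mulrA ler_peMl// ?mulr_ge0 ?(ltW P) ?(le_trans ler01)//.
  by rewrite lerDl.
apply: (@le_trans _ _ B).
  have [r1|r1] := leP r 1.
    apply: (@le_trans _ _ 1); last by rewrite lerDl.
    by rewrite mulr_ile1 ?exprn_ge0 ?expR_ge0// exprn_ile1.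
  apply: (@le_trans _ _ (r ^+ l0 * expR (- e * pw rho r))).
    rewrite ler_wpM2r ?expR_ge0//; apply: ler_weXn2l; first exact: ltW.
    exact: ltnW.
  by apply: le_trans (big l0 r (leqnn _) rp) _; rewrite lerDr.
apply: (@le_trans _ _ (B / m * m)); first by rewrite divfK ?gt_eqF.
apply: (@le_trans _ _ (B / m * phi rho k%:R ^+ k)); first by rewrite ler_wpM2l// Hm.
rewrite ler_wpM2r ?(ltW P)//; apply: (@le_trans _ _ (1 + B / m)); first by rewrite lerDr.
by rewrite ler_peMr// addr_ge0.
Qed.

End Normalized.
End ProximateOrder.

(** * The Clifford algebra *)

Section Clifford.
Variables (R : realType) (n : nat).
Local Notation Cl := (Cl R n).
Local Notation blade := {set 'I_n}.
Implicit Types (A B C D : blade) (a b c : Cl).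

Lemma in_symdiff (i : 'I_n) A B : (i \in symdiff A B) = (i \in A) (+) (i \in B).
Proof. by rewrite !inE; case: (i \in A); case: (i \in B). Qed.

Lemma symdiffK A B : symdiff A (symdiff A B) = B.
Proof. by apply/setP => i; rewrite !in_symdiff addbA addbb. Qed.
Lemma symdiff_eq A B C : (symdiff A B == C) = (B == symdiff A C).
Proof. by apply/eqP/eqP => [<-|->]; rewrite symdiffK. Qed.

(** The inversions and the squares e_i^2 = -1 merge into the single condition [j <= i]. In this form
    the sign is visibly multiplicative in each argument under symmetric difference, from which
    associativity follows. *)
Lemma clsign_prod A B : clsign R A B =
  \prod_(i : 'I_n) \prod_(j : 'I_n) (-1) ^+ ((i \in A) && (j \in B) && (j <= i)%N).
Proof.
rewrite /clsign exprD.
have -> : (-1 : R) ^+ #|[set p : 'I_n * 'I_n | (p.1 \in A) && (p.2 \in B) && (p.2 < p.1)%N]%SET| =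
    \prod_(i : 'I_n) \prod_(j : 'I_n) (-1) ^+ ((i \in A) && (j \in B) && (j < i)%N).
  rewrite -prodr_const big_mkcond/= pair_big/=; apply: eq_bigr => p _; rewrite inE.
  by case: ifP.
have -> : (-1 : R) ^+ #|A :&: B| =
    \prod_(i : 'I_n) \prod_(j : 'I_n) (-1) ^+ ((i \in A) && (j \in B) && (j == i)).
  rewrite -prodr_const big_mkcond/=; apply: eq_bigr => i _; rewrite inE.
  rewrite (bigD1 i)//= big1 ?mulr1; last by move=> j /negbTE ->; rewrite andbF.
  by rewrite eqxx andbT; case: ifP.
rewrite -big_split/=; apply: eq_bigr => i _; rewrite -big_split/=; apply: eq_bigr => j _.
rewrite -(inj_eq val_inj)/= [in RHS]leq_eqVlt.
case: eqP => [->|_] /=; first by rewrite ltnn andbF mul1r andbT.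
by rewrite andbF mulr1.
Qed.

Lemma clsign_symdiffl A B C : clsign R (symdiff A B) C = clsign R A C * clsign R B C.
Proof.
rewrite !clsign_prod -big_split/=; apply: eq_bigr => i _; rewrite -big_split/=.
apply: eq_bigr => j _; rewrite in_symdiff.
by case: (i \in A); case: (i \in B); case: (j \in C); case: (j <= i)%N; rewrite /= ?mulr1 ?mul1r ?mulrNN ?mulr1.
Qed.

Lemma clsign_symdiffr A B C : clsign R A (symdiff B C) = clsign R A B * clsign R A C.
Proof.
rewrite !clsign_prod -big_split/=; apply: eq_bigr => i _; rewrite -big_split/=.
apply: eq_bigr => j _; rewrite in_symdiff.
by case: (i \in A); case: (j \in B); case: (j \in C); case: (j <= i)%N; rewrite /= ?mulr1 ?mul1r ?mulrNN ?mulr1.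
Qed.

Lemma clsign_norm A B : `|clsign R A B| = 1.
Proof. by rewrite /clsign normrX normrN1 expr1n. Qed.

Lemma clmulE a b C : clmul a b C = \sum_A clsign R A (symdiff A C) * a A * b (symdiff A C).
Proof.
rewrite ffunE; apply: eq_bigr => A _.
under eq_bigl do rewrite symdiff_eq.
by rewrite big_pred1_eq.
Qed.

(** After reindexing by [symdiff A E] the summands agree except for their signs, and
    bimultiplicativity splits both sign products into the same factors. *)
Lemma clmulA a b c : clmul a (clmul b c) = clmul (clmul a b) c.
Proof.
apply/ffunP => D; rewrite [LHS]clmulE [RHS]clmulE.
under eq_bigr do rewrite clmulE mulr_sumr.
under [RHS]eq_bigr do rewrite clmulE mulr_sumr mulr_suml.
rewrite [RHS]exchange_big/=; apply: eq_bigr => A _.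
rewrite (reindex_inj (inv_inj (symdiffK A)))/=; apply: eq_bigr => E _.
have -> : symdiff (symdiff A E) (symdiff A D) = symdiff E D.
  by apply/setP => i; rewrite !in_symdiff; case: (i \in A); case: (i \in E); case: (i \in D).
have -> : clsign R A (symdiff A D) = clsign R A (symdiff A E) * clsign R A (symdiff E D).
  rewrite -clsign_symdiffr; congr clsign.
  by apply/setP => i; rewrite !in_symdiff; case: (i \in A); case: (i \in E); case: (i \in D).
have -> : clsign R E (symdiff E D) = clsign R A (symdiff E D) * clsign R (symdiff A E) (symdiff E D).
  rewrite -clsign_symdiffl; congr clsign.
  by apply/setP => i; rewrite !in_symdiff; case: (i \in A); case: (i \in E).
by ring.
Qed.

Lemma clmulDl a b c : clmul (cladd a b) c = cladd (clmul a c) (clmul b c).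
Proof.
apply/ffunP => D; rewrite [RHS]ffunE !clmulE -big_split/=; apply: eq_bigr => A _.
by rewrite ffunE; ring.
Qed.

Lemma cl_le_norm a A : `|a A| <= clnorm a.
Proof.
rewrite -sqrtr_sqr ler_wsqrtr// (bigD1 A)//= lerDl sumr_ge0// => B _.
exact: sqr_ge0.
Qed.

Lemma clnorm_ge0 a : 0 <= clnorm a.
Proof. exact: sqrtr_ge0. Qed.

Definition blades : R := #|{: blade}|%:R.

Lemma blades_ge1 : 1 <= blades.
Proof.
rewrite /blades ler1n; apply/card_gt0P; by exists finset.set0.
Qed.

Lemma blades_ge0 : 0 <= blades.
Proof. exact: le_trans ler01 blades_ge1. Qed.

Lemma sum_blades_le (f : blade -> R) (x : R) : (forall A, f A <= x) -> \sum_A f A <= blades * x.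
Proof.
move=> fx; apply: (@le_trans _ _ (\sum_(A : blade) x)); first exact: ler_sum.
by rewrite sumr_const mulr_natl.
Qed.

(** Together with [cl_le_norm] this exchanges the Euclidean norm for componentwise bounds; each
    exchange costs the dimension 2^n. *)
Lemma clnorm_le a (x : R) : (forall A, `|a A| <= x) -> clnorm a <= blades * x.
Proof.
move=> ax; have x0 : 0 <= x := le_trans (normr_ge0 _) (ax finset.set0).
rewrite -[leRHS]ger0_norm ?mulr_ge0 ?blades_ge0// -sqrtr_sqr ler_wsqrtr// exprMn.
apply: (@le_trans _ _ (blades * x ^+ 2)).
  apply: sum_blades_le => A; rewrite -real_normK ?num_real// lerXn2r ?nnegrE//.
by rewrite ler_wpM2r ?sqr_ge0// expr2 ler_peMl ?blades_ge0// blades_ge1.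
Qed.

Lemma clmul_le a b (x y : R) : (forall A, `|a A| <= x) -> (forall A, `|b A| <= y) ->
  forall A, `|clmul a b A| <= blades * (x * y).
Proof.
move=> ax byy C; rewrite clmulE; apply: le_trans (ler_norm_sum _ _ _) _.
apply: sum_blades_le => A; rewrite !normrM clsign_norm mul1r.
by apply: ler_pM.
Qed.

(** The generator of index [i0] as a point of the sphere, the fixed imaginary unit on which
    components are read off; the unit of the algebra is [cl1]. *)
Definition e1 (i0 : 'I_n) : 'I_n -> R := fun l => (l == i0)%:R.

Lemma jclE (j : 'I_n -> R) A : jcl j A = \sum_(l : 'I_n | A == finset.set1 l) j l.
Proof.
rewrite ffunE /=; case: eqP => [/eqP|/eqP A0].
  rewrite cards_eq0 => /eqP ->; rewrite big1// => l /eqP/setP/(_ l).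
  by rewrite !inE eqxx.
case: pickP => [l /eqP Al|noA].
  rewrite (bigD1 l) ?Al//= big1 ?addr0// => i /andP[/eqP/set1_inj -> ]; by rewrite eqxx.
by rewrite big1// => l; rewrite noA.
Qed.

Lemma inS_e1 i0 : inS (e1 i0).
Proof.
rewrite /inS (bigD1 i0)//= /e1 eqxx expr1n big1 ?addr0// => l /negbTE ->.
by rewrite expr0n.
Qed.

Lemma jcl_e1 i0 A : jcl (e1 i0) A = (A == finset.set1 i0)%:R.
Proof.
rewrite jclE; case: eqP => [->|H].
  rewrite (bigD1 i0)//= /e1 eqxx big1 ?addr0// => l /andP[/eqP/set1_inj -> ].
  by rewrite eqxx.
rewrite big1// => l /eqP Al; rewrite /e1; case: eqP => // li.
by case: H; rewrite Al li.
Qed.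

Lemma clmul_e1 i0 b C : clmul (jcl (e1 i0)) b C =
  clsign R (finset.set1 i0) (symdiff (finset.set1 i0) C) * b (symdiff (finset.set1 i0) C).
Proof.
rewrite clmulE (bigD1 (finset.set1 i0))//= jcl_e1 eqxx mulr1 big1 ?addr0// => A /negbTE h.
by rewrite jcl_e1 h mulr0 mul0r.
Qed.

Lemma clmul_e1K i0 b : clmul (jcl (e1 i0)) (clmul (jcl (e1 i0)) b) = clopp b.
Proof.
apply/ffunP => C; rewrite !clmul_e1 symdiffK ffunE mulrA -clsign_symdiffr.
have -> : symdiff (symdiff (finset.set1 i0) C) C = finset.set1 i0.
  by apply/setP => i; rewrite !in_symdiff -addbA addbb addbF.
rewrite (_ : clsign _ _ _ = -1) ?mulN1r// /clsign finset.setIid cards1.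
rewrite (_ : [set p | _]%SET = finset.set0) ?cards0 ?expr1//.
apply/setP => -[i j]; rewrite !inE /=; apply/negbTE/negP => /andP[/andP[/eqP -> /eqP ->]].
by rewrite ltnn.
Qed.

Lemma jcl_le (j : 'I_n -> R) (x : R) : (forall l, `|j l| <= x) -> 0 <= x -> forall A, `|jcl j A| <= x.
Proof.
move=> jx x0 A; rewrite ffunE/=; case: ifP => _; first by rewrite normr0.
by case: pickP => [l _|_]; rewrite ?normr0.
Qed.

Lemma jcl_scale (j : 'I_n -> R) (s : R) : jcl (fun l => s * j l) = clscale s (jcl j).
Proof. by apply/ffunP => A; rewrite [RHS]ffunE !jclE mulr_sumr. Qed.

Lemma clmul_scalel (s : R) a b : clmul (clscale s a) b = clscale s (clmul a b).
Proof.
apply/ffunP => C; rewrite [RHS]ffunE !clmulE mulr_sumr; apply: eq_bigr => A _.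
by rewrite ffunE; ring.
Qed.
Lemma clmul_scaler (s : R) a b : clmul a (clscale s b) = clscale s (clmul a b).
Proof.
apply/ffunP => C; rewrite [RHS]ffunE !clmulE mulr_sumr; apply: eq_bigr => A _.
by rewrite ffunE; ring.
Qed.
Lemma cloppE a : clopp a = clscale (-1) a.
Proof. by apply/ffunP => C; rewrite !ffunE mulN1r. Qed.

Lemma claddE a b A : cladd a b A = a A + b A.
Proof. by rewrite ffunE. Qed.

Lemma cloppEE a A : clopp a A = - a A.
Proof. by rewrite ffunE. Qed.

Lemma clscaleE (s : R) a A : clscale s a A = s * a A.
Proof. by rewrite ffunE. Qed.

Definition cl1 : Cl := [ffun A : blade => (A == finset.set0)%:R].

(** Bimultiplicativity gives s = s * s, and s is nonzero because its modulus is 1. *)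
Lemma clsign0l (A : blade) : clsign R finset.set0 A = 1.
Proof.
have := clsign_symdiffl finset.set0 finset.set0 A.
have -> : symdiff finset.set0 finset.set0 = finset.set0 :> blade.
  by apply/setP => i; rewrite in_symdiff addbb inE.
rewrite -{1}[clsign R finset.set0 A]mulr1 => /(mulfI _) <-//.
by rewrite -normr_eq0 clsign_norm oner_eq0.
Qed.

Lemma clsign0r (A : blade) : clsign R A finset.set0 = 1.
Proof.
have := clsign_symdiffr A finset.set0 finset.set0.
have -> : symdiff finset.set0 finset.set0 = finset.set0 :> blade.
  by apply/setP => i; rewrite in_symdiff addbb inE.
rewrite -{1}[clsign R A finset.set0]mulr1 => /(mulfI _) <-//.
by rewrite -normr_eq0 clsign_norm oner_eq0.
Qed.

Lemma symdiff0l (A : blade) : symdiff finset.set0 A = A.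
Proof. by apply/setP => i; rewrite in_symdiff inE addFb. Qed.

Lemma clmulr1 (a : Cl) : clmul a cl1 = a.
Proof.
apply/ffunP => C; rewrite clmulE (bigD1 C)//= big1 => [|A AC].
  have -> : symdiff C C = finset.set0 by apply/setP => i; rewrite in_symdiff addbb inE.
  by rewrite addr0 clsign0r mul1r [cl1 _]ffunE eqxx mulr1.
rewrite [cl1 _]ffunE; case: eqP => [AC0|_]; last by rewrite mulr0.
case/eqP: AC; apply/setP => i; have /setP/(_ i) := AC0.
by rewrite in_symdiff inE; case: (i \in A); case: (i \in C).
Qed.

Lemma clmul0r (a : Cl) : clmul a (clzero R n) = clzero R n.
Proof.
apply/ffunP => C; rewrite clmulE [RHS]ffunE big1// => A _.
by rewrite [clzero R n _]ffunE mulr0.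
Qed.

Lemma clscale1 (a : Cl) : clscale 1 a = a.
Proof. by apply/ffunP => A; rewrite clscaleE mul1r. Qed.

Lemma clnorm_scale (s : R) (a : Cl) : 0 <= s -> clnorm (clscale s a) = s * clnorm a.
Proof.
move=> s0; rewrite /clnorm; under eq_bigr do rewrite clscaleE exprMn.
by rewrite -mulr_sumr sqrtrM ?sqr_ge0// sqrtr_sqr ger0_norm.
Qed.

End Clifford.

(** * Slice functions as families of entire functions *)

Section SliceFamilies.
Variables (R : realType) (n : nat).
Local Notation Cl := (Cl R n).
Local Notation blade := {set 'I_n}.
Local Notation para := (para R n).
Implicit Types (F G : blade -> R[i] -> R[i]) (f g : para -> Cl) (x : para).

Definition re_part F (u v : R) : Cl := [ffun A => complex.Re (F A (Complex u v))].
Definition im_part F (u v : R) : Cl := [ffun A => complex.Im (F A (Complex u v))].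

Definition slice_coord x : R[i] := Complex x.1 (xv x).

Definition slice_value (w : blade -> R[i]) x : Cl :=
  cladd [ffun A => complex.Re (w A)] (clmul (jcl (xj x)) [ffun A => complex.Im (w A)]).

(* The family [F] encodes the function [u + j v |-> sum_A (Re (F A (u + i v)) + j Im (F A (u + i v))) e_A]. *)
Definition slice_fun F : para -> Cl := fun x => slice_value (F ^~ (slice_coord x)) x.

(** Commuting with conjugation encodes the parity of the components: real part even and imaginary
    part odd in v. *)
Definition holo_family F := forall A,
  (exists dF : R[i] -> R[i], cderiv (F A) dF) /\ forall z, F A (z^*)%C = ((F A z)^*)%C.

Lemma xv_ge0 x : 0 <= xv x.
Proof. exact: sqrtr_ge0. Qed.

Lemma normc_slice_coord x : normc (slice_coord x) = pnorm x.
Proof. by rewrite normcE' /= /pnorm /xv sqr_sqrtr// sumr_ge0// => l _; exact: sqr_ge0. Qed.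

Lemma pnorm_ge0 x : 0 <= pnorm x.
Proof. exact: sqrtr_ge0. Qed.

Lemma xv_slicept (u v : R) (j : 'I_n -> R) : inS j -> xv (slicept u v j) = `|v|.
Proof.
move=> jS; rewrite /xv /=; under eq_bigr do rewrite exprMn.
by rewrite -mulr_sumr jS mulr1 sqrtr_sqr.
Qed.

Lemma pnorm_slicept (u v : R) (j : 'I_n -> R) : inS j ->
  pnorm (slicept u v j) = normc (Complex u v).
Proof.
by move=> jS; rewrite -normc_slice_coord /slice_coord xv_slicept// !normcE'/= real_normK ?num_real.
Qed.

Lemma slicept_xj x : xv x != 0 -> slicept x.1 (xv x) (xj x) = x.
Proof.
move=> x0; rewrite /slicept [RHS]surjective_pairing; congr pair.
by apply/funext => l; rewrite /xj mulrC divfK.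
Qed.

Lemma inS_xj x : xv x != 0 -> inS (xj x).
Proof.
move=> x0; rewrite /inS /xj; under eq_bigr do rewrite expr_div_n.
rewrite -mulr_suml; have -> : \sum_(i < n) x.2 i ^+ 2 = xv x ^+ 2.
  by rewrite sqr_sqrtr// sumr_ge0// => l _; exact: sqr_ge0.
by rewrite divff// expf_neq0.
Qed.

Lemma slicept_real x (j : 'I_n -> R) : xv x = 0 -> slicept x.1 0 j = x.
Proof.
move=> /eqP; rewrite sqrtr_eq0 => xle.
have x0 : \sum_(l < n) x.2 l ^+ 2 = 0.
  by apply: le_anti; rewrite xle sumr_ge0// => l _; exact: sqr_ge0.
rewrite /slicept [RHS]surjective_pairing; congr pair; apply/funext => l; rewrite mul0r.
move/eqP: x0; rewrite psumr_eq0 => [/allP/(_ l)|i _]; last exact: sqr_ge0.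
by rewrite mem_index_enum sqrf_eq0 => /(_ isT) /eqP.
Qed.

Lemma xj_le x l : `|xj x l| <= 1.
Proof.
rewrite /xj normrM normfV (ger0_norm (xv_ge0 x)).
have [->|x0] := eqVneq (xv x) 0; first by rewrite invr0 mulr0.
rewrite ler_pdivrMr ?mul1r; last by rewrite lt_neqAle eq_sym x0 xv_ge0.
rewrite /xv -sqrtr_sqr ler_wsqrtr// (bigD1 l)//= lerDl sumr_ge0// => i _; exact: sqr_ge0.
Qed.

Lemma im_part_opp F u v : holo_family F -> im_part F u (- v) = clopp (im_part F u v).
Proof.
move=> hF; apply/ffunP => A; rewrite !ffunE; have [_ H] := hF A.
by have := H (Complex u v); rewrite /= => ->; case: (F A _).
Qed.

Lemma re_part_opp F u v : holo_family F -> re_part F u (- v) = re_part F u v.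
Proof.
move=> hF; apply/ffunP => A; rewrite !ffunE; have [_ H] := hF A.
by have := H (Complex u v); rewrite /= => ->; case: (F A _).
Qed.

(** [slice_fun] uses the representation of a point with v >= 0. For v < 0 the unit changes sign
    together with the odd component; for v = 0 the odd component vanishes and the unit is
    irrelevant. *)
Lemma slice_fun_decomp F : holo_family F -> slice_decomp (slice_fun F) (re_part F) (im_part F).
Proof.
move=> hF u v j jS.
have -> : slice_fun F (slicept u v j) = cladd (re_part F u `|v|)
    (clmul (jcl (xj (slicept u v j))) (im_part F u `|v|)).
  by rewrite /slice_fun /slice_value /slice_coord xv_slicept.
have [->|vn0] := eqVneq v 0.
  rewrite normr0; have -> : im_part F u 0 = clscale 0 (clzero R n).
    apply/ffunP => A; have := congr1 (fun a : Cl => a A) (im_part_opp u 0 hF).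
    rewrite oppr0 cloppEE clscaleE mul0r => /eqP.
    by rewrite -addr_eq0 -mulr2n mulrn_eq0/= => /eqP.
  by rewrite !clmul_scaler; congr cladd; apply/ffunP => A; rewrite !clscaleE !mul0r.
have [v0|v0] := leP 0 v.
  rewrite ger0_norm//; congr (cladd _ (clmul (jcl _) _)).
  apply/funext => l; rewrite /xj xv_slicept//= ger0_norm//.
  by rewrite mulrC mulKf.
rewrite ltr0_norm// re_part_opp// im_part_opp//; congr cladd.
have -> : xj (slicept u v j) = fun l => -1 * j l.
  apply/funext => l; rewrite /xj xv_slicept//= ltr0_norm// invrN mulrN mulrAC divff ?mul1r ?mulN1r//.
rewrite jcl_scale cloppE clmul_scalel clmul_scaler.
by apply/ffunP => A; rewrite !clscaleE mulrA mulrNN mulr1 mul1r.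
Qed.

Lemma slice_fun_components F : holo_family F ->
  slice_components (slice_fun F) (re_part F) (im_part F).
Proof.
move=> hF; split; first exact: slice_fun_decomp.
have reE A : (fun u v => re_part F u v A) = fun u v => complex.Re (F A (Complex u v)).
  by apply/funext => u; apply/funext => v; rewrite ffunE.
have imE A : (fun u v => im_part F u v A) = fun u v => complex.Im (F A (Complex u v)).
  by apply/funext => u; apply/funext => v; rewrite ffunE.
split; first by move=> A; rewrite reE; have [[F' d] _] := hF A; exact: cderiv_C1_Re d.
split; first by move=> A; rewrite imE; have [[F' d] _] := hF A; exact: cderiv_C1_Im d.
split; first by move=> u v; exact: re_part_opp.
split; first by move=> u v; exact: im_part_opp.
split=> A u v; rewrite reE imE; have [[F' d] _] := hF A.
  by rewrite (cderiv_u_Re _ _ d) (cderiv_v_Im _ _ d).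
by rewrite (cderiv_v_Re _ _ d) (cderiv_u_Im _ _ d).
Qed.

Lemma slice_fun_SM F : holo_family F -> SM_L (slice_fun F).
Proof. by move=> hF; exists (re_part F), (im_part F); exact: slice_fun_components. Qed.

(** Even and odd part in v of f on one slice. The odd part is e * f1, and multiplying it by -e
    isolates f1 since e^2 = -1. *)
Lemma decomp_halves f (f0 f1 : R -> R -> Cl) (i0 : 'I_n) u v : slice_components f f0 f1 ->
  f0 u v = clscale 2^-1 (cladd (f (slicept u v (e1 R i0))) (f (slicept u (- v) (e1 R i0)))) /\
  f1 u v = clscale (- 2^-1) (clmul (jcl (e1 R i0))
    (cladd (f (slicept u v (e1 R i0))) (clopp (f (slicept u (- v) (e1 R i0)))))).
Proof.
move=> [dec [_ [_ [ev [od _]]]]]; rewrite !dec; try exact: inS_e1.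
rewrite ev od.
set p := f0 u v; set q := f1 u v; set e := jcl _.
have e2 : clmul e (clopp q) = clopp (clmul e q) by rewrite !cloppE clmul_scaler.
rewrite e2; split.
  by apply/ffunP => A; rewrite !(claddE, clscaleE, cloppEE); lra.
have -> : cladd (cladd p (clmul e q)) (clopp (cladd p (clopp (clmul e q)))) = clscale 2 (clmul e q).
  by apply/ffunP => A; rewrite !(claddE, clscaleE, cloppEE); lra.
rewrite clmul_scaler clmul_e1K.
by apply/ffunP => A; rewrite !(claddE, clscaleE, cloppEE); lra.
Qed.

Hypothesis n_gt0 : (0 < n)%N.
Let i0 : 'I_n := Ordinal n_gt0.

Lemma components_unique f (f0 f1 g0 g1 : R -> R -> Cl) : slice_components f f0 f1 -> slice_components f g0 g1 ->
  f0 = g0 /\ f1 = g1.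
Proof.
move=> h k; split; apply/funext => u; apply/funext => v.
- by have [-> _] := decomp_halves i0 u v h; have [-> _] := decomp_halves i0 u v k.
- by have [_ ->] := decomp_halves i0 u v h; have [_ ->] := decomp_halves i0 u v k.
Qed.

(** Uniqueness forces the value chosen by [epsilon], so star products may be computed from any known
    decomposition. *)
Lemma comps_eq f (f0 f1 : R -> R -> Cl) : slice_components f f0 f1 -> comps f = (f0, f1).
Proof.
move=> h; have ex : exists p : (R -> R -> Cl) * (R -> R -> Cl), slice_components f p.1 p.2.
  by exists (f0, f1).
have := ClassicalEpsilon.epsilon_spec
  (inhabits ((fun _ _ => clzero R n), (fun _ _ => clzero R n))) _ ex.
rewrite -/(comps f) => k; have [e0' e1'] := components_unique h k.
by rewrite e0' e1' -surjective_pairing.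
Qed.

Lemma comps_slice_fun F : holo_family F -> comps (slice_fun F) = (re_part F, im_part F).
Proof. by move=> hF; apply: comps_eq; exact: slice_fun_components. Qed.

Lemma slice_decomp_eq f g (f0 f1 : R -> R -> Cl) : slice_decomp f f0 f1 -> slice_decomp g f0 f1 -> f = g.
Proof.
move=> df dg; apply/funext => x.
have [x0|x0] := eqVneq (xv x) 0.
  by rewrite -(slicept_real (e1 R i0) x0) df ?dg//; exact: inS_e1.
by rewrite -(slicept_xj x0) df ?dg//; exact: inS_xj.
Qed.

Lemma SM_family f : SM_L f -> exists2 F, holo_family F & f = slice_fun F.
Proof.
move=> [f0 [f1 h]]; have [dec [c0 [c1 [ev [od [cr1 cr2]]]]]] := h.
pose F (A : blade) (z : R[i]) : R[i] :=
  Complex (f0 (complex.Re z) (complex.Im z) A) (f1 (complex.Re z) (complex.Im z) A).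
have hF : holo_family F.
  move=> A; split.
    by eexists; exact: (C1_cderiv (c0 A) (c1 A) (cr1 A) (cr2 A)).
  by case=> u v; rewrite /F /= ev od; congr Complex; rewrite ffunE.
exists F => //; apply: (slice_decomp_eq dec).
have -> : f0 = re_part F by apply/funext => u; apply/funext => v; apply/ffunP => A; rewrite ffunE.
have -> : f1 = im_part F by apply/funext => u; apply/funext => v; apply/ffunP => A; rewrite ffunE.
exact: slice_fun_decomp.
Qed.

Lemma slice_value_le (w : blade -> R[i]) x (B : R) : (forall A, normc (w A) <= B) ->
  clnorm (slice_value w x) <= blades R n * (B + blades R n * B).
Proof.
move=> wB; apply: clnorm_le => A; rewrite claddE.
apply: le_trans (ler_normD _ _) _; apply: lerD.
  by rewrite ffunE; exact: le_trans (Re_le_normc _) (wB A).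
rewrite -[B in leRHS]mul1r; apply: clmul_le => C.
  by apply: jcl_le => // l; exact: xj_le.
by rewrite ffunE; exact: le_trans (Im_le_normc _) (wB C).
Qed.

Lemma slice_fun_le F x (B : R) : (forall A, normc (F A (slice_coord x)) <= B) ->
  clnorm (slice_fun F x) <= blades R n * (1 + blades R n) * B.
Proof. by move=> H; apply: le_trans (slice_value_le x H) _; rewrite -mulrA mulrDl mul1r. Qed.

(** Both values entering [decomp_halves] lie on the sphere of radius |z|. The even part costs the
    constant 1, the odd part the factor [blades] of a Clifford multiplication. *)
Lemma family_le F z (B : R) : holo_family F ->
  (forall x, pnorm x = normc z -> clnorm (slice_fun F x) <= B) ->
  forall A, normc (F A z) <= (1 + blades R n) * B.
Proof.
move=> hF fB A; case: z fB => u v fB.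
have [h0 h1] := decomp_halves i0 u v (slice_fun_components hF).
have b1 : clnorm (slice_fun F (slicept u v (e1 R i0))) <= B.
  by apply: fB; rewrite pnorm_slicept//; exact: inS_e1.
have b2 : clnorm (slice_fun F (slicept u (- v) (e1 R i0))) <= B.
  apply: fB; rewrite pnorm_slicept; last exact: inS_e1.
  by rewrite !normcE'/= sqrrN.
have c1 C := le_trans (cl_le_norm _ C) b1.
have c2 C := le_trans (cl_le_norm _ C) b2.
apply: le_trans (normc_le_ReIm _) _; rewrite mulrDl mul1r; apply: lerD.
  have -> : complex.Re (F A (Complex u v)) = re_part F u v A by rewrite ffunE.
  rewrite h0 clscaleE claddE; have := c1 A; have := c2 A; rewrite !ler_norml.
  by move=> /andP[? ?] /andP[? ?]; apply/andP; split; lra.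
have -> : complex.Im (F A (Complex u v)) = im_part F u v A by rewrite ffunE.
rewrite h1 clscaleE normrM normrN [`|2^-1|]ger0_norm ?invr_ge0//.
have : `|clmul (jcl (e1 R i0)) (cladd (slice_fun F (slicept u v (e1 R i0)))
      (clopp (slice_fun F (slicept u (- v) (e1 R i0))))) A| <= blades R n * (1 * (2 * B)).
  apply: clmul_le => C.
    by rewrite jcl_e1; case: eqP; rewrite ?normr1 ?normr0.
  rewrite claddE cloppEE; have := c1 C; have := c2 C; rewrite !ler_norml.
  by move=> /andP[? ?] /andP[? ?]; apply/andP; split; lra.
by rewrite mul1r; set X := `|_|; set Y := blades R n; lra.
Qed.

End SliceFamilies.

(** * Star product and derivative in x_0 on families *)

Section StarAndDerivative.
Variables (R : realType) (n : nat).
Local Notation Cl := (Cl R n).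
Local Notation blade := {set 'I_n}.
Local Notation para := (para R n).
Implicit Types (F G : blade -> R[i] -> R[i]) (f g : para -> Cl) (x : para).

Lemma slice_valueE (w : blade -> R[i]) x C : slice_value w x C =
  complex.Re (w C) + \sum_A clsign R A (symdiff A C) * jcl (xj x) A * complex.Im (w (symdiff A C)).
Proof.
rewrite claddE ffunE clmulE; congr (_ + _); apply: eq_bigr => A _.
by rewrite [[ffun A0 => complex.Im (w A0)] _]ffunE.
Qed.

Lemma slice_value_sum (N : nat) (w : nat -> blade -> R[i]) x :
  slice_value (fun A => \sum_(l < N) w l A) x = clsum N (fun l => slice_value (w l) x).
Proof.
apply/ffunP => C; rewrite [RHS]ffunE slice_valueE Re_sum.
under [RHS]eq_bigr do rewrite slice_valueE.
rewrite big_split/= exchange_big/=; congr (_ + _); apply: eq_bigr => A _.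
by rewrite Im_sum mulr_sumr.
Qed.

Lemma slice_fun_sum (N : nat) (F : nat -> blade -> R[i] -> R[i]) x :
  slice_fun (fun A z => \sum_(l < N) F l A z) x = clsum N (fun l => slice_fun (F l) x).
Proof. exact: slice_value_sum. Qed.

Lemma slice_funB F G : fsub (slice_fun F) (slice_fun G) = slice_fun (fun A z => F A z - G A z).
Proof.
apply/funext => x; apply/ffunP => C; rewrite /fsub claddE cloppEE /slice_fun !slice_valueE cReD cReN.
under [in RHS]eq_bigr do rewrite cImD cImN mulrBr.
by rewrite sumrB addrACA opprD.
Qed.

(** The imaginary unit multiplies from the left and [a] from the right, so by associativity right
    multiplication is a real linear substitution within the family, independent of the slice. *)
Lemma slice_value_clmul (w : blade -> R[i]) x (a : Cl) :
  slice_value (fun C => \sum_A (clsign R A (symdiff A C) * a (symdiff A C))%:C%C * w A) x =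
  clmul (slice_value w x) a.
Proof.
rewrite /slice_value clmulDl; congr cladd.
  apply/ffunP => C; rewrite ffunE clmulE Re_sum; apply: eq_bigr => A _.
  by rewrite cReM/= mul0r subr0 [[ffun A0 => complex.Re (w A0)] _]ffunE; ring.
rewrite -clmulA; congr clmul.
apply/ffunP => C; rewrite ffunE clmulE Im_sum; apply: eq_bigr => A _.
by rewrite cImM/= mul0r addr0 [[ffun A0 => complex.Im (w A0)] _]ffunE; ring.
Qed.

Lemma is_derive_sumR (I : Type) (r : seq I) (h : I -> R -> R) (dh : I -> R) (t : R) :
  (forall i, is_derive t (1 : R) (h i) (dh i)) ->
  is_derive t (1 : R) (fun s => \sum_(i <- r) h i s) (\sum_(i <- r) dh i).
Proof.
move=> H; elim: r => [|i r IH].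
  rewrite big_nil; under eq_fun do rewrite big_nil.
  exact: is_derive_cst.
rewrite big_cons; under eq_fun do rewrite big_cons.
exact: is_deriveDR (H i) IH erefl.
Qed.

Lemma cderiv_sum (I : Type) (r : seq I) (h dh : I -> R[i] -> R[i]) :
  (forall i, cderiv (h i) (dh i)) ->
  cderiv (fun z => \sum_(i <- r) h i z) (fun z => \sum_(i <- r) dh i z).
Proof.
move=> H; elim: r => [|i r IH].
  under eq_fun do rewrite big_nil.
  under [X in cderiv _ X]eq_fun do rewrite big_nil.
  exact: cderiv_cst.
under eq_fun do rewrite big_cons.
under [X in cderiv _ X]eq_fun do rewrite big_cons.
exact: cderivD.
Qed.

(** Varying x_0 alone fixes both v and the unit j, so the derivative acts on the family as the
    partial derivative in u, which is the complex derivative. *)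
Lemma dx0_slice_fun F dF : (forall A, cderiv (F A) (dF A)) ->
  dx0 (slice_fun F) = slice_fun dF.
Proof.
move=> d; apply/funext => x; apply/ffunP => C; rewrite ffunE.
have -> : (fun t => slice_fun F (t, x.2) C) = fun t =>
    complex.Re (F C (Complex t (xv x))) +
    \sum_A clsign R A (symdiff A C) * jcl (xj x) A * complex.Im (F (symdiff A C) (Complex t (xv x))).
  by apply/funext => t; rewrite /slice_fun slice_valueE.
apply: is_derive_derive1; rewrite /slice_fun slice_valueE.
apply: is_deriveDR; last by [].
  by have [d1 _ _ _ _] := d C; exact: d1.
apply: is_derive_sumR => A; have [_ d2 _ _ _] := d (symdiff A C).
apply: (is_deriveMR (is_derive_cst (clsign R A (symdiff A C) * jcl (xj x) A) _ _) (d2 _ _)).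
by rewrite mul0r add0r.
Qed.

Lemma holo_ps (a : blade -> nat -> R) : (forall A, entire_seq (a A)) -> holo_family (fun A => ps (a A)).
Proof. by move=> ea A; split; [eexists; exact: ps_cderiv|move=> z; exact: ps_conj]. Qed.

Definition dseqn (l : nat) (a : blade -> nat -> R) : blade -> nat -> R := fun A => iter l (@dseq R) (a A).

Lemma entire_dseqn l (a : blade -> nat -> R) : (forall A, entire_seq (a A)) ->
  forall A, entire_seq (dseqn l a A).
Proof. by move=> ea A; rewrite /dseqn; elim: l => [|l IH] //=; exact: entire_dseq. Qed.

Lemma dx0n_ps l (a : blade -> nat -> R) : (forall A, entire_seq (a A)) ->
  dx0n l (slice_fun (fun A => ps (a A))) = slice_fun (fun A => ps (dseqn l a A)).
Proof.
move=> ea; rewrite /dx0n; elim: l => [|l IH] //=.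
rewrite IH; apply: dx0_slice_fun => A; apply: ps_cderiv; exact: entire_dseqn.
Qed.

Definition star_family F G : blade -> R[i] -> R[i] := fun C z =>
  \sum_A (clsign R A (symdiff A C))%:C%C * (F A z * G (symdiff A C) z).

Lemma holo_star F G : holo_family F -> holo_family G -> holo_family (star_family F G).
Proof.
move=> hF hG C; split.
  pose dF A := sval (cid (hF A).1); pose dG A := sval (cid (hG A).1).
  have HF A : cderiv (F A) (dF A) by exact: svalP (cid (hF A).1).
  have HG A : cderiv (G A) (dG A) by exact: svalP (cid (hG A).1).
  eexists; apply: cderiv_sum => A; apply: cderivM; first exact: cderiv_cst.
  by apply: cderivM; [exact: HF|exact: HG].
move=> z; rewrite /star_family rmorph_sum; apply: eq_bigr => A _.
by rewrite (hF A).2 (hG _).2 !rmorphM/= oppr0.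
Qed.

(** Blade by blade, f0 g0 - f1 g1 and f1 g0 + f0 g1 are the real and imaginary parts of the products
    of the complex functions. *)
Lemma starL_slice_fun (n_gt0 : (0 < n)%N) F G : holo_family F -> holo_family G ->
  starL (slice_fun F) (slice_fun G) = slice_fun (star_family F G).
Proof.
move=> hF hG; apply/funext => x; rewrite /starL (comps_slice_fun n_gt0 hF) (comps_slice_fun n_gt0 hG)/=.
rewrite /slice_fun /slice_value -/(re_part (star_family F G) x.1 (xv x)) -/(im_part (star_family F G) x.1 (xv x)).
congr cladd.
  apply/ffunP => C; rewrite claddE cloppEE !clmulE ffunE Re_sum -sumrB; apply: eq_bigr => A _.
  by rewrite !ffunE cReM/= mul0r subr0 cReM; ring.
congr clmul; apply/ffunP => C; rewrite claddE !clmulE ffunE Im_sum -big_split; apply: eq_bigr => A _.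
by rewrite !ffunE cImM/= mul0r addr0 cImM; ring.
Qed.

Lemma star_family_le F G z (s t : R) : (forall A, normc (F A z) <= s) -> (forall A, normc (G A z) <= t) ->
  forall C, normc (star_family F G C z) <= blades R n * (s * t).
Proof.
move=> Fs Gt C; apply: le_trans (normc_sum _ _ _) _; apply: sum_blades_le => A.
rewrite normcM normc_real clsign_norm mul1r normcM.
by apply: ler_pM; rewrite ?normc_ge0.
Qed.

End StarAndDerivative.

(** * Weighted norms as real inequalities *)

Section Weights.
Variables (R : realType) (n : nat).
Local Notation Cl := (Cl R n).
Local Notation blade := {set 'I_n}.
Local Notation para := (para R n).
Implicit Types (f g : para -> Cl) (x : para) (rho : R -> R).

Lemma fsubE f g x A : fsub f g x A = f x A - g x A.
Proof. by rewrite /fsub claddE cloppEE. Qed.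

Definition wbound rho (e B : R) f := forall x, clnorm (f x) <= B * expR (e * pw rho (pnorm x)).

Lemma wnorm_leP rho e B f : (wnorm rho e f <= B%:E)%E <-> wbound rho e B f.
Proof.
have E x (y : R) : (y * weight rho e x <= B) = (y <= B * expR (e * pw rho (pnorm x))).
  by rewrite /weight mulNr expRN ler_pdivrMr ?expR_gt0.
split => [H x|H].
  rewrite -E -lee_fin; apply: le_trans H; apply: ereal_sup_ubound; exists x => //.
apply: ge_ereal_sup => _ [x _ <-]; by rewrite lee_fin E.
Qed.

Lemma wnorm_ge0 rho e f : (0 <= wnorm rho e f)%E.
Proof.
apply: le_trans (_ : (clnorm (f (0, fun=> 0)) * weight rho e (0, fun=> 0))%:E <= _)%E.
  by rewrite lee_fin mulr_ge0 ?clnorm_ge0// /weight expR_ge0.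
by apply: ereal_sup_ubound; exists (0, fun=> 0).
Qed.

Lemma wnorm_fin rho e f : (wnorm rho e f < +oo)%E -> exists2 B : R, 0 <= B & wbound rho e B f.
Proof.
move=> H; have fn : wnorm rho e f \is a fin_num by rewrite ge0_fin_numE// wnorm_ge0.
exists (fine (wnorm rho e f)); first exact/fine_ge0/wnorm_ge0.
by apply/wnorm_leP; rewrite fineK.
Qed.

Lemma inA0P rho f : inA0 rho f <->
  SM_L f /\ forall e : R, 0 < e -> exists2 B : R, 0 <= B & wbound rho e B f.
Proof.
split => [H|[s H] e e0].
  split; first by have [] := H 1 ltr01.
  by move=> e e0; have [_ /wnorm_fin] := H e e0.
split => //; have [B _ HB] := H e e0.
by apply: le_lt_trans (ltry B); apply/wnorm_leP.
Qed.

Lemma cvgA0_geom rho (S : nat -> para -> Cl) g :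
  (forall e : R, 0 < e -> exists E : R, forall N, wbound rho e (E * 2^-1 ^+ N) (fsub (S N) g)) ->
  cvgA0 rho S g.
Proof.
move=> H e e0; have [E HE] := H e e0.
apply: (@squeeze_cvge _ _ _ _ (fun=> 0%E) _ (fun N => (E * 2^-1 ^+ N)%:E)).
- by apply: nearW => N; rewrite wnorm_ge0/=; apply/wnorm_leP.
- exact: cvg_cst.
- by apply/cvg_EFin; [exact: nearW|exact: half_expr_cvg0].
Qed.

Lemma wbound_fsub rho e B B' f g : wbound rho e B f -> wbound rho e B' g ->
  wbound rho e (blades R n * (B + B')) (fsub f g).
Proof.
move=> Hf Hg x; rewrite -mulrA; apply: clnorm_le => A.
rewrite /fsub claddE cloppEE; apply: le_trans (ler_normB _ _) _; rewrite mulrDl.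
by apply: lerD; [exact: le_trans (cl_le_norm _ A) (Hf x)|exact: le_trans (cl_le_norm _ A) (Hg x)].
Qed.

Lemma wbound_le rho e B B' f : B <= B' -> wbound rho e B f -> wbound rho e B' f.
Proof. by move=> BB H x; apply: le_trans (H x) _; rewrite ler_wpM2r ?expR_ge0. Qed.

End Weights.

(** * Linear combinations, truncations and derivatives of power series *)

Section PowerSeriesAlgebra.
Variable R : realType.
Implicit Types (a b : nat -> R) (z : R[i]).

Lemma cReZ (c : R) z : complex.Re (c%:C%C * z) = c * complex.Re z.
Proof. by rewrite cReM/= mul0r subr0. Qed.
Lemma cImZ (c : R) z : complex.Im (c%:C%C * z) = c * complex.Im z.
Proof. by rewrite cImM/= mul0r addr0. Qed.

Lemma ps0 a : entire_seq a -> ps a 0 = (a 0%N)%:C%C.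
Proof.
move=> /entire_seqP/(_ 0) [B B0 HB].
apply: (@ps_unique_limit R a 0 _ B (`|a 0%N|)) => [k|N].
  by apply: HB; rewrite normc0 mulr0.
case: N => [|N]; first by rewrite /psN big_ord0 sub0r normcN normc_real expr0 mulr1.
rewrite /psN big_ord_recl expr0 mulr1 big1 ?addr0 ?subrr ?normc0 ?mulr_ge0 ?exprn_ge0 ?invr_ge0//.
by move=> i _; rewrite expr0n mulr0.
Qed.

Lemma entire_lin a b (c : R) : entire_seq a -> entire_seq b -> entire_seq (fun k => a k + c * b k).
Proof.
move=> ea eb r r0; have [A HA] := ea r r0; have [B HB] := eb r r0.
exists (A + `|c| * B) => k; apply: (@le_trans _ _ ((`|a k| + `|c| * `|b k|) * r ^+ k)).
  rewrite ler_wpM2r ?exprn_ge0 ?(ltW r0)//; apply: le_trans (ler_normD _ _) _.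
  by rewrite normrM.
by rewrite mulrDl; apply: lerD => //; rewrite -mulrA ler_wpM2l.
Qed.

Lemma ps_lin a b (c : R) z : entire_seq a -> entire_seq b ->
  ps (fun k => a k + c * b k) z = ps a z + c%:C%C * ps b z.
Proof.
move=> ea eb; have [A A0 HA] := entire_seqP ea (2 * normc z).
have [B B0 HB] := entire_seqP eb (2 * normc z).
have [D D0 HD] := entire_seqP (entire_lin c ea eb) (2 * normc z).
have z0 : 0 <= 2 * normc z by rewrite mulr_ge0 ?normc_ge0.
apply: (@ps_unique_limit _ _ _ _ D (4 * A + `|c| * (4 * B))) => [k|N]; first by apply: HD.
have -> : psN (fun k => a k + c * b k) N z = psN a N z + c%:C%C * psN b N z.
  rewrite /psN mulr_sumr -big_split/=; apply: eq_bigr => k _.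
  by rewrite rmorphD rmorphM/=; ring.
have -> : psN a N z + c%:C%C * psN b N z - (ps a z + c%:C%C * ps b z) =
  (psN a N z - ps a z) + c%:C%C * (psN b N z - ps b z) by ring.
apply: le_trans (le_normcD _ _) _; rewrite mulrDl; apply: lerD.
  by rewrite normcB; apply: ps_approx => k; exact: HA.
rewrite normcM normc_real -mulrA ler_wpM2l// normcB; apply: ps_approx => k; exact: HB.
Qed.

Lemma ps_finite a N z : (forall k, (N <= k)%N -> a k = 0) -> ps a z = psN a N z.
Proof.
move=> a0.
have [B HB] : exists B : R, forall k, `|a k| * (2 * normc z) ^+ k <= B.
  exists (\sum_(k < N) `|a k| * (2 * normc z) ^+ k) => k.
  have p i : 0 <= `|a i| * (2 * normc z) ^+ i by rewrite mulr_ge0 ?exprn_ge0 ?mulr_ge0 ?normc_ge0.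
  have [kN|Nk] := ltnP k N; last by rewrite a0// normr0 mul0r sumr_ge0.
  by rewrite (bigD1 (Ordinal kN))//= lerDl sumr_ge0.
have E M : (N <= M)%N -> psN a M z = psN a N z.
  move=> NM; rewrite /psN -(subnKC NM) big_split_ord/= [X in _ + X]big1 ?addr0// => i _.
  by rewrite a0 ?leq_addr// mul0r.
apply/eqP; rewrite -subr_eq0 -normc_eq0 eq_le normc_ge0 andbT.
apply: (@le_half_limit _ _ _ (4 * B)) => M; rewrite add0r.
rewrite -(E (maxn N M)) ?leq_maxl//; apply: le_trans (ps_approx HB _) _.
rewrite ler_wpM2l//.
  by rewrite mulr_ge0//; apply: le_trans (HB 0%N); rewrite expr0 mulr1.
by apply: ler_wiXn2l; rewrite ?invr_ge0 ?invf_le1 ?ler1n// leq_maxr.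
Qed.

Lemma entire_finite a N : (forall k, (N <= k)%N -> a k = 0) -> entire_seq a.
Proof.
move=> a0 r r0; exists (\sum_(k < N) `|a k| * r ^+ k) => k.
have p i : 0 <= `|a i| * r ^+ i by rewrite mulr_ge0 ?exprn_ge0 ?(ltW r0).
have [kN|Nk] := ltnP k N; last by rewrite a0// normr0 mul0r sumr_ge0.
by rewrite (bigD1 (Ordinal kN))//= lerDl sumr_ge0.
Qed.

Lemma entire_sum N (b : nat -> nat -> R) : (forall l, entire_seq (b l)) ->
  entire_seq (fun k => \sum_(l < N) b l k).
Proof.
move=> eb; elim: N => [|N IH].
  by apply: (@entire_finite _ 0) => k _; rewrite big_ord0.
have -> : (fun k => \sum_(l < N.+1) b l k) = fun k => \sum_(l < N) b l k + 1 * b N k.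
  by apply/funext => k; rewrite big_ord_recr mul1r.
exact: entire_lin.
Qed.

Lemma ps_sum N (b : nat -> nat -> R) z : (forall l, entire_seq (b l)) ->
  ps (fun k => \sum_(l < N) b l k) z = \sum_(l < N) ps (b l) z.
Proof.
move=> eb; elim: N => [|N IH].
  rewrite big_ord0 (@ps_finite _ 0) ?/psN ?big_ord0// => k _; by rewrite big_ord0.
rewrite big_ord_recr/= -IH -[X in _ + X]mul1r -[1]/((1 : R)%:C%C) -ps_lin//; last exact: entire_sum.
by congr (ps _ z); apply/funext => k; rewrite big_ord_recr/= mul1r.
Qed.

Lemma iter_dseqE l a k : iter l (@dseq R) a k = ((k + l) ^_ l)%:R * a (k + l)%N.
Proof.
elim: l a k => [|l IH] a k; first by rewrite addn0 mul1r.
rewrite iterS {1}/dseq IH addSnnS mulrA -natrM; congr (_%:R * _).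
by rewrite ffactnSr addnS subSn ?leq_addl// addnK mulnC.
Qed.

(* Cauchy's estimate on a disc of radius [s] around [z], read off the coefficients:
   [(k + l) ^_ l * |z| ^ k * s ^ l <= l! * (|z| + s) ^ (k + l)]. *)
Lemma ps_deriv_le l a z (s X : R) : 0 < s ->
  (forall k, `|a k| * (2 * normc z + s) ^+ k <= X) ->
  normc (ps (iter l (@dseq R) a) z) <= 4 * (l`!%:R / s ^+ l * X).
Proof.
move=> s0 aX; apply: ps_le => k; rewrite iter_dseqE normrM normr_nat.
set y := 2 * normc z; have y0 : 0 <= y by rewrite mulr_ge0 ?normc_ge0.
apply: (@le_trans _ _ (l`!%:R / s ^+ l * (`|a (k + l)%N| * (y + s) ^+ (k + l)))); last first.
  by rewrite ler_wpM2l ?divr_ge0 ?exprn_ge0 ?(ltW s0).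
rewrite -bin_ffact mulnC natrM.
rewrite [leLHS](_ : _ = l`!%:R * `|a (k + l)%N| * ('C(k + l, l)%:R * y ^+ k)); last by ring.
rewrite [leRHS](_ : _ = l`!%:R * `|a (k + l)%N| * ((y + s) ^+ (k + l) / s ^+ l)); last by ring.
rewrite ler_wpM2l ?mulr_ge0// ler_pdivlMr ?exprn_gt0//.
have lk : (l < (k + l).+1)%N by rewrite ltnS leq_addl.
rewrite exprDn (bigD1 (Ordinal lk))//= addnK mulr_natl -mulrnAl lerDl sumr_ge0// => i _.
by rewrite mulrn_wge0// mulr_ge0// exprn_ge0// ltW.
Qed.

Lemma ps_single (c : R) k z : ps (fun j => c * (j == k)%:R) z = c%:C%C * z ^+ k.
Proof.
rewrite (@ps_finite _ k.+1) => [|j kj]; last first.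
  by case: eqP kj => [->|_ _]; rewrite ?ltnn// mulr0.
rewrite /psN big_ord_recr/= big1 ?add0r ?eqxx ?mulr1// => i _.
by rewrite (ltn_eqF (ltn_ord i)) mulr0 mul0r.
Qed.

Lemma entire_single (c : R) k : entire_seq (fun j => c * (j == k)%:R).
Proof.
by apply: (@entire_finite _ k.+1) => j; case: eqP => [->|_ _]; rewrite ?ltnn// mulr0.
Qed.

End PowerSeriesAlgebra.

(** * Growth of slice functions against growth of their coefficients *)

Section Coefficients.
Variables (R : realType) (n : nat).
Local Notation Cl := (Cl R n).
Local Notation blade := {set 'I_n}.
Local Notation para := (para R n).
Implicit Types (f g : para -> Cl) (x : para) (rho : R -> R) (a b : blade -> nat -> R).

Definition entire_family a := forall A, entire_seq (a A).
Definition slice_series a : para -> Cl := slice_fun (fun A => ps (a A)).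

Lemma slice_series_SM a : entire_family a -> SM_L (slice_series a).
Proof. by move=> ea; apply: slice_fun_SM; exact: holo_ps. Qed.

Lemma slice_series_lin a b (c : R) x : entire_family a -> entire_family b ->
  slice_series (fun A k => a A k + c * b A k) x = cladd (slice_series a x) (clscale c (slice_series b x)).
Proof.
move=> ea eb; apply/ffunP => C; rewrite [RHS]claddE clscaleE /slice_series /slice_fun !slice_valueE.
rewrite ps_lin// cReD cReZ -!addrA; congr (_ + _).
rewrite mulrDr [RHS]addrCA; congr (_ + _); rewrite mulr_sumr -big_split; apply: eq_bigr => A _.
rewrite ps_lin// cImD cImZ.
by move: (complex.Im (ps (a _) _)) (complex.Im (ps (b _) _)) => p q /=; ring.
Qed.

Lemma slice_series_fsub a b : entire_family a -> entire_family b ->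
  fsub (slice_series a) (slice_series b) = slice_series (fun A k => a A k + (-1) * b A k).
Proof. by move=> ea eb; apply/funext => x; rewrite slice_series_lin// /fsub cloppE. Qed.

Lemma slice_series_sum N (b : nat -> blade -> nat -> R) x : (forall l, entire_family (b l)) ->
  clsum N (fun l => slice_series (b l) x) = slice_series (fun A k => \sum_(l < N) b l A k) x.
Proof.
move=> eb; rewrite -slice_value_sum /slice_series /slice_fun; congr slice_value; apply/funext => A.
by rewrite (@ps_sum _ N (fun l => b l A))// => l; exact: eb.
Qed.

(** The factor 2 comes from Cauchy's bound with split real and imaginary parts, the other factor
    from recovering the family from f. *)
Definition coef_cst : R := 2 * (1 + blades R n).

Lemma coef_cst_ge0 : 0 <= coef_cst.
Proof. by rewrite mulr_ge0// addr_ge0// blades_ge0. Qed.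

Lemma SM_coef (n_gt0 : (0 < n)%N) f : SM_L f -> exists2 a, entire_family a &
  f = slice_series a /\ forall (r B : R) k A, 0 <= r -> (forall x, pnorm x = r -> clnorm (f x) <= B) ->
     `|a A k| * r ^+ k <= coef_cst * B.
Proof.
move=> /(SM_family n_gt0) [F hF ->].
have /choice [a Ha] : forall A, exists a : nat -> R, [/\ entire_seq a, (forall z, F A z = ps a z) &
    forall r (B : R) k, 0 < r -> (forall z, normc z = r -> normc (F A z) <= B) ->
      `|a k| * r ^+ k <= 2 * B].
  by move=> A; have [[F' d] J] := hF A; exact: taylor_real d J.
have ea : entire_family a by move=> A; have [] := Ha A.
have FE A z : F A z = ps (a A) z by have [_ -> _] := Ha A.
exists a => //; split.
  by congr slice_fun; apply/funext => A; apply/funext => z.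
(* Cauchy's bound requires a positive radius. At radius 0 only k = 0 carries information, and that
   coefficient is the value at the origin. *)
move=> r B k A; rewrite le_eqVlt => /orP[/eqP <-|r0] HB; last first.
  have [_ _ H] := Ha A; rewrite /coef_cst -mulrA; apply: H => // z zr.
  by apply: (family_le n_gt0 hF) => x; rewrite zr; exact: HB.
have H0 : `|a A 0%N| <= (1 + blades R n) * B.
  rewrite -normc_real -ps0// -FE; apply: (family_le n_gt0 hF) => x; rewrite normc0; exact: HB.
have B0 : 0 <= (1 + blades R n) * B := le_trans (normr_ge0 _) H0.
rewrite /coef_cst -mulrA; case: k => [|k]; last by rewrite expr0n mulr0 mulr_ge0.
by rewrite expr0 mulr1; apply: le_trans H0 _; rewrite ler_peMl// ler1n.
Qed.

Definition cbound rho (e B : R) a :=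
  forall A k (r : R), 0 <= r -> `|a A k| * r ^+ k <= B * expR (e * pw rho r).

(** One coefficient family obeys the bounds for all orders and types simultaneously, which allows
    passing between seminorms. *)
Lemma SM_cbound (n_gt0 : (0 < n)%N) f : SM_L f -> exists2 a, entire_family a &
  f = slice_series a /\ forall rho e B, wbound rho e B f -> cbound rho e (coef_cst * B) a.
Proof.
move=> /(SM_coef n_gt0) [a ea [-> H]]; exists a => //; split => // rho e B fB A k r r0.
by rewrite -mulrA; apply: (H r _ k A r0) => x xr; rewrite -xr; exact: fB.
Qed.

(** Summing at x uses the coefficient bound at radius [2 * pnorm x]. The type [e'] satisfies
    [e' * K0 <= e] for the doubling constant [K0], and the additive constant moves into [K], which
    depends on neither the series nor [C]. *)
Lemma slice_series_wbound rho rinf (e : R) : prox_order rho rinf -> 0 < e -> exists e' K : R,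
  [/\ 0 < e', 0 <= K & forall a C, entire_family a -> cbound rho e' C a -> wbound rho e (K * C) (slice_series a)].
Proof.
move=> hp e0; have [|K0 K00 HK] := @pw_scale R rho rinf hp 2; first by rewrite ler1n.
have K1 : 0 < K0 + 1 by rewrite ltr_wpDl.
have [e' e'0 e'K] : exists2 e' : R, 0 < e' & e' * K0 <= e.
  exists (e / (K0 + 1)); first by rewrite divr_gt0.
  by rewrite mulrAC ler_pdivrMr// ler_wpM2l ?(ltW e0)// lerDl.
exists e', (blades R n * (1 + blades R n) * (4 * expR (e' * K0))); split => //.
  by rewrite !mulr_ge0 ?addr_ge0 ?blades_ge0 ?expR_ge0.
move=> a C ea aC x; rewrite -mulrA -mulrA.
apply: slice_fun_le => A.
apply: le_trans (ps_le (B := C * expR (e' * pw rho (2 * pnorm x))) _) _.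
  by move=> k; rewrite normc_slice_coord; apply: aC; rewrite mulr_ge0// pnorm_ge0.
have C0 : 0 <= C.
  have := aC A 0%N 0 (lexx 0); rewrite expr0 mulr1 => /(le_trans (normr_ge0 _)).
  by rewrite pmulr_lge0// expR_gt0.
rewrite -!mulrA ler_wpM2l// [leRHS]mulrCA ler_wpM2l// -expRD ler_expR.
apply: (@le_trans _ _ (e' * (K0 * (pw rho (pnorm x) + 1)))).
  by rewrite ler_wpM2l ?(ltW e'0)// HK// pnorm_ge0.
by rewrite mulrDr mulr1 mulrDr addrC lerD2l mulrA ler_wpM2r ?pw_ge0.
Qed.

(** Completeness in usable form: the sum is built coefficientwise. The decay for one type [e0] shows
    that it is entire, and the error after N terms is then controlled for every type in which the
    terms decay. *)
Lemma series_complete (n_gt0 : (0 < n)%N) rho (t : nat -> para -> Cl) :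
  (forall l, SM_L (t l)) ->
  (exists e C : R, forall l, wbound rho e (C * 2^-1 ^+ l) (t l)) ->
  exists2 a, entire_family a & forall N, exists2 d, entire_family d &
    fsub (fun x => clsum N (fun l => t l x)) (slice_series a) = slice_series d /\
    forall e C, (forall l, wbound rho e (C * 2^-1 ^+ l) (t l)) ->
      cbound rho e (2 * (coef_cst * C) * 2^-1 ^+ N) d.
Proof.
move=> tSM [e0 [C0 H0]].
have /choice [b Hb] : forall l, exists b, [/\ entire_family b, t l = slice_series b &
    forall e B, wbound rho e B (t l) -> cbound rho e (coef_cst * B) b].
  by move=> l; have [b eb [tb H]] := SM_cbound n_gt0 (tSM l); exists b; split => // e B /H.
have eb l : entire_family (b l) by have [] := Hb l.
pose a A k := limn (fun N => \sum_(l < N) b l A k).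
have bnd e C : (forall l, wbound rho e (C * 2^-1 ^+ l) (t l)) ->
    forall A k r, 0 <= r -> forall N,
    `|a A k - \sum_(l < N) b l A k| * r ^+ k <= 2 * (coef_cst * C) * 2^-1 ^+ N * expR (e * pw rho r).
  move=> HC A k r r0 N.
  have h l : `|b l A k * r ^+ k| <= coef_cst * C * expR (e * pw rho r) * 2^-1 ^+ l.
    have [_ _ /(_ _ _ (HC l))/(_ A k r r0)] := Hb l.
    by rewrite normrM (ger0_norm (exprn_ge0 _ r0)) => /le_trans; apply; rewrite le_eqVlt; apply/orP; left; apply/eqP; ring.
  have [cv tl] := sum_half_tail h.
  (* The limit is obtained after scaling by [r ^+ k]. When this vanishes the left-hand side is 0,
     and the tail bound shows that the right-hand side is nonnegative. *)
  have [rk0|rk0] := eqVneq (r ^+ k) 0.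
    rewrite rk0 mulr0; have := tl N; have := normr_ge0 (limn (fun N0 => \sum_(k0 < N0) b k0 A k * r ^+ k) - \sum_(k0 < N) b k0 A k * r ^+ k).
    move=> p q; apply: le_trans (le_trans p q) _; rewrite le_eqVlt; apply/orP; left; apply/eqP; ring.
  have e1 : (fun M => \sum_(l < M) b l A k) = fun M => (\sum_(l < M) b l A k * r ^+ k) / r ^+ k.
    by apply/funext => M; rewrite -mulr_suml mulfK.
  have aE : a A k = limn (fun M => \sum_(l < M) b l A k * r ^+ k) / r ^+ k.
    by rewrite /a e1; apply: cvg_lim => //; apply: cvgM => //; exact: cvg_cst.
  rewrite -[r ^+ k in leLHS]ger0_norm ?exprn_ge0// -normrM mulrBl aE divfK// mulr_suml.
  apply: le_trans (tl N) _; rewrite le_eqVlt; apply/orP; left; apply/eqP; ring.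
have ea : entire_family a.
  move=> A r r0; exists (2 * (coef_cst * C0) * expR (e0 * pw rho r)) => k.
  have := bnd _ _ H0 A k r (ltW r0) 0%N; rewrite big_ord0 subr0 expr0 mulr1//.
exists a => // N; exists (fun A k => (\sum_(l < N) b l A k) + (-1) * a A k).
  move=> A; apply: entire_lin => //.
  by apply: (@entire_sum _ N (fun l => b l A)) => l; exact: eb.
split.
  rewrite -slice_series_fsub//; last by move=> A; apply: (@entire_sum _ N (fun l => b l A)) => l; exact: eb.
  congr fsub; apply/funext => x; rewrite -slice_series_sum//; congr clsum; apply/funext => l.
  by have [_ -> _] := Hb l.
move=> e C HC A k r r0; rewrite mulN1r distrC; exact: bnd.
Qed.

End Coefficients.

(** * Binomial inversion *)

Lemma sum_ord_widen0 (V : nmodType) (F : nat -> V) k m : (k <= m)%N ->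
  (forall i, (k <= i)%N -> F i = 0) -> \sum_(i < m) F i = \sum_(i < k) F i.
Proof.
move=> km F0; rewrite -(subnKC km) big_split_ord/= [X in _ + X]big1 ?addr0// => i _.
by rewrite F0 ?leq_addr.
Qed.

Lemma coef_shiftX (F : comNzRingType) (c : F) l i :
  (('X + c%:P) ^+ l)`_i = c ^+ (l - i) *+ 'C(l, i).
Proof.
have -> : ('X + c%:P) ^+ l = \poly_(j < l.+1) (c ^+ (l - j) *+ 'C(l, j)).
  rewrite addrC exprDn poly_def; apply: eq_bigr => j _.
  by rewrite -mul_polyC polyCMn polyC_exp mulrnAl.
by rewrite coef_poly ltnS; case: leqP => // li; rewrite bin_small.
Qed.

(* The linear form [p |-> \sum_i p`_i * P i], applied to [(('X - z) + z) ^+ k = 'X^k]. *)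
Lemma binomial_inversion (F : comNzRingType) (P : nat -> F) (z : F) k :
  \sum_(l < k.+1) z ^+ (k - l) *+ 'C(k, l) *
     (\sum_(i < l.+1) (- z) ^+ (l - i) *+ 'C(l, i) * P i) = P k.
Proof.
pose L (p : {poly F}) := \sum_(i < k.+1) p`_i * P i.
transitivity (L 'X^k); last first.
  rewrite /L big_ord_recr/= coefXn eqxx mul1r big1 ?add0r// => i _.
  by rewrite coefXn (ltn_eqF (ltn_ord i)) mul0r.
have -> : 'X^k = \sum_(l < k.+1) (z ^+ (k - l) *+ 'C(k, l))%:P * ('X + (- z)%:P) ^+ l.
  rewrite -[in LHS](subrK (z%:P) 'X) -polyCN addrC exprDn; apply: eq_bigr => l _.
  by rewrite polyCMn polyC_exp mulrnAl.
rewrite /L; under [RHS]eq_bigr do rewrite coef_sum mulr_suml.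
rewrite exchange_big/=; apply: eq_bigr => l _; rewrite mulr_sumr.
transitivity (\sum_(i < l.+1) z ^+ (k - l) *+ 'C(k, l) * (('X + (- z)%:P) ^+ l)`_i * P i).
  by apply: eq_bigr => i _; rewrite coef_shiftX mulrA.
rewrite -(@sum_ord_widen0 _ (fun i => z ^+ (k - l) *+ 'C(k, l) * (('X + (- z)%:P) ^+ l)`_i * P i) l.+1 k.+1) => [|//|i li].
- by apply: eq_bigr => i _; rewrite coefCM.
- by rewrite coef_shiftX (bin_small li) mulr0n mulr0 mul0r.
Qed.

Lemma sum_bin (R : comNzRingType) l : \sum_(i < l.+1) 'C(l, i)%:R = 2 ^+ l :> R.
Proof.
rewrite -[2]/(1 + 1 : R) exprDn; apply: eq_bigr => i _.
by rewrite !expr1n mul1r.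
Qed.

(** * Operators from their values on powers *)

Section Symbols.
Variables (R : realType) (n : nat).
Local Notation blade := {set 'I_n}.

(** The power (-z)^j as a real power series, so that holomorphy and conjugation symmetry are
    inherited from [ps]. *)
Definition negpow j : nat -> R := fun m => (-1) ^+ j * (m == j)%:R.

Lemma ps_negpow j z : ps (negpow j) z = (- z) ^+ j.
Proof. by rewrite /negpow ps_single [RHS]exprNn rmorphXn rmorphN1. Qed.

(* The coefficient [u_l] of an operator that maps the [k]-th power to [slice_series (p k)]. *)
Definition symbol (p : nat -> blade -> nat -> R) l : blade -> R[i] -> R[i] := fun A z =>
  \sum_(i < l.+1) ('C(l, i)%:R / l`!%:R)%:C%C * (ps (negpow (l - i)) z * ps (p i A) z).

Lemma holo_symbol p l : (forall k, entire_family (p k)) -> holo_family (symbol p l).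
Proof.
move=> ep A; split.
  eexists; apply: cderiv_sum => i; apply: cderivM; first exact: cderiv_cst.
  by apply: cderivM; apply: ps_cderiv; [exact: entire_single|exact: ep].
move=> z; rewrite /symbol rmorph_sum; apply: eq_bigr => i _.
rewrite !rmorphM/= oppr0; congr (_ * (_ * _)); apply: ps_conj; last exact: ep.
exact: entire_single.
Qed.

Lemma ps_iter_dseq_finite (b : nat -> R) N l z : (forall k, (N <= k)%N -> b k = 0) ->
  ps (iter l (@dseq R) b) z = \sum_(k < N) ((k ^_ l)%:R * b k)%:C%C * z ^+ (k - l).
Proof.
move=> b0; have [Nl|lN] := leqP N l.
  rewrite (@ps_finite _ _ 0) => [|k _]; last first.
    by rewrite iter_dseqE b0 ?mulr0// (leq_trans Nl)// leq_addl.
  rewrite /psN big_ord0 big1// => k _; rewrite ffact_small ?mul0r// (leq_trans _ Nl)//.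
rewrite (@ps_finite _ _ (N - l)) => [|k]; last first.
  by rewrite leq_subLR => Nk; rewrite iter_dseqE b0 ?mulr0// addnC.
pose F k := ((k ^_ l)%:R * b k)%:C%C * z ^+ (k - l).
have -> : \sum_(k < N) F k = \sum_(k < l + (N - l)) F k by rewrite (subnKC (ltnW lN)).
rewrite big_split_ord/= [X in X + _]big1 ?add0r => [|k _]; last first.
  by rewrite /F ffact_small ?mul0r.
by apply: eq_bigr => k _; rewrite /F iter_dseqE addnC addKn.
Qed.

(** On a polynomial the series in l is a finite sum: derivatives of order at least N vanish. The
    factor l! in [k ^_ l] cancels the 1 / l! of the symbol, and binomial inversion returns the image
    of each power. *)
Lemma symbol_inversion p (b : nat -> R) N M z A : (forall k, (N <= k)%N -> b k = 0) -> (N <= M)%N ->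
  \sum_(l < M) symbol p l A z * ps (iter l (@dseq R) b) z = \sum_(k < N) (b k)%:C%C * ps (p k A) z.
Proof.
move=> b0 NM; under eq_bigr do rewrite (ps_iter_dseq_finite _ _ b0) mulr_sumr.
rewrite exchange_big/=; apply: eq_bigr => k _.
rewrite (@sum_ord_widen0 _ (fun l => symbol p l A z * (((k ^_ l)%:R * b k)%:C%C * z ^+ (k - l))) k.+1 M).
- rewrite -[in RHS](binomial_inversion (fun i => ps (p i A) z) z k) mulr_sumr.
  apply: eq_bigr => l _; rewrite /symbol -bin_ffact.
  rewrite !mulr_suml !mulr_sumr; apply: eq_bigr => i _.
  have f0 : l`!%:R != 0 :> R by rewrite pnatr_eq0 -lt0n fact_gt0.
  have cE (m : nat) : m%:R = (m%:R : R)%:C%C :> R[i] by rewrite rmorph_nat.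
  have -> : (('C(k, l) * l`!)%:R * b k)%:C%C = 'C(k, l)%:R%:C%C * (l`!%:R)%:C%C * (b k)%:C%C :> R[i].
    by rewrite natrM !rmorphM.
  rewrite ps_negpow -[z ^+ (k - l) *+ _]mulr_natr -[(- z) ^+ (l - i) *+ _]mulr_natr (cE 'C(k, l)) (cE 'C(l, i)).
  have <- : ('C(l, i)%:R / l`!%:R)%:C%C * (l`!%:R)%:C%C = ('C(l, i)%:R)%:C%C :> R[i].
    by rewrite -rmorphM divfK.
  ring.
- by apply: leq_trans NM.
- by move=> l kl; rewrite ffact_small// mul0r mul0r mulr0.
Qed.

End Symbols.

(** * The operators between the two spaces *)

Section Convergence.
Variables (R : realType) (n : nat).
Local Notation Cl := (Cl R n).
Local Notation blade := {set 'I_n}.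
Local Notation para := (para R n).
Local Notation cl1 := (cl1 R n).
Hypothesis n_gt0 : (0 < n)%N.
Variables (rho1 rho2 rhohat : R -> R) (rinf1 rinf2 : R).
Hypotheses (h1 : prox_order rho1 rinf1) (h2 : prox_order rho2 rinf2).
Hypothesis hO : exists C : R, \forall r \near +oo, powR r (rho1 r) <= C * powR r (rho2 r).
Hypothesis hhat : normalized_prox_order rhohat rinf1.
Hypothesis hhat_eq : \forall r \near +oo, rhohat r = rho1 r.
Implicit Types (f g : para -> Cl) (x : para) (u : nat -> para -> Cl).

Let hhat' : prox_order rhohat rinf1. Proof. by case: hhat. Qed.

Lemma pw_hat_le : exists2 K : R, 0 <= K & forall t, 0 <= t -> pw rhohat t <= K * (pw rho2 t + 1).
Proof.
have [c c0 Hc] := pw_eventually_eq hhat' h1 hhat_eq.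
have [d d0 Hd] := pw_bigO h1 hO.
exists (d + c); first by rewrite addr_ge0.
move=> t t0; apply: le_trans (Hc t t0) _; rewrite mulrDl; apply: lerD; first exact: Hd.
by rewrite ler_peMr// lerDr pw_ge0.
Qed.

(** Since [phi] at 0 is unspecified, the radius 1 stands in for [l = 0]; [k0] pays for this in the
    last inequality. *)
Lemma phi_radius : exists2 k0 : R, 0 <= k0 & exists s : nat -> R, forall l,
  [/\ 0 < s l, s l ^+ l = phi rhohat l%:R ^+ l & pw rhohat (s l) <= l%:R + k0].
Proof.
exists (pw rhohat 1); first exact: pw_ge0.
exists (fun l => if l == 0%N then 1 else phi rhohat l%:R) => -[|l] /=.
  by rewrite !expr0 add0r; split.
have [p e] := phiP hhat (ltr0Sn R l).
by split => //; rewrite e lerDl pw_ge0.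
Qed.

Lemma term_bound u : ucond rho2 rhohat rinf1 u -> forall e : R, 0 < e ->
  exists eps C : R, [/\ 0 < eps, 0 <= C & forall f B, SM_L f -> wbound rho1 eps B f ->
    forall l, wbound rho2 e (C * B * 2^-1 ^+ l) (starL (u l) (dx0n l f))].
Proof.
move=> [uSM ub] e e0; have e20 : 0 < e / 2 by rewrite divr_gt0.
have [eps0 [C0 [eps0_gt0 [C0_gt0 Hu]]]] := ub _ e20.
have rinf0 := prox_rinf_gt0 h1.
pose kap := powR (expR 1 * rinf1) rinf1^-1.
have kap0 : 0 < kap by rewrite powR_gt0 ?mulr_gt0 ?expR_gt0.
(* This makes [eps0 / (kap * M) <= 1 / 4]. Of the resulting [4 ^ -l], one factor [2 ^ -l] cancels
   the growth of the weight on the disc of radius [M * s l], and the other is the rate of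
   convergence. *)
pose M := 1 + 4 * eps0 / kap.
have M1 : 1 <= M by rewrite lerDl divr_ge0 ?mulr_ge0 ?(ltW eps0_gt0) ?(ltW kap0).
have M0 : 0 < M := lt_le_trans ltr01 M1.
have ratio : eps0 / (kap * M) <= 4^-1.
  rewrite ler_pdivrMr ?mulr_gt0// ler_pdivlMl// /M mulrDr mulr1 mulrC.
  by rewrite [kap * (_ / _)]mulrC divfK ?gt_eqF// mulrC lerDr ltW.
have [|K4 K40 H4] := @pw_scale R rhohat rinf1 hhat' 4; first by rewrite ler1n.
have [|KM KM0 HM] := @pw_scale R rhohat rinf1 hhat' (2 * M); first by lra.
have eq1 : \forall r \near +oo, rho1 r = rhohat r by apply: filterS hhat_eq => r ->.
have [c1 c10 Hc1] := pw_eventually_eq h1 hhat' eq1.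
have [K5 K50 H5] := pw_hat_le.
have [k0 k00 [s Hs]] := phi_radius.
have ln20 : 0 < ln 2 :> R by rewrite ln_gt0// ltr1n.
have K45 : 0 <= K4 * K5 by rewrite mulr_ge0.
(* One half of the type [e] is left for f, the other half is spent on u_l. The second condition
   turns the part of the exponent linear in l into at most [2 ^ l]. *)
have [eps [eps_gt0 epsK epsM]] : exists eps : R, [/\ 0 < eps, eps * (K4 * K5) <= e / 2 & eps * KM <= ln 2].
  exists (Num.min (e / 2 / (K4 * K5 + 1)) (ln 2 / (KM + 1))).
  have p1 : 0 < K4 * K5 + 1 by lra.
  have p2 : 0 < KM + 1 by lra.
  split; first by rewrite lt_min !divr_gt0.
    apply: (@le_trans _ _ (e / 2 / (K4 * K5 + 1) * (K4 * K5))).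
      by rewrite ler_wpM2r// ge_min lexx.
    by rewrite mulrAC ler_pdivrMr// ler_wpM2l ?(ltW e20)// lerDl.
  apply: (@le_trans _ _ (ln 2 / (KM + 1) * KM)).
    by rewrite ler_wpM2r// ge_min lexx orbT.
  by rewrite mulrAC ler_pdivrMr// ler_wpM2l ?(ltW ln20)// lerDl.
pose D := K4 * K5 + K4 + KM * (k0 + 1) + 1 + c1.
(* The radius [2 * t + M * s l] is at most [4 * t] or [2 * (M * s l)]. The first case is charged to
   the second order, the second grows linearly in l, and everything else is collected in [D]. *)
have V1 l t : 0 <= t -> pw rho1 (2 * t + M * s l) <= K4 * K5 * pw rho2 t + KM * l%:R + D.
  move=> t0; have [sp _ sl] := Hs l; set w := M * s l.
  have w0 : 0 < w by rewrite mulr_gt0.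
  have A0 : 0 <= 2 * t + w by apply: addr_ge0; [exact: mulr_ge0|exact: ltW].
  apply: le_trans (Hc1 _ A0) _.
  have b1 : pw rhohat (4 * t) <= K4 * (K5 * (pw rho2 t + 1) + 1).
    by apply: le_trans (H4 t t0) _; rewrite ler_wpM2l// lerD2r H5.
  have b2 : pw rhohat (2 * w) <= KM * (l%:R + k0 + 1).
    rewrite /w mulrA; apply: le_trans (HM _ (ltW sp)) _; rewrite ler_wpM2l//.
    by rewrite lerD2r.
  have b3 : pw rhohat (2 * t + w) <= pw rhohat (4 * t) + pw rhohat (2 * w) + 1.
    have p4 := pw_ge0 rhohat (4 * t); have pw2 := pw_ge0 rhohat (2 * w).
    have [tw|wt] := leP (2 * t) w.
      have := @pw_le_ge0 R rhohat rinf1 hhat (2 * t + w) (2 * w) A0; lra.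
    have := @pw_le_ge0 R rhohat rinf1 hhat (2 * t + w) (4 * t) A0; lra.
  rewrite /D; move: b1 b2 b3; rewrite !mulrDr !mulr1 mulrA; lra.
pose bl := blades R n; have bl0 : 0 <= bl := blades_ge0 R n.
pose C := bl * (1 + bl) * (bl * ((1 + bl) * C0 * (4 * (coef_cst R n * expR (eps * D))))).
have C_ge0 : 0 <= C.
  by rewrite /C !mulr_ge0 ?addr_ge0 ?expR_ge0 ?coef_cst_ge0 ?(ltW C0_gt0).
exists eps, C; split; [exact: eps_gt0|exact: C_ge0|] => f B fSM fB l x.
have [a ea [fE /(_ _ _ _ fB) aB]] := SM_cbound n_gt0 fSM.
have [U hU uE] := SM_family n_gt0 (uSM l).
rewrite fE dx0n_ps// uE starL_slice_fun//; last first.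
  by apply: holo_ps; exact: entire_dseqn.
have [sp sE _] := Hs l.
set t := pnorm x; have t0 : 0 <= t := pnorm_ge0 x.
have zt : normc (slice_coord x) = t := normc_slice_coord x.
pose gl := C0 * Gcoef rhohat rinf1 l / l`!%:R * eps0 ^+ l.
have bU A : normc (U A (slice_coord x)) <= (1 + bl) * (gl * expR (e / 2 * pw rho2 t)).
  apply: (family_le n_gt0 hU) => y; rewrite zt -uE => yt; rewrite -yt.
  by have /wnorm_leP := Hu l; apply.
pose X := coef_cst R n * B * expR (eps * pw rho1 (2 * t + M * s l)).
have Ms0 : 0 < M * s l by rewrite mulr_gt0.
have bP A : normc (ps (dseqn l a A) (slice_coord x)) <= 4 * (l`!%:R / (M * s l) ^+ l * X).
  apply: ps_deriv_le => // k; rewrite zt; apply: aB.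
  by rewrite addr_ge0 ?mulr_ge0 ?(ltW M0) ?(ltW sp).
have B0 : 0 <= B.
  by have := fB x; move=> /(le_trans (clnorm_ge0 _)); rewrite pmulr_lge0// expR_gt0.
have bS := @star_family_le R n U (fun A => ps (dseqn l a A)) (slice_coord x) _ _ bU bP.
have bT := slice_fun_le bS.
apply: le_trans bT _.
have E2 : expR (eps * pw rho1 (2 * t + M * s l)) <=
    expR (e / 2 * pw rho2 t) * 2 ^+ l * expR (eps * D).
  have -> : 2 ^+ l = expR (l%:R * ln 2) :> R by rewrite expRM_natl lnK ?posrE.
  rewrite -!expRD ler_expR; apply: (@le_trans _ _ (eps * (K4 * K5 * pw rho2 t + KM * l%:R + D))).
    by rewrite ler_wpM2l ?(ltW eps_gt0)// V1.
  rewrite !mulrDr lerD2r; apply: lerD; first by rewrite mulrA ler_wpM2r// pw_ge0.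
  by rewrite mulrA [leRHS]mulrC ler_wpM2r.
(* The factorial of the condition on u_l cancels that of Cauchy's estimate, and [phi(l) ^ l] cancels
   against [s l ^ l]. *)
have coefE : Gcoef rhohat rinf1 l / l`!%:R * eps0 ^+ l * (l`!%:R / (M * s l) ^+ l) = (eps0 / (kap * M)) ^+ l.
  rewrite Gcoef_phi -sE -/kap !exprMn exprVn exprMn.
  have f0 : l`!%:R != 0 :> R by rewrite pnatr_eq0 -lt0n fact_gt0.
  have k1 : kap ^+ l != 0 by rewrite expf_neq0 ?gt_eqF.
  have k2 : M ^+ l != 0 by rewrite expf_neq0 ?gt_eqF.
  have k3 : s l ^+ l != 0 by rewrite expf_neq0 ?gt_eqF.
  by field; rewrite f0 k1 k2 k3.
have rl : (eps0 / (kap * M)) ^+ l <= 4^-1 ^+ l.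
  rewrite lerXn2r ?nnegrE ?invr_ge0// divr_ge0 ?(ltW eps0_gt0)// mulr_ge0 ?(ltW kap0) ?(ltW M0)//.
have r0 : 0 <= (eps0 / (kap * M)) ^+ l.
  by rewrite exprn_ge0// divr_ge0 ?(ltW eps0_gt0)// mulr_ge0 ?(ltW kap0) ?(ltW M0).
set Q := (eps0 / (kap * M)) ^+ l in coefE rl r0.
set E := expR (e / 2 * pw rho2 t) in E2 *.
have EE : expR (e * pw rho2 t) = E * E by rewrite /E -expRD -mulrDl -splitr.
rewrite EE.
have E0 : 0 <= E by rewrite expR_ge0.
rewrite -/bl.
have -> : bl * (1 + bl) * (bl * ((1 + bl) * (gl * E) * (4 * (l`!%:R / (M * s l) ^+ l * X)))) =
   bl * (1 + bl) * (bl * ((1 + bl) * C0 * (4 * coef_cst R n))) * B * E *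
   (Q * expR (eps * pw rho1 (2 * t + M * s l))).
  by rewrite -coefE /gl /X; ring.
have -> : C * B * 2^-1 ^+ l * (E * E) = bl * (1 + bl) * (bl * ((1 + bl) * C0 * (4 * coef_cst R n))) * B * E *
   (4^-1 ^+ l * (E * 2 ^+ l * expR (eps * D))).
  have -> : 4^-1 ^+ l = 2^-1 ^+ l * 2^-1 ^+ l :> R.
    by rewrite -exprMn; congr (_ ^+ _); lra.
  have q : (2^-1 ^+ l * 2 ^+ l : R) = 1 by rewrite -exprMn mulVf ?expr1n// pnatr_eq0.
  rewrite -[LHS]mulr1 -[X in _ * X = _]q /C; ring.
apply: ler_wpM2l.
  by rewrite !mulr_ge0 ?addr_ge0 ?coef_cst_ge0 ?(ltW C0_gt0).
by apply: ler_pM; rewrite ?expR_ge0.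
Qed.

Lemma SM_fsub f g : SM_L f -> SM_L g -> SM_L (fsub f g).
Proof.
move=> /(SM_coef n_gt0)[a ea [-> _]] /(SM_coef n_gt0)[b eb [-> _]].
rewrite slice_series_fsub//; apply: slice_series_SM => A; exact: entire_lin.
Qed.

Lemma inA0_fsub rho f g : inA0 rho f -> inA0 rho g -> inA0 rho (fsub f g).
Proof.
move=> /inA0P[fSM fb] /inA0P[gSM gb]; apply/inA0P; split; first exact: SM_fsub.
move=> e e0; have [B B0 HB] := fb e e0; have [B' B'0 HB'] := gb e e0.
exists (blades R n * (B + B')); first by rewrite mulr_ge0 ?blades_ge0 ?addr_ge0.
exact: wbound_fsub.
Qed.

Lemma term_SM u l f : SM_L (u l) -> SM_L f -> SM_L (starL (u l) (dx0n l f)).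
Proof.
move=> /(SM_family n_gt0)[U hU ->] /(SM_coef n_gt0)[a ea [-> _]].
rewrite dx0n_ps// starL_slice_fun//; last by apply: holo_ps; exact: entire_dseqn.
by apply: slice_fun_SM; apply: holo_star => //; apply: holo_ps; exact: entire_dseqn.
Qed.

Lemma term_fsub u l f g : SM_L (u l) -> SM_L f -> SM_L g ->
  starL (u l) (dx0n l (fsub f g)) = fsub (starL (u l) (dx0n l f)) (starL (u l) (dx0n l g)).
Proof.
move=> /(SM_family n_gt0)[U hU ->] /(SM_coef n_gt0)[a ea [-> _]] /(SM_coef n_gt0)[b eb [-> _]].
have eab : entire_family (fun A k => a A k + (-1) * b A k) by move=> A; exact: entire_lin.
rewrite slice_series_fsub// !dx0n_ps//.
rewrite !starL_slice_fun//; try by apply: holo_ps; exact: entire_dseqn.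
rewrite slice_funB; congr slice_fun; apply/funext => C; apply/funext => z.
rewrite /star_family -sumrB; apply: eq_bigr => A _; rewrite -mulrBr; congr (_ * _).
rewrite -mulrBr; congr (_ * _).
have -> : dseqn l (fun A k => a A k + (-1) * b A k) (symdiff A C) =
    fun k => dseqn l a (symdiff A C) k + (-1) * dseqn l b (symdiff A C) k.
  by apply/funext => k; rewrite /dseqn !iter_dseqE; ring.
by rewrite ps_lin ?rmorphN1 ?mulN1r//; exact: entire_dseqn.
Qed.

Lemma psumE u f N x A : psum u f N x A = \sum_(l < N) starL (u l) (dx0n l f) x A.
Proof. by rewrite [LHS]ffunE. Qed.

Lemma psum_fsub u f g N : (forall l, SM_L (u l)) -> SM_L f -> SM_L g ->
  psum u (fsub f g) N = fsub (psum u f N) (psum u g N).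
Proof.
move=> uSM fSM gSM; apply/funext => x; apply/ffunP => A.
rewrite [RHS]claddE cloppEE !psumE -sumrB; apply: eq_bigr => l _.
by rewrite term_fsub// [LHS]claddE cloppEE.
Qed.

(** The constants depend on neither [f] nor [N]. At [N = 0] the partial sum is empty and the bound
    controls [T f] itself; for large N it is the convergence of the series. *)
Lemma operator_bound u : ucond rho2 rhohat rinf1 u -> exists T : (para -> Cl) -> (para -> Cl),
  (forall f, inA0 rho1 f -> SM_L (T f)) /\
  forall e : R, 0 < e -> exists eps C : R, [/\ 0 < eps, 0 <= C & forall f B, inA0 rho1 f ->
    wbound rho1 eps B f -> forall N, wbound rho2 e (C * B * 2^-1 ^+ N) (fsub (psum u f N) (T f))].
Proof.
move=> hu; have [uSM _] := hu; have tb := term_bound hu.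
have /choice [T HT] : forall f, exists Tf : para -> Cl, inA0 rho1 f -> exists2 a, entire_family a &
    Tf = slice_series a /\ forall N, exists2 d, entire_family d & fsub (psum u f N) (slice_series a) = slice_series d /\
    forall e C, (forall l, wbound rho2 e (C * 2^-1 ^+ l) (starL (u l) (dx0n l f))) ->
      cbound rho2 e (2 * (coef_cst R n * C) * 2^-1 ^+ N) d.
  (* Outside the space the value of the operator is arbitrary; [f] is taken. *)
  move=> f; have [hf|hf] := pselect (inA0 rho1 f); last by exists f.
  have [fSM fb] := (inA0P rho1 f).1 hf.
  have tSM l : SM_L (starL (u l) (dx0n l f)) by exact: term_SM.
  have [|a ea Ha] := series_complete (rho := rho2) n_gt0 tSM; last by exists (slice_series a) => _; exists a.
  have [eps [C [eps0 C0 HC]]] := tb 1 ltr01; have [B B0 HB] := fb eps eps0.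
  by exists 1, (C * B); exact: HC.
exists T; split; first by move=> f /HT[a ea [-> _]]; exact: slice_series_SM.
move=> e e0; have [e' [K [e'0 K0 HK]]] := @slice_series_wbound R n rho2 rinf2 e h2 e0.
have [eps [C [eps0 C0 HC]]] := tb e' e'0.
exists eps, (K * (2 * (coef_cst R n * C))); split; first exact: eps0.
  by apply: (mulr_ge0 K0); apply: mulr_ge0 => //; apply: mulr_ge0 (coef_cst_ge0 R n) C0.
move=> f B hf fB N; have [fSM _] := (inA0P rho1 f).1 hf.
have [a ea [-> /(_ N)[d ed [-> Hd]]]] := HT f hf.
have := HK d _ ed (Hd e' (C * B) (HC f B fSM fB)).
by congr (wbound _ _ _ _); ring.
Qed.

(** * Mapping property, convergence and continuity of the operator defined by a series *)

Section Operator.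
Variables (u : nat -> para -> Cl) (T : (para -> Cl) -> (para -> Cl)).
Hypotheses (uSM : forall l, SM_L (u l)) (TSM : forall f, inA0 rho1 f -> SM_L (T f)).
Hypothesis HT : forall e : R, 0 < e -> exists eps C : R, [/\ 0 < eps, 0 <= C & forall f B, inA0 rho1 f ->
    wbound rho1 eps B f -> forall N, wbound rho2 e (C * B * 2^-1 ^+ N) (fsub (psum u f N) (T f))].

Lemma operator_inA0 f : inA0 rho1 f -> inA0 rho2 (T f).
Proof.
move=> hf; apply/inA0P; split; first exact: TSM.
move=> e e0; have [eps [C [eps0 C0 HC]]] := HT e0.
have [_ fb] := (inA0P rho1 f).1 hf; have [B B0 HB] := fb eps eps0.
exists (C * B); first exact: mulr_ge0.
move=> x; have := HC f B hf HB 0%N x; rewrite expr0 mulr1; congr (_ <= _).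
rewrite /clnorm; congr Num.sqrt; apply: eq_bigr => A _.
by rewrite fsubE psumE big_ord0 sub0r sqrrN.
Qed.

Lemma operator_cvg f : inA0 rho1 f -> cvgA0 rho2 (psum u f) (T f).
Proof.
move=> hf; apply: cvgA0_geom => e e0; have [eps [C [eps0 C0 HC]]] := HT e0.
have [_ fb] := (inA0P rho1 f).1 hf; have [B B0 HB] := fb eps eps0.
by exists (C * B) => N; exact: HC.
Qed.

(** The partial sums are additive in f, and T is approximated by them at rate [2 ^ -N]; so T g - T f
    may be compared with T (g - f) up to an error that vanishes, and the case N = 0 bounds the
    latter. *)
Lemma operator_diff (e : R) : 0 < e -> exists eps C : R, [/\ 0 < eps, 0 <= C &
  forall f g B, inA0 rho1 f -> inA0 rho1 g -> wbound rho1 eps B (fsub g f) ->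
    wbound rho2 e (C * B) (fsub (T g) (T f))].
Proof.
move=> e0; have [eps [C [eps0 C0 HC]]] := HT e0.
exists eps, (blades R n * C); split; first exact: eps0.
  exact: mulr_ge0 (blades_ge0 R n) C0.
move=> f g B hf hg gfB x.
have [fSM fb] := (inA0P rho1 f).1 hf; have [Bf _ HBf] := fb eps eps0.
have [gSM gb] := (inA0P rho1 g).1 hg; have [Bg _ HBg] := gb eps eps0.
have hgf := inA0_fsub hg hf.
set E := expR _; rewrite -mulrA -mulrA; apply: clnorm_le => A.
have cl f' B' N : wbound rho2 e (C * B' * 2^-1 ^+ N) (fsub (psum u f' N) (T f')) ->
    `|psum u f' N x A - T f' x A| <= C * B' * E * 2^-1 ^+ N.
  move=> /(_ x) H; rewrite -fsubE; apply: le_trans (cl_le_norm _ A) _.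
  by rewrite mulrAC.
have H0 := cl _ _ _ (HC _ _ hgf gfB 0%N).
rewrite psumE big_ord0 sub0r normrN expr0 mulr1 -mulrA in H0.
apply: (@le_half_limit _ _ _ (C * Bg * E + C * Bf * E + C * B * E)) => N.
have H1 := cl _ _ _ (HC _ _ hgf gfB N).
have H2 := cl _ _ _ (HC _ _ hf HBf N).
have H3 := cl _ _ _ (HC _ _ hg HBg N).
rewrite psum_fsub// fsubE in H1; rewrite fsubE !mulrDl.
move: H0 H1 H2 H3; rewrite !ler_norml.
move: (C * Bg * E * _) (C * Bf * E * _) (C * B * E * _) (C * (B * E)) => *; lra.
Qed.

Lemma operator_cont : contA0 rho1 rho2 T.
Proof.
move=> f hf e d e0 d0; have [eps [C [eps0 C0 HC]]] := operator_diff e0.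
exists eps, (d / (C + 1)); have C1 : 0 < C + 1 by rewrite ltr_wpDl.
split => //; split; first exact: divr_gt0.
move=> g hg gf; apply: (@le_lt_trans _ _ (C * (d / (C + 1)))%:E).
  by apply/wnorm_leP; apply: HC => //; apply/wnorm_leP/ltW.
by rewrite lte_fin mulrA ltr_pdivrMr// mulrC ltr_pM2l// ltrDl.
Qed.

End Operator.

(** * Monomials with right coefficients and Taylor polynomials in the weighted spaces *)

Definition single (a : Cl) k : para -> Cl := slice_series (fun A j => a A * (j == k)%:R).

Lemma single_clmul a k : single a k = fun x => clmul (single cl1 k x) a.
Proof.
apply/funext => x; rewrite /single /slice_series /slice_fun -slice_value_clmul; congr slice_value.
apply/funext => C; rewrite (bigD1 finset.set0)//= big1 ?addr0 => [|A A0].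
  by rewrite !ps_single symdiff0l clsign0l mul1r [cl1 _]ffunE eqxx mul1r.
by rewrite ps_single [cl1 _]ffunE (negbTE A0) mul0r mulr0.
Qed.

Lemma single_bound (e : R) : 0 < e -> exists Y D : R, [/\ 0 <= Y, 0 < D &
  forall (a : Cl) (s : R) k, (forall A, `|a A| <= s) ->
    wbound rho1 e (Y * D ^+ k * phi rhohat k%:R ^+ k * s) (single a k)].
Proof.
move=> e0; have [e' [K [e'0 K0 HK]]] := @slice_series_wbound R n rho1 rinf1 e h1 e0.
have [C [D [C0 D0 HD]]] := monomial_bound hhat e'0.
have [c c0 Hc] := pw_eventually_eq hhat' h1 hhat_eq.
exists (K * (C * expR (e' * c))), D; split; [|exact: D0|].
  by apply: (mulr_ge0 K0); apply: mulr_ge0 (ltW C0) _; exact: expR_ge0.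
move=> a s k as_; have s0 : 0 <= s := le_trans (normr_ge0 _) (as_ finset.set0).
rewrite -!mulrA; apply: HK; first by move=> A; exact: entire_single.
have F0 : 0 <= C * D ^+ k * phi rhohat k%:R ^+ k.
  apply: mulr_ge0; last exact: (phiX_ge0 hhat).
  by apply: mulr_ge0 (ltW C0) _; apply: exprn_ge0; exact: ltW.
move=> A j r r0; have [->|jk] := eqVneq j k; last first.
  rewrite mulr0 normr0 mul0r mulr_ge0 ?expR_ge0//.
  move: (mulr_ge0 (mulr_ge0 F0 s0) (expR_ge0 (e' * c))); congr (_ <= _); ring.
rewrite mulr1; have := HD k r r0; rewrite mulNr expRN ler_pdivrMr; last exact: expR_gt0.
move=> rk.
apply: (@le_trans _ _ (s * (C * D ^+ k * phi rhohat k%:R ^+ k * expR (e' * (pw rho1 r + c))))).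
  apply: ler_pM => //; first exact: exprn_ge0.
  apply: le_trans rk _; apply: (ler_wpM2l F0); rewrite ler_expR.
  by apply: (ler_wpM2l (ltW e'0)); exact: Hc.
by rewrite mulrDr expRD le_eqVlt; apply/orP; left; apply/eqP; ring.
Qed.

Lemma single_inA0 a k : inA0 rho1 (single a k).
Proof.
apply/inA0P; split; first by apply: slice_series_SM => A; exact: entire_single.
move=> e e0; have [Y [D [Y0 D0 H]]] := single_bound e0.
have aA A : `|a A| <= clnorm a := cl_le_norm a A.
exists (Y * D ^+ k * phi rhohat k%:R ^+ k * clnorm a); last exact: H.
apply: mulr_ge0 (clnorm_ge0 a); apply: mulr_ge0; last exact: (phiX_ge0 hhat).
by apply: mulr_ge0 Y0 _; apply: exprn_ge0; exact: ltW.
Qed.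

Definition taylor_coef (a : blade -> nat -> R) k : Cl := [ffun A => a A k].

Definition taylor (a : blade -> nat -> R) N : para -> Cl :=
  fun x => clsum N (fun k => clmul (single cl1 k x) (taylor_coef a k)).

Lemma taylor_slice_series a N :
  taylor a N = slice_series (fun A j => if (j < N)%N then a A j else 0).
Proof.
apply/funext => x; rewrite /taylor.
have -> : (fun k => clmul (single cl1 k x) (taylor_coef a k)) =
    fun k => slice_series (fun A j => taylor_coef a k A * (j == k)%:R) x.
  by apply/funext => k; rewrite -/(single _ _) [in RHS]single_clmul.
rewrite (@slice_series_sum R n N (fun k A j => taylor_coef a k A * (j == k)%:R)) => [|k A]; last exact: entire_single.
congr (slice_series _ x); apply/funext => A; apply/funext => j.
case: ifPn => [jN|jN].
  rewrite (bigD1 (Ordinal jN))//= eqxx mulr1 ffunE big1 ?addr0// => i ij.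
  by rewrite (_ : (j == i :> nat) = false) ?mulr0//; apply/negbTE; move: ij; rewrite eq_sym.
rewrite big1// => i _; case: eqP => [ji|_]; last by rewrite mulr0.
by rewrite ji ltn_ord in jN.
Qed.

Lemma trunc_entire (a : blade -> nat -> R) N : entire_family (n := n) (fun (A : blade) j => if (j < N)%N then a A j else 0 : R).
Proof. by move=> A; apply: (@entire_finite _ _ N) => j; rewrite leqNgt => /negbTE ->. Qed.

(** Bounding the coefficients at radius [2 * r] gains [2 ^ -j] in degree j, hence [2 ^ -N] for what
    remains after truncation. The constant is uniform in N. *)
Lemma taylor_cvg f : inA0 rho1 f -> exists2 a, entire_family a & f = slice_series a /\
  forall e : R, 0 < e -> exists E : R, 0 < E /\ forall N, wbound rho1 e (E * 2^-1 ^+ N) (fsub (taylor a N) f).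
Proof.
move=> /inA0P[fSM fb]; have [a ea [fE Ha]] := SM_cbound n_gt0 fSM; exists a => //; split => // e e0.
have [e' [K [e'0 K0 HK]]] := @slice_series_wbound R n rho1 rinf1 e h1 e0.
have [|K2 K20 H2] := @pw_scale R rho1 rinf1 h1 2; first by rewrite ler1n.
have K21 : 0 < K2 + 1 by rewrite ltr_wpDl.
pose e2 := e' / (K2 + 1); have e20 : 0 < e2 by exact: divr_gt0.
have e2K : e2 * K2 <= e'.
  by rewrite /e2 mulrAC ler_pdivrMr// ler_wpM2l ?(ltW e'0)// lerDl.
have [B B0 /Ha aB] := fb _ e20.
pose X := K * (coef_cst R n * B * expR (e2 * K2)).
have X0 : 0 <= X.
  apply: (mulr_ge0 K0); apply: mulr_ge0 (expR_ge0 _); exact: mulr_ge0 (coef_cst_ge0 R n) B0.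
(* The [+ 1] makes the constant strictly positive, as the scaling argument of [linear_bound] divides
   by it. *)
exists (X + 1); split; first by rewrite ltr_wpDl.
move=> N; apply: (@wbound_le _ _ _ _ (K * (coef_cst R n * B * expR (e2 * K2) * 2^-1 ^+ N))).
  by rewrite mulrA ler_wpM2r ?exprn_ge0 ?invr_ge0// lerDl.
rewrite taylor_slice_series fE slice_series_fsub//; last exact: trunc_entire.
apply: HK; first by move=> A; apply: entire_lin => //; exact: trunc_entire.
move=> A j r r0; have Z0 : 0 <= coef_cst R n * B * expR (e2 * K2) * 2^-1 ^+ N * expR (e' * pw rho1 r).
  apply: mulr_ge0 (expR_ge0 _); apply: mulr_ge0; last by apply: exprn_ge0; rewrite invr_ge0.
  by apply: mulr_ge0 (expR_ge0 _); exact: mulr_ge0 (coef_cst_ge0 R n) B0.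
case: ltnP => [jN|Nj]; first by rewrite mulN1r subrr normr0 mul0r.
rewrite add0r mulN1r normrN.
have -> : `|a A j| * r ^+ j = `|a A j| * (2 * r) ^+ j * 2^-1 ^+ j.
  by rewrite exprMn -mulrA; congr (_ * _); rewrite mulrAC -exprMn divff ?expr1n ?mul1r// pnatr_eq0.
have r20 : 0 <= 2 * r by rewrite mulr_ge0.
rewrite [leRHS]mulrAC; apply: ler_pM.
- by rewrite mulr_ge0 ?exprn_ge0.
- by rewrite exprn_ge0 ?invr_ge0.
- apply: le_trans (aB A j _ r20) _; rewrite -[leRHS]mulrA -expRD.
  apply: ler_wpM2l; first exact: mulr_ge0 (coef_cst_ge0 R n) B0.
  rewrite ler_expR; apply: (@le_trans _ _ (e2 * (K2 * (pw rho1 r + 1)))).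
    by apply: (ler_wpM2l (ltW e20)); exact: H2.
  rewrite mulrDr mulr1 mulrDr addrC lerD2l mulrA; apply: (ler_wpM2r (pw_ge0 _ _)); exact: e2K.
- by apply: ler_wiXn2l; rewrite ?invr_ge0 ?invf_le1 ?ler1n.
Qed.

Lemma inA0_lin rho f g (c : R) : inA0 rho f -> inA0 rho g ->
  inA0 rho (fun x => cladd (f x) (clscale c (g x))).
Proof.
move=> /inA0P[fSM fb] /inA0P[gSM gb]; apply/inA0P; split.
  move: fSM gSM => /(SM_coef n_gt0)[a ea [-> _]] /(SM_coef n_gt0)[b eb [-> _]].
  have -> : (fun x => cladd (slice_series a x) (clscale c (slice_series b x))) = slice_series (fun A k => a A k + c * b A k).
    by apply/funext => x; rewrite slice_series_lin.
  by apply: slice_series_SM => A; exact: entire_lin.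
move=> e e0; have [B B0 HB] := fb e e0; have [B' B'0 HB'] := gb e e0.
have Z : 0 <= B + `|c| * B' by apply: addr_ge0 B0 _; exact: mulr_ge0.
exists (blades R n * (B + `|c| * B')); first exact: mulr_ge0 (blades_ge0 R n) Z.
move=> x; rewrite -mulrA; apply: clnorm_le => A.
rewrite claddE clscaleE; apply: le_trans (ler_normD _ _) _; rewrite mulrDl.
apply: lerD; first exact: le_trans (cl_le_norm _ A) (HB x).
rewrite normrM -mulrA; apply: (ler_wpM2l (normr_ge0 c)).
exact: le_trans (cl_le_norm _ A) (HB' x).
Qed.

Lemma zero_inA0 : inA0 rho1 (fun=> clzero R n).
Proof.
have -> : (fun=> clzero R n) = single (clzero R n) 0.
  by rewrite single_clmul; apply/funext => x; rewrite clmul0r.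
exact: single_inA0.
Qed.

(** * Continuous right linear operators *)

Section Linear.
Variable T : (para -> Cl) -> (para -> Cl).
Hypotheses (hT0 : forall f, inA0 rho1 f -> inA0 rho2 (T f)) (hlin : rlinA0 rho1 T).

Lemma linear_add f g x : inA0 rho1 f -> inA0 rho1 g ->
  T (fun y => cladd (f y) (g y)) x = cladd (T f x) (T g x).
Proof. by move=> hf hg; exact: hlin.1. Qed.

Lemma linear_clmul f a x : inA0 rho1 f -> T (fun y => clmul (f y) a) x = clmul (T f x) a.
Proof. by move=> hf; exact: hlin.2. Qed.

Lemma linear_zero x : T (fun=> clzero R n) x = clzero R n.
Proof.
have -> : (fun=> clzero R n) = (fun y : para => clmul (clzero R n) (clzero R n)).
  by apply/funext => y; rewrite clmul0r.
by rewrite (linear_clmul _ _ zero_inA0) clmul0r.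
Qed.

(** A real scalar acts as right multiplication by [s] times the unit, so right linearity contains
    real homogeneity. *)
Lemma linear_scale f (s : R) x : inA0 rho1 f -> T (fun y => clscale s (f y)) x = clscale s (T f x).
Proof.
move=> hf; have -> : (fun y => clscale s (f y)) = fun y => clmul (f y) (clscale s cl1).
  by apply/funext => y; rewrite clmul_scaler clmulr1.
by rewrite linear_clmul// clmul_scaler clmulr1.
Qed.

Lemma linear_fsub f g : inA0 rho1 f -> inA0 rho1 g -> fsub (T g) (T f) = T (fsub g f).
Proof.
move=> hf hg; have hgf := inA0_fsub hg hf.
apply/funext => x; apply/ffunP => A; rewrite fsubE.
have {1}-> : g = fun y => cladd (fsub g f y) (f y).
  by apply/funext => y; apply/ffunP => B; rewrite claddE fsubE subrK.
by rewrite linear_add// claddE addrK.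
Qed.

Lemma taylor_inA0 a N : inA0 rho1 (taylor a N).
Proof.
elim: N => [|N IH].
  rewrite (_ : taylor a 0 = fun=> clzero R n); first exact: zero_inA0.
  by apply/funext => x; apply/ffunP => A; rewrite !ffunE big_ord0.
have -> : taylor a N.+1 = fun x => cladd (taylor a N x) (clscale 1 (single (taylor_coef a N) N x)).
  apply/funext => x; apply/ffunP => A; rewrite clscale1 claddE [in RHS]single_clmul.
  by rewrite [LHS]ffunE [taylor a N x _]ffunE big_ord_recr.
exact: inA0_lin IH (single_inA0 _ _).
Qed.

Lemma linear_taylor a N x :
  T (taylor a N) x = clsum N (fun k => clmul (T (single cl1 k) x) (taylor_coef a k)).
Proof.
elim: N => [|N IH].
  rewrite (_ : taylor a 0 = fun=> clzero R n).
    by rewrite linear_zero; apply/ffunP => A; rewrite !ffunE big_ord0.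
  by apply/funext => y; apply/ffunP => A; rewrite !ffunE big_ord0.
have -> : taylor a N.+1 = fun x => cladd (taylor a N x) (clmul (single cl1 N x) (taylor_coef a N)).
  apply/funext => y; apply/ffunP => A; rewrite claddE.
  by rewrite [LHS]ffunE [taylor a N y _]ffunE big_ord_recr.
rewrite linear_add; [|exact: taylor_inA0|by rewrite -single_clmul; exact: single_inA0].
rewrite (linear_clmul _ _ (single_inA0 _ _)) IH.
by apply/ffunP => A; rewrite claddE [RHS]ffunE big_ord_recr [X in X + _]ffunE.
Qed.

Hypothesis hcont : contA0 rho1 rho2 T.

(** Continuity at the zero function with tolerance 1, made homogeneous by rescaling g. *)
Lemma linear_bound (e2 : R) : 0 < e2 -> exists e1 K : R, [/\ 0 < e1, 0 < K &
  forall g B, 0 < B -> inA0 rho1 g -> wbound rho1 e1 B g -> wbound rho2 e2 (K * B) (T g)].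
Proof.
move=> e20; have [e1 [eta [e10 [eta0 H]]]] := hcont zero_inA0 e20 ltr01.
exists e1, (2 / eta); split; [exact: e10|exact: divr_gt0|] => g B B0 hg gB.
(* Scaling the norm down to [eta / 2] meets the strict inequality demanded by continuity. *)
pose s := eta / 2 / B; have s0 : 0 < s by rewrite !divr_gt0.
have hsg : inA0 rho1 (fun y => clscale s (g y)).
  have -> : (fun y => clscale s (g y)) = fun y => cladd (clzero R n) (clscale s (g y)).
    by apply/funext => y; apply/ffunP => A; rewrite claddE [clzero _ _ _]ffunE add0r.
  exact: inA0_lin zero_inA0 hg.
have fsub0 (h : para -> Cl) : fsub h (fun=> clzero R n) = h.
  by apply/funext => x; apply/ffunP => A; rewrite fsubE [clzero _ _ _]ffunE subr0.
have T0 : T (fun=> clzero R n) = fun=> clzero R n by apply/funext => x; exact: linear_zero.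
have := H _ hsg; rewrite T0 !fsub0 => /(_ _)/ltW/wnorm_leP HT.
have /HT {}HT : (wnorm rho1 e1 (fun y => clscale s (g y)) < eta%:E)%E.
  apply: (@le_lt_trans _ _ (eta / 2)%:E); last by rewrite lte_fin; lra.
  apply/wnorm_leP => x; rewrite clnorm_scale ?(ltW s0)//.
  have -> : eta / 2 = s * B by rewrite divfK// gt_eqF.
  rewrite -[leRHS]mulrA ler_pM2l//; exact: gB.
move=> x; have := HT x; rewrite linear_scale// clnorm_scale ?(ltW s0)// mul1r.
rewrite mulrC -ler_pdivlMr// => /le_trans; apply.
rewrite le_eqVlt; apply/orP; left; apply/eqP; rewrite /s.
by field; rewrite (gt_eqF eta0) (gt_eqF B0).
Qed.

Lemma symbol_ucond p : (forall k, entire_family (p k)) -> (forall k, T (single cl1 k) = slice_series (p k)) ->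
  ucond rho2 rhohat rinf1 (fun l => slice_fun (symbol p l)).
Proof.
move=> ep Tp; split; first by move=> l; apply: slice_fun_SM; exact: holo_symbol.
(* The symbol is a sum of products of an image p_i with a power of -x; each factor is allowed half
   of the type. *)
move=> sig sig0; pose e2 := sig / 2; have e20 : 0 < e2 by exact: divr_gt0.
have [e1 [K [e10 K0 HK]]] := linear_bound e20.
have [Y [D1 [Y0 D10 HY]]] := single_bound e10.
have [K6 K60 H6] := pw_hat_le.
have K61 : 0 < K6 + 1 by rewrite ltr_wpDl.
pose e := e2 / (K6 + 1); have e0 : 0 < e by exact: divr_gt0.
have eK : e * K6 <= e2 by rewrite /e mulrAC ler_pdivrMr// ler_wpM2l ?(ltW e20)// lerDl.
have [C2 [D2 [C20 D20 HD]]] := monomial_bound hhat e0.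
pose bl := blades R n; have bl1 : 1 <= bl := blades_ge1 R n.
have bl0 : 0 < bl := lt_le_trans ltr01 bl1.
have bl10 : 0 < 1 + bl by rewrite addr_gt0.
have Y10 : 0 < Y + 1 by rewrite ltr_wpDl.
pose D := D1 + D2; have D0 : 0 < D by rewrite addr_gt0.
pose F k := phi rhohat k%:R ^+ k; have F0 k : 0 < F k := phiX_gt0 hhat k.
pose Z1 := (1 + bl) * (K * (Y + 1)); have Z10 : 0 < Z1 by rewrite mulr_gt0// mulr_gt0.
pose Z2 := C2 * expR e2; have Z20 : 0 < Z2 by rewrite mulr_gt0// expR_gt0.
pose E x := expR (e2 * pw rho2 (pnorm x)).
have bp k A x : normc (ps (p k A) (slice_coord x)) <= Z1 * D ^+ k * F k * E x.
  have hP : holo_family (fun A => ps (p k A)) by exact: holo_ps (ep k).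
  have S x0 : wbound rho2 e2 (K * ((Y + 1) * D ^+ k * F k)) (slice_series (p k)).
    rewrite -Tp; apply: HK; [|exact: single_inA0|].
      by rewrite mulr_gt0// mulr_gt0// exprn_gt0.
    apply: wbound_le (HY cl1 1 k _).
      rewrite mulr1; apply: (ler_wpM2r (ltW (F0 k))); apply: ler_pM => //.
      - exact: exprn_ge0 (ltW D10).
      - by rewrite lerDl.
      - by apply: lerXn2r; rewrite ?nnegrE ?(ltW D10) ?(ltW D0)// /D lerDl ltW.
    by move=> A'; rewrite ffunE; case: (_ == _); rewrite ?normr1 ?normr0.
  apply: le_trans (family_le n_gt0 (z := slice_coord x) hP _ A) _.
    move=> y; rewrite normc_slice_coord => yx; have := S x y; rewrite yx; exact.
  by rewrite /Z1 /E le_eqVlt; apply/orP; left; apply/eqP; ring.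
have bz m x : normc (slice_coord x) ^+ m <= Z2 * D ^+ m * F m * E x.
  rewrite normc_slice_coord; have x0 := pnorm_ge0 x.
  have := HD m _ x0; rewrite mulNr expRN ler_pdivrMr; last exact: expR_gt0.
  move=> /le_trans; apply.
  apply: (@le_trans _ _ (C2 * D ^+ m * F m * (expR e2 * E x))); last first.
    by rewrite /Z2 le_eqVlt; apply/orP; left; apply/eqP; ring.
  apply: ler_pM; [|exact: expR_ge0| |].
  - by apply: mulr_ge0 (ltW (F0 m)); apply: mulr_ge0 (ltW C20) _; exact: exprn_ge0 (ltW D20).
  - apply: (ler_wpM2r (ltW (F0 m))); apply: (ler_wpM2l (ltW C20)).
    by apply: lerXn2r; rewrite ?nnegrE ?(ltW D20) ?(ltW D0)// /D lerDr ltW.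
  - rewrite -expRD ler_expR; apply: (@le_trans _ _ (e * (K6 * (pw rho2 (pnorm x) + 1)))).
      by apply: (ler_wpM2l (ltW e0)); exact: H6.
    rewrite mulrA mulrDr mulr1 addrC; apply: lerD => //.
    by apply: (ler_wpM2r (pw_ge0 _ _)).
have rinf0 := prox_rinf_gt0 h1.
pose kap := powR (expR 1 * rinf1) rinf1^-1.
have kap0 : 0 < kap by rewrite powR_gt0 ?mulr_gt0 ?expR_gt0.
have kD0 : 0 < 2 * D * kap by rewrite mulr_gt0// mulr_gt0.
(* The base collects 2 from the sum of the binomial coefficients, the common base [D] of the two
   monomial bounds, and [kap] to undo the denominator of G_l. *)
exists (2 * D * kap), (bl * (1 + bl) * (Z1 * Z2)); split; [exact: kD0|split].
  by rewrite mulr_gt0// mulr_gt0.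
move=> l; apply/wnorm_leP => x.
have f0 : 0 < l`!%:R :> R by rewrite ltr0n fact_gt0.
(* Writing [2 ^+ l] as the sum of the binomial coefficients allows a comparison term by term with
   the symbol. *)
rewrite [leRHS](_ : _ = bl * (1 + bl) *
  \sum_(i < l.+1) 'C(l, i)%:R / l`!%:R * (Z1 * Z2 * D ^+ l * F l * (E x * E x))); last first.
  rewrite -mulr_suml -mulr_suml sum_bin Gcoef_phi -/kap -/(F l) /E -expRD -mulrDl -splitr.
  have k1 : kap ^+ l != 0 by rewrite expf_neq0 ?gt_eqF.
  by rewrite !exprMn; field; rewrite k1 gt_eqF.
apply: slice_fun_le => A.
apply: le_trans (normc_sum _ _ _) _; apply: ler_sum => i _.
rewrite normcM normc_real ger0_norm; last exact: divr_ge0.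
apply: ler_wpM2l; first exact: divr_ge0.
rewrite normcM ps_negpow normcX normcN.
have il : (i <= l)%N by rewrite -ltnS.
apply: (@le_trans _ _ (Z2 * D ^+ (l - i) * F (l - i)%N * E x * (Z1 * D ^+ i * F i * E x))).
  apply: ler_pM; [|exact: normc_ge0|exact: bz|exact: bp].
  by apply: exprn_ge0; exact: normc_ge0.
(* This supermultiplicativity merges the bounds for p_i and for the power l - i into the single
   [phi(l) ^ l] of G_l. *)
have FF : F i * F (l - i)%N <= F l by have := phiX_mul hhat i (l - i); rewrite subnKC.
have -> : D ^+ l = D ^+ i * D ^+ (l - i) by rewrite -exprD subnKC.
have W0 : 0 <= Z1 * Z2 * (D ^+ i * D ^+ (l - i)) * (E x * E x).
  apply: mulr_ge0; last by apply: mulr_ge0; exact: expR_ge0.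
  by apply: mulr_ge0; apply: mulr_ge0; rewrite ?(ltW Z10) ?(ltW Z20)//; exact: exprn_ge0 (ltW D0).
move: (ler_wpM2l W0 FF); congr (_ <= _); ring.
Qed.

(** The identity is exact as soon as [M >= N]. The right coefficients of the polynomial only enter
    through the twisted convolution, so the inversion takes place separately in each blade A of
    p. *)
Lemma symbol_psum p a N M x : (forall k, entire_family (p k)) -> (forall k, T (single cl1 k) = slice_series (p k)) ->
  (N <= M)%N -> psum (fun l => slice_fun (symbol p l)) (taylor a N) M x = T (taylor a N) x.
Proof.
move=> ep Tp NM; rewrite linear_taylor taylor_slice_series /psum.
set b := fun A : blade => _; have eb : entire_family b by exact: trunc_entire.
have -> : (fun l => starL (slice_fun (symbol p l)) (dx0n l (slice_series b)) x) =
    fun l => slice_fun (star_family (symbol p l) (fun A => ps (dseqn l b A))) x.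
  apply/funext => l; rewrite /slice_series dx0n_ps// starL_slice_fun//; first exact: holo_symbol.
  by apply: holo_ps; exact: entire_dseqn.
rewrite -slice_fun_sum.
have -> : (fun k => clmul (T (single cl1 k) x) (taylor_coef a k)) = fun k =>
    slice_value (fun C => \sum_A (clsign R A (symdiff A C) * taylor_coef a k (symdiff A C))%:C%C * ps (p k A) (slice_coord x)) x.
  by apply/funext => k; rewrite Tp slice_value_clmul.
rewrite -slice_value_sum; congr slice_value; apply/funext => C; rewrite /star_family.
rewrite exchange_big [RHS]exchange_big/=; apply: eq_bigr => A _; rewrite -mulr_sumr.
rewrite (@symbol_inversion R n p (b (symdiff A C)) N)//; last first.
  by move=> k; rewrite leqNgt /b => /negbTE ->.
rewrite mulr_sumr; apply: eq_bigr => k _.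
by rewrite mulrA -rmorphM/= /b ltn_ord ffunE.
Qed.

Lemma representation : exists u, ucond rho2 rhohat rinf1 u /\
  forall f, inA0 rho1 f -> cvgA0 rho2 (psum u f) (T f).
Proof.
have /choice [p Hp] : forall k, exists p, entire_family p /\ T (single cl1 k) = slice_series p.
  move=> k; have [/(SM_coef n_gt0)[p ep [-> _]] _] := (inA0P rho2 _).1 (hT0 (single_inA0 cl1 k)).
  by exists p.
have ep k : entire_family (p k) by have [] := Hp k.
have Tp k : T (single cl1 k) = slice_series (p k) by have [] := Hp k.
have hu := symbol_ucond ep Tp; set u := fun l => _ in hu.
exists u; split => // f hf.
have [T' [TSM HT]] := operator_bound hu; have [uSM _] := hu.
suff -> : T f = T' f by exact: operator_cvg HT f hf.
have [a ea [_ Ha]] := taylor_cvg hf.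
have T'taylor N : T' (taylor a N) = T (taylor a N).
  apply/funext => x; apply/ffunP => A; apply/eqP; rewrite -subr_eq0 -normr_eq0 eq_le normr_ge0 andbT.
  have [e [C [e0 C0 HC]]] := HT 1 ltr01.
  have [_ fb] := (inA0P rho1 _).1 (taylor_inA0 a N); have [B B0 HB] := fb e e0.
  apply: (@le_half_limit _ _ _ (C * B * expR (1 * pw rho2 (pnorm x)))) => M; rewrite add0r.
  (* The index [maxn N M] is at least N, where the partial sum already equals [T (taylor a N)], and
     at least M, where it is within [2 ^ -M] of [T' (taylor a N)], up to a constant. *)
  have := HC _ _ (taylor_inA0 a N) HB (maxn N M) x.
  move=> /(le_trans (cl_le_norm _ A)); rewrite fsubE symbol_psum ?leq_maxl// distrC.
  move=> /le_trans; apply; rewrite mulrAC; apply: ler_wpM2l.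
    by apply: mulr_ge0 (expR_ge0 _); exact: mulr_ge0.
  by apply: ler_wiXn2l; rewrite ?invr_ge0 ?invf_le1 ?ler1n ?leq_maxr.
(* T and T' agree on Taylor polynomials, and a single target seminorm, of type 1, already separates
   points; both distances to the common value decay like [2 ^ -N]. *)
have [e1 [K [e10 K0 HK]]] := linear_bound ltr01.
have [e2 [C [e20 C0 HC]]] := operator_diff uSM HT ltr01.
have [E1 [E10 HE1]] := Ha e1 e10; have [E2 [E20 HE2]] := Ha e2 e20.
apply/funext => x; apply/ffunP => A; apply/eqP; rewrite -subr_eq0 -normr_eq0 eq_le normr_ge0 andbT.
set X := expR (1 * pw rho2 (pnorm x)).
apply: (@le_half_limit _ _ _ (K * E1 * X + C * E2 * X)) => N; rewrite add0r.
have htN := taylor_inA0 a N.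
have q0 : 0 < E1 * 2^-1 ^+ N by rewrite mulr_gt0// exprn_gt0// invr_gt0.
have b1 := HK _ _ q0 (inA0_fsub htN hf) (HE1 N) x.
have b2 := HC _ _ _ hf htN (HE2 N) x.
rewrite -linear_fsub// in b1; rewrite T'taylor in b2.
have {}b1 := le_trans (cl_le_norm _ A) b1; have {}b2 := le_trans (cl_le_norm _ A) b2.
rewrite !fsubE -/X in b1 b2; rewrite mulrDl; move: b1 b2.
have -> : K * (E1 * 2^-1 ^+ N) * X = K * E1 * X * 2^-1 ^+ N by ring.
have -> : C * (E2 * 2^-1 ^+ N) * X = C * E2 * X * 2^-1 ^+ N by ring.
rewrite !ler_norml.
move: (T (taylor a N) x A) (T f x A) (T' f x A) (K * _ * _ * _) (C * _ * _ * _) => *; lra.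
Qed.

End Linear.
End Convergence.

Theorem theorem4p4 (R : realType) (n : nat) (hn : (0 < n)%N)
  (rho1 rho2 rhohat1 : R -> R) (rinf1 rinf2 : R)
  (h1 : prox_order rho1 rinf1) (h2 : prox_order rho2 rinf2)
  (hO : exists C : R, \forall r \near +oo, powR r (rho1 r) <= C * powR r (rho2 r))
  (hhat : normalized_prox_order rhohat1 rinf1)
  (hhat_eq : \forall r \near +oo, rhohat1 r = rho1 r) :
  (* (a) *)
  (forall u : nat -> para R n -> Cl R n, ucond rho2 rhohat1 rinf1 u ->
     exists T : (para R n -> Cl R n) -> (para R n -> Cl R n),
       (forall f, inA0 rho1 f -> inA0 rho2 (T f) /\ cvgA0 rho2 (psum u f) (T f)) /\
       contA0 rho1 rho2 T) /\
  (* (b) *)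
  (forall T : (para R n -> Cl R n) -> (para R n -> Cl R n),
     (forall f, inA0 rho1 f -> inA0 rho2 (T f)) ->
     rlinA0 rho1 T -> contA0 rho1 rho2 T ->
     exists u : nat -> para R n -> Cl R n, ucond rho2 rhohat1 rinf1 u /\
       forall f, inA0 rho1 f -> cvgA0 rho2 (psum u f) (T f)).
Proof.
split => [u hu|T hT0 hlin hcont]; last exact: (representation hn h1 h2 hO hhat hhat_eq hT0 hlin hcont).
have [T [TSM HT]] := operator_bound hn h1 h2 hO hhat hhat_eq hu; have [uSM _] := hu.
exists T; split; last exact: (operator_cont hn uSM HT).
by move=> f hf; split; [exact: (operator_inA0 TSM HT)|exact: (operator_cvg HT)].
Qed.
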